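(* Let $n\ge3$, let $\mathcal C\subset\mathbb R^{n+1}$ be the $n$-dimensional catenoid (with parameter $h_0>0$), and let $R>h_0$. Let $RMJF_{\mathcal C}$ be the space of Jacobi fields on $\mathcal C$ generated by rigid motions of $\mathbb R^{n+1}$ (translations, scalings and rotations). Then the only Jacobi fields in $RMJF_{\mathcal C}$ which lie in $W^{1,2}(\mathcal C)$, or in $W^{1,2}_{\omega_{\mathcal C,R}}(\mathcal C)$, are those generated by translations parallel to the hyperplane $\{x_{n+1}=0\}$; that is, $$RMJF_{\mathcal C}\cap W^{1,2}(\mathcal C)=RMJF_{\mathcal C}\cap W^{1,2}_{\omega_{\mathcal C,R}}(\mathcal C)=\operatorname{span}\{f_1,\dots,f_n\},\qquad f_i(y)=\langle\nu(y),e_i\rangle .$$ In particular $$n\le\mathrm{nul}(\mathcal C)\le\mathrm{nul}_{\omega_{\mathcal C,R}}(\mathcal C).$$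
   Context: **Catenoid.** For $h_0>0$ set $a=h_0^{-2(n-1)}$ and $s(h)=\int_{h_0}^h\frac{d\tau}{(a\tau^{2(n-1)}-1)^{1/2}}$ for $h\ge h_0$; this is an increasing map of $[h_0,\infty)$ onto $[0,s_\infty)$ with $s_\infty<\infty$. Let $h:[0,s_\infty)\to[h_0,\infty)$ be its inverse, extended smoothly as an even function to $(-s_\infty,s_\infty)$. The catenoid $\mathcal C$ is the image of the embedding $F:(-s_\infty,s_\infty)\times S^{n-1}\to\mathbb R^{n+1}$, $F(s,w)=(h(s)w,s)$, where $S^{n-1}\subset\mathbb R^n$ is the unit sphere. Its unit normal at $y=F(s,w)$ is $\nu(y)=\frac{(w,-h'(s))}{(1+h'(s)^2)^{1/2}}$. $e_1,\dots,e_{n+1}$ is the standard basis of $\mathbb R^{n+1}$. **Jacobi fields.** Jacobi fields are the $f\in C^\infty(\mathcal C)$ with $\Delta_{\mathcal C}f+|A_{\mathcal C}|^2f=0$. $RMJF_{\mathcal C}$ is the linear span of: the translation fields $\langle\nu(y),e_i\rangle$, $i=1,\dots,n+1$; the scaling field $\langle\nu(y),y\rangle$; and the rotation fields $\langle\nu(y),Qy\rangle$, for $Q$ a real $(n+1)\times(n+1)$ matrix with $Q^T=-Q$. **Weights and nullities.** $\omega_{\mathcal C,R}(y)=R^{-2}$ for $y\in\mathcal C$ with $|y|<R$ and $\omega_{\mathcal C,R}(y)=|y|^{-2}$ for $y\in\mathcal C$ with $|y|\ge R$. $W^{1,2}_{\omega_{\mathcal C,R}}(\mathcal C)=\{f\in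 L^1_{\mathrm{loc}}(\mathcal C):|\nabla f|\in L^2(\mathcal C),\ f^2\omega_{\mathcal C,R}\in L^1(\mathcal C)\}$. $\mathrm{nul}(\mathcal C)$ and $\mathrm{nul}_{\omega_{\mathcal C,R}}(\mathcal C)$ are the dimensions of the spaces of Jacobi fields on $\mathcal C$ lying in $W^{1,2}(\mathcal C)$ and in $W^{1,2}_{\omega_{\mathcal C,R}}(\mathcal C)$, respectively. *)

(* Defs.v *)
From HB Require Import structures.
From mathcomp Require Import all_boot all_order all_algebra.
From mathcomp Require Import all_classical all_reals all_analysis.

Set Implicit Arguments.
Unset Strict Implicit.
Unset Printing Implicit Defensive.
Import Order.TTheory GRing.Theory Num.Theory.
Import numFieldNormedType.Exports.
Local Open Scope classical_set_scope.
Local Open Scope ring_scope.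

Section LinearAlgebra.
Context {R : realType}.

Definition lspan {V : lmodType R} (S : set V) : set V :=
  [set v | exists k : nat, exists c : 'I_k -> R, exists g : 'I_k -> V,
     (forall i, S (g i)) /\ v = \sum_(i < k) c i *: g i].

Definition is_basis {V : lmodType R} (S : set V) (k : nat) (b : 'I_k -> V) :=
  [/\ forall i, S (b i),
      forall c : 'I_k -> R, \sum_(i < k) c i *: b i = 0 -> forall i, c i = 0
    & S `<=` lspan (range b)].

(* Dimension of a linear subspace S, in {0, 1, ..., +oo}: the set below is the
   singleton of the common size of all finite bases of S, or is empty, with
   infimum +oo, when S has no finite basis. *)
Definition dimension {V : lmodType R} (S : set V) : \bar R :=
  ereal_inf [set (k%:R)%:E | k in
               [set k : nat | exists b : 'I_k -> V, is_basis S b]].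

(* The canonical norm of 'rV[R]_m in the library is the sup norm, hence the
   explicit Euclidean structure. *)
Definition dotp m (u v : 'rV[R]_m) : R := \sum_(i < m) u 0 i * v 0 i.
Definition enorm m (u : 'rV[R]_m) : R := Num.sqrt (dotp u u).
Definition evec m (i : 'I_m) : 'rV[R]_m := delta_mx 0 i.

End LinearAlgebra.

Section Calculus.
Context {R : realType} {m : nat}.

Definition partial (i : 'I_m) (g : 'rV[R]_m -> R^o) : 'rV[R]_m -> R^o :=
  fun x => 'D_(evec i) g x.

(* g is C^oo on the open set U: every iterated partial derivative of g exists
   and is differentiable at every point of U. *)
Definition smooth_on (U : set 'rV[R]_m) (g : 'rV[R]_m -> R^o) : Prop :=
  forall (l : seq 'I_m) (x : 'rV[R]_m), U x ->
    differentiable (foldr partial g l) x.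

End Calculus.

Section SigmaFiniteProduct.
Context d1 d2 (T1 : measurableType d1) (T2 : measurableType d2) (R : realType).
Variables (m1 : {sigma_finite_measure set T1 -> \bar R})
          (m2 : {sigma_finite_measure set T2 -> \bar R}).

(* An alias of the product measure, carrying the sigma-finite structure that
   the library declares on it but does not infer. *)
Definition prod_meas : set (T1 * T2)%type -> \bar R := (m1 \x m2)%E.

HB.instance Definition _ := Measure.on prod_meas.

Fact prod_meas_sigma_finite : sigma_finite setT prod_meas.
Proof.
have /sigma_finiteP[F [TF ndF Foo]] := sigma_finiteT m1.
have /sigma_finiteP[G [TG ndG Goo]] := sigma_finiteT m2.
exists (fun k => F k `*` G k).
  rewrite -setXTT TF TG predeqE => -[x y]; split.
    move=> [/= [k _ Fkx] [l _ Gly]]; exists (maxn k l) => //; split.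
    - by move: x Fkx; exact/subsetPset/ndF/leq_maxl.
    - by move: y Gly; exact/subsetPset/ndG/leq_maxr.
  by move=> [k _ []/= ? ?]; split; exists k.
move=> k; have [? ?] := Foo k; have [? ?] := Goo k.
split; first exact: measurableX.
by rewrite /prod_meas product_measure1E// lte_mul_pinfty// ge0_fin_numE.
Qed.

HB.instance Definition _ :=
  Measure_isSigmaFinite.Build _ _ _ prod_meas prod_meas_sigma_finite.

End SigmaFiniteProduct.

(* Lebesgue measure on R^n, as the iterated product measure on
   R * (R * (... * unit)); ms_crd lists the coordinates of a point. *)
Record meas_space (R : realType) := MeasSpace {
  ms_disp : measure_display;
  ms_type : measurableType ms_disp;
  ms_meas : {sigma_finite_measure set ms_type -> \bar R};
  ms_crd : ms_type -> nat -> R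
}.

Fixpoint leb (R : realType) (n : nat) : meas_space R :=
  if n isn't n'.+1 then
    @MeasSpace R _ unit (dirac tt : {sigma_finite_measure set unit -> \bar R})
      (fun _ _ => 0)
  else
    let L := leb R n' in
    @MeasSpace R _ (measurableTypeR R * ms_type L)%type
      (prod_meas (@lebesgue_measure R) (ms_meas L))
      (fun p i => if i is i'.+1 then ms_crd p.2 i' else p.1).

Definition leb_row (R : realType) n (x : ms_type (leb R n)) : 'rV[R]_n :=
  \row_(i < n) ms_crd x i.

Section Catenoid.
Context {R : realType}.
Variables (n : nat) (h0 : R).

(* A point of R^(n+1) is a row y : 'rV_(n + 1); hpart y : 'rV_n consists of its
   first n coordinates and vpart y is the last one. *)
Definition hpart (y : 'rV[R]_(n + 1)) : 'rV[R]_n := lsubmx y.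
Definition vpart (y : 'rV[R]_(n + 1)) : R := rsubmx y 0 0.

Definition cat_a : R := (h0 ^+ (2 * n.-1))^-1.

Definition cat_s (u : R) : R :=
  \int[@lebesgue_measure R]_(tau in `[h0, u])
     (Num.sqrt (cat_a * tau ^+ (2 * n.-1) - 1))^-1.

Definition s_infty : \bar R :=
  ereal_sup [set (cat_s u)%:E | u in [set u | h0 <= u]].

Definition cat_dom : set R := [set t | (`|t|%:E < s_infty)%E].

(* The inverse of cat_s, extended evenly. *)
Definition cat_h : R -> R^o :=
  fun t => get [set u : R | h0 <= u /\ cat_s u = `|t|].

Definition usphere : set 'rV[R]_n := [set w | enorm w = 1].

Definition catF (t : R) (w : 'rV[R]_n) : 'rV[R]_(n + 1) :=
  row_mx (cat_h t *: w) (t%:M).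

Definition catenoid : set 'rV[R]_(n + 1) :=
  [set catF t w | t in cat_dom & w in usphere].

(* At y = F(t,w) the direction hpart y / |hpart y| is w. *)
Definition udir (x : 'rV[R]_n) : 'rV[R]_n := (enorm x)^-1 *: x.

Definition cat_nu (y : 'rV[R]_(n + 1)) : 'rV[R]_(n + 1) :=
  let h' := derive1 cat_h (vpart y) in
  (Num.sqrt (1 + h' ^+ 2))^-1 *: row_mx (udir (hpart y)) ((- h')%:M).

(* Functions and vector fields on the catenoid C are represented by functions
   on R^(n+1), of which only the values on C matter. C is a smooth retract of
   the open set cat_nbhd, through cat_retr: for f on C, f \o cat_retr is an
   extension of f to cat_nbhd, and f is C^oo on C iff this extension is C^oo.
   The tangential derivatives of f on C are those of any extension of f. *)
Definition cat_nbhd : set 'rV[R]_(n + 1) :=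
  [set y | cat_dom (vpart y) /\ hpart y != 0].

Definition cat_retr (y : 'rV[R]_(n + 1)) : 'rV[R]_(n + 1) :=
  catF (vpart y) (udir (hpart y)).

Definition smooth_C (f : 'rV[R]_(n + 1) -> R^o) : Prop :=
  smooth_on cat_nbhd (f \o cat_retr).

(* Orthogonal projection of the gradient of the extension onto the tangent
   space: v *m (1 - nu^T nu) = v - <v, nu> nu. *)
Definition tgrad (f : 'rV[R]_(n + 1) -> R^o) (y : 'rV[R]_(n + 1)) :
    'rV[R]_(n + 1) :=
  (\row_i partial i (f \o cat_retr) y)
    *m (1%:M - (cat_nu y)^T *m cat_nu y).

Definition tpartial (i : 'I_(n + 1)) (f : 'rV[R]_(n + 1) -> R^o) :
    'rV[R]_(n + 1) -> R^o :=
  fun y => tgrad f y 0 i.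

(* For X tangential this is the Riemannian divergence of X on C. *)
Definition div_C (X : 'rV[R]_(n + 1) -> 'rV[R]_(n + 1)) :
    'rV[R]_(n + 1) -> R^o :=
  fun y => \sum_i tpartial i (fun z => X z 0 i) y.

Definition laplace_C (f : 'rV[R]_(n + 1) -> R^o) : 'rV[R]_(n + 1) -> R^o :=
  div_C (tgrad f).

(* |A|^2 = sum_i |D_{tau_i} nu|^2 for an orthonormal frame tau_i of the tangent
   space, i.e. the squared Hilbert-Schmidt norm of the tangential derivative of
   the unit normal. *)
Definition A2 : 'rV[R]_(n + 1) -> R^o :=
  fun y => \sum_i \sum_j (tpartial i (fun z => cat_nu z 0 j) y) ^+ 2.

(* Functions on C are normalized to vanish outside C, so that equality, linear
   combinations and dimensions are those of functions on C. *)
Definition jacobi_fields : set ('rV[R]_(n + 1) -> R^o) :=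
  [set f | [/\ forall y, ~ catenoid y -> f y = 0, smooth_C f
            & forall y, catenoid y -> laplace_C f y + A2 y * f y = 0]].

Definition normal_field (V : 'rV[R]_(n + 1) -> 'rV[R]_(n + 1)) :
    'rV[R]_(n + 1) -> R^o :=
  fun y => if y \in catenoid then dotp (cat_nu y) (V y) else 0.

Definition transl_field (i : 'I_(n + 1)) := normal_field (fun=> evec i).
Definition scaling_field := normal_field id.
Definition rot_field (Q : 'M[R]_(n + 1)) :=
  normal_field (fun y => (Q *m y^T)^T).

Definition RMJF : set ('rV[R]_(n + 1) -> R^o) :=
  lspan (range transl_field `|` [set scaling_field] `|`
         [set rot_field Q | Q in [set Q : 'M[R]_(n + 1) | Q^T = - Q]]).

(* Integration over C against its n-dimensional area. The induced metric is
   (1 + h'^2) dt^2 + h^2 g_S, so the area element is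
   h^(n-1) (1 + h'^2)^(1/2) dt dsigma(w), with sigma the surface measure of
   S^(n-1), for which \int g dsigma = n \int_{0<|x|<1} g(x/|x|) dx. *)
Definition par_dom : set (measurableTypeR R * ms_type (leb R n)) :=
  [set p | cat_dom p.1 /\ 0 < enorm (leb_row p.2) < 1].

Definition par_density (t : R) : R :=
  n%:R * cat_h t ^+ n.-1 * Num.sqrt (1 + (derive1 cat_h t) ^+ 2).

Definition par_pull (g : 'rV[R]_(n + 1) -> R)
    (p : measurableTypeR R * ms_type (leb R n)) : R :=
  g (catF p.1 (udir (leb_row p.2))) * par_density p.1.

Definition integrable_C (g : 'rV[R]_(n + 1) -> R) : Prop :=
  (prod_meas (@lebesgue_measure R) (ms_meas (leb R n))).-integrable par_dom
    (EFin \o par_pull g).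

Definition integral_C (g : 'rV[R]_(n + 1) -> R) : R :=
  \int[prod_meas (@lebesgue_measure R) (ms_meas (leb R n))]_(p in par_dom)
    par_pull g p.

Definition L1loc_C (g : 'rV[R]_(n + 1) -> R) : Prop :=
  forall K : set 'rV[R]_(n + 1), compact K -> K `<=` catenoid ->
    integrable_C (fun y => g y * \1_K y).

Definition tangential (X : 'rV[R]_(n + 1) -> 'rV[R]_(n + 1)) : Prop :=
  forall y, catenoid y -> dotp (X y) (cat_nu y) = 0.

Definition test_field (X : 'rV[R]_(n + 1) -> 'rV[R]_(n + 1)) : Prop :=
  [/\ tangential X, forall i, smooth_C (fun y => X y 0 i)
    & exists K : set 'rV[R]_(n + 1), [/\ compact K, K `<=` catenoid
        & forall y, catenoid y -> ~ K y -> X y = 0]].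

Definition weak_grad (f : 'rV[R]_(n + 1) -> R)
    (G : 'rV[R]_(n + 1) -> 'rV[R]_(n + 1)) : Prop :=
  [/\ tangential G, forall i, L1loc_C (fun y => G y 0 i)
    & forall X, test_field X ->
        integral_C (fun y => f y * div_C X y) =
        - integral_C (fun y => dotp (G y) (X y))].

Definition W12 (omega : 'rV[R]_(n + 1) -> R) : set ('rV[R]_(n + 1) -> R^o) :=
  [set f | [/\ L1loc_C f,
      exists2 G, weak_grad f G & integrable_C (fun y => enorm (G y) ^+ 2)
    & integrable_C (fun y => f y ^+ 2 * omega y)]].

Definition weight (Rad : R) (y : 'rV[R]_(n + 1)) : R :=
  if enorm y < Rad then Rad ^- 2 else enorm y ^- 2.

Definition nul (omega : 'rV[R]_(n + 1) -> R) : \bar R :=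
  dimension (jacobi_fields `&` W12 omega).

End Catenoid.

Arguments RMJF {R} n h0.
Arguments W12 {R} n h0 omega.
Arguments weight {R} n Rad.
Arguments transl_field {R} n h0 i.
Arguments nul {R} n h0 omega.

(* Main.v *)
(** The catenoid is parametrized by its height [t] and a direction [w], and
    [u = (h0 / h)^(n-1) = 1 / sqrt(1 + h'^2)] is the norm of the horizontal part
    of the unit normal.  The horizontal translation fields are the functions
    [u <c, w>]; since the area density is [n h^(n-1) / u] and
    [u h^(n-1) = h0^(n-1)], their squares are integrable against the area, as are
    those of their tangential gradients.

    On the meridian of direction [w], a field generated by rigid motions is [u E]
    with [E = <v,w> - v0 h' + lambda (h - t h') + (t + h h') <b,w>].  If its
    weighted square is integrable on [C], then by Fubini [(E / h)^2] is integrable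
    in [t] along almost every meridian, whereas [h'] is not integrable near either
    end, being the derivative of the unbounded function [h].  For [<b,w>]
    different from [0], [(E / h)^2] dominates [h'] at the ends; for [b = 0] it
    does so unless [v0 + lambda s_oo = 0] (upper end) and [v0 - lambda s_oo = 0]
    (lower end).  Hence [b = 0] and [v0 = lambda = 0].

    Membership in the Sobolev spaces uses the divergence theorem for compactly
    supported tangential fields.  In the parameters [(x, t)], with [w = x/|x|]
    and [x] in the punctured unit ball, the divergence becomes a Euclidean one of
    a field without radial component, so that a cutoff in [|x|] makes it
    compactly supported and only multiplies its divergence by the cutoff. *)
Require Import Defs.
From mathcomp Require Import all_boot all_order all_algebra.
From mathcomp Require Import all_classical all_reals all_analysis.
From mathcomp Require Import measurable_realfun ring lra.
Set Implicit Arguments.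
Unset Strict Implicit.
Unset Printing Implicit Defensive.
Import Order.TTheory GRing.Theory Num.Theory.
Import numFieldNormedType.Exports.
Local Open Scope classical_set_scope.
Local Open Scope ring_scope.

(** * Derivatives of real functions *)

Section RealDerivative.
Context {R : realType}.
Implicit Types (f g : R -> R) (x c : R).

(** The quotient [E / h] appears because [u ^+ 2] times the area density is the constant
    [n h0^(n-1)], while the weight is at least a multiple of [h^-2]: heights stay below [h0 * pi],
    hence below [pi * h]. The coefficient of [h'] in [E] is [<b,w> h - (v0 + lambda t)], and the
    other terms are of order [h]. For [n >= 3] one has [h^2 <= 2 h0^2 h'] at the upper end once
    [h >= 2 h0], so the slope absorbs these terms, and a bound [|E| >= d h'] gives
    [(E / h)^2 >= (d^2 / (2 h0^2)) h'].

    One good meridian settles [v0] and [lambda]; to exclude a nonzero [b] the meridian must avoid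
    [<b,w> = 0], which is possible since a nonempty open set of directions has positive measure.

    The profile is given only as the inverse of an integral whose integrand blows up at the neck, so
    its derivatives at [t = 0] come from continuous extension and not from the inverse function
    rule. Smoothness means that all iterated partial derivatives are differentiable; it is obtained
    from a finite family of functions whose partial derivatives are polynomials in the family. *)

Definition has_der f x (d : R) := is_derive x 1 (f : R -> R^o) d.

Lemma has_der_eq f x d d' : has_der f x d -> d = d' -> has_der f x d'.
Proof. by move=> ? <-. Qed.

Lemma has_der_continuous f x d : has_der f x d -> {for x, continuous f}.
Proof. by case=> df _; exact/differentiable_continuous/derivable1_diffP. Qed.

Lemma has_der_derive1 f x d : has_der f x d -> derive1 f x = d.
Proof. by move=> df; rewrite derive1E; case: df. Qed.

Lemma has_der_near f g x d :
  (\near x, f x = g x) -> has_der f x d -> has_der g x d.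
Proof. by move=> fg; exact: near_eq_is_derive. Qed.

Lemma has_der_cst c x : has_der (fun=> c) x 0.
Proof. exact: is_derive_cst. Qed.

Lemma has_der_id x : has_der (fun t => t) x 1.
Proof. exact: is_derive_id. Qed.

Lemma has_derN f x df : has_der f x df -> has_der (fun t => - f t) x (- df).
Proof. by move=> *; exact: is_deriveN. Qed.

Lemma has_derB f g x df dg : has_der f x df -> has_der g x dg ->
  has_der (fun t => f t - g t) x (df - dg).
Proof. by move=> *; exact: is_deriveB. Qed.

Lemma has_derM f g x df dg : has_der f x df -> has_der g x dg ->
  has_der (fun t => f t * g t) x (f x * dg + g x * df).
Proof. by move=> *; exact: is_deriveM. Qed.

Lemma has_derZ c f x df : has_der f x df -> has_der (fun t => c * f t) x (c * df).
Proof.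
move=> fd; apply: has_der_eq (has_derM (has_der_cst c x) fd) _.
by rewrite mulr0 addr0.
Qed.

Lemma has_der_comp f g x df dg : has_der f x df -> has_der g (f x) dg ->
  has_der (fun t => g (f t)) x (dg * df).
Proof. by move=> fd gd; exact: (@is_derive1_comp _ g f). Qed.

Lemma has_derV f x df : f x != 0 -> has_der f x df ->
  has_der (fun t => (f t)^-1) x (- df / f x ^+ 2).
Proof.
move=> fx0 [fx1 fE]; split; first exact: derivableV.
by rewrite deriveV// fE -[_ *: _]/(_ * _) mulNr mulrC mulNr.
Qed.

Lemma has_derX k f x df : has_der f x df ->
  has_der (fun t => f t ^+ k) x (k%:R * f x ^+ k.-1 * df).
Proof.
move=> fd; elim: k => [|k IH].
  by apply: has_der_eq (has_der_cst 1 x) _; rewrite !mul0r.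
under [fun t => _]funext do rewrite exprS.
apply: has_der_eq (has_derM fd IH) _ => /=.
by case: k {IH} => [|k]; rewrite ?exprS /= -?[in RHS]natr1; ring.
Qed.

Lemma has_der_sqrt f x df : 0 < f x -> has_der f x df ->
  has_der (fun t => Num.sqrt (f t)) x (df / (2 * Num.sqrt (f x))).
Proof.
move=> fx0 fd.
apply: has_der_eq (has_der_comp fd (is_derive1_sqrt fx0)) _.
by rewrite mulrC.
Qed.

End RealDerivative.

Lemma measurable_invr (R : realType) : measurable_fun [set: R] (@GRing.inv R).
Proof.
have o0 : open (~` [set (0 : R)]).
  by rewrite openC; apply: accessible_closed_set1; exact: hausdorff_accessible.
rewrite -(setvU [set (0 : R)]); apply/measurable_funU => //.
  by apply: measurableC.
split; last exact: measurable_fun_set1.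
apply: open_continuous_measurable_fun => // x /set_mem/eqP x0.
exact: inv_continuous.
Qed.

Lemma near_norm_lt (R : realType) (V : normedModType R) (x : V) (c : R) :
  `|x| < c -> \forall y \near x, `|y| < c.
Proof. by apply: cvgr_lt; exact: norm_continuous. Qed.

Lemma near_norm_gt (R : realType) (V : normedModType R) (x : V) (c : R) :
  c < `|x| -> \forall y \near x, c < `|y|.
Proof. by apply: cvgr_gt; exact: norm_continuous. Qed.

Lemma near_normr_lt (R : realType) (x c : R) :
  `|x| < c -> \forall y \near x, `|y| < c.
Proof. exact: (@near_norm_lt R R^o). Qed.

Lemma near_normr_gt (R : realType) (x c : R) :
  c < `|x| -> \forall y \near x, c < `|y|.
Proof. exact: (@near_norm_gt R R^o). Qed.

Lemma eq_continuous_for (T U : topologicalType) (f g : T -> U) (x : T) :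
  f =1 g -> {for x, continuous g} -> {for x, continuous f}.
Proof. by move=> /funext ->. Qed.

(** * Dimension *)

Section Dimension.
Context {R : realType} {V : lmodType R}.
Implicit Types (S : set V).

(** A combination in [lspan] may repeat generators; choosing an index for each term and adding the
    coefficients over each index turns it into a sum over [I]. *)
Lemma lspan_range (I : finType) (b : I -> V) v :
  lspan (range b) v <-> exists c : I -> R, v = \sum_i c i *: b i.
Proof.
split=> [[k [c [g [gb ->]]]]|[c ->]].
  have /choice[f fP] : forall i, exists j, b j = g i.
    by move=> i; have [j _ <-] := gb i; exists j.
  exists (fun j => \sum_(i | f i == j) c i).
  rewrite (partition_big f predT)//=; apply: eq_bigr => j _.
  by rewrite scaler_suml; apply: eq_bigr => i /eqP <-; rewrite fP.
exists #|I|, (fun i => c (enum_val i)), (fun i => b (enum_val i)).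
split; first by move=> i; exists (enum_val i).
rewrite (reindex (fun i : 'I_#|I| => enum_val i))//=.
by exists enum_rank => i _; rewrite ?enum_valK ?enum_rankK.
Qed.

Definition independent (k : nat) (b : 'I_k -> V) :=
  forall c : 'I_k -> R, \sum_(i < k) c i *: b i = 0 -> forall i, c i = 0.

(** The coordinates of [v] in [b] form a matrix with trivial left kernel, since a relation between
    its rows is a relation between the vectors [v i]. Its rank is then [m], and it is bounded by the
    number of columns. *)
Lemma independent_le_span m k (v : 'I_m -> V) (b : 'I_k -> V) :
  independent v -> (forall i, lspan (range b) (v i)) -> (m <= k)%N.
Proof.
move=> iv vb.
have /choice[M MP] : forall i, exists c : 'I_k -> R, v i = \sum_j c j *: b j.
  by move=> i; exact/lspan_range.
pose A := \matrix_(i < m, j < k) M i j.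
suff /eqP : row_free A by move=> <-; exact: rank_leq_col.
rewrite -kermx_eq0; apply/eqP/row_matrixP => i; rewrite row0.
set c := row i _; have cA : c *m A = 0.
  by rewrite /c -row_mul mulmx_ker row0.
apply/rowP => j; rewrite [RHS]mxE; apply: (iv (c 0)).
under eq_bigr do rewrite MP scaler_sumr.
rewrite exchange_big big1//= => l _.
under eq_bigr do rewrite scalerA.
rewrite -scaler_suml.
have := congr1 (fun B : 'rV_k => B 0 l) cA; rewrite /= mxE [RHS]mxE => cA0.
rewrite [X in X *: _](_ : _ = 0) ?scale0r// -[RHS]cA0.
by apply: eq_bigr => j0 _; rewrite [A _ _]mxE.
Qed.

Lemma le_dimension_independent S m (v : 'I_m -> V) :
  (forall i, S (v i)) -> independent v -> (m%:R%:E <= dimension S)%E.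
Proof.
move=> Sv iv; apply: le_ereal_inf_tmp => _ [k [b [_ _ Sb]] <-].
rewrite lee_fin ler_nat; apply: (independent_le_span iv) => i.
exact/Sb/Sv.
Qed.

(* Not requiring S1 to be a subspace: a maximal independent family in S1 is a
   basis in the sense of is_basis. *)
Lemma dimension_le S1 S2 : S1 `<=` S2 -> (dimension S1 <= dimension S2)%E.
Proof.
move=> S12; apply: le_ereal_inf_tmp => _ [k [b [_ _ S2b]] <-].
pose P m := `[< exists v : 'I_m -> V, (forall i, S1 (v i)) /\ independent v >].
have P0 : P 0%N.
  by apply/asboolP; exists (fun=> 0); split=> [[]//|c _ []].
have Pk m : P m -> (m <= k)%N.
  move=> /asboolP[v [S1v iv]]; apply: (independent_le_span iv) => i.
  exact/S2b/S12.
have [m Pm mP] := ex_maxnP (ex_intro (fun m => is_true (P m)) _ P0) Pk.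
apply: (@le_trans _ _ (m%:R)%:E); last by rewrite lee_fin ler_nat Pk.
have /asboolP[v [S1v iv]] := Pm.
apply: ereal_inf_lbound; exists m => //; exists v; split=> // x S1x.
apply/lspan_range.
have : ~ exists v : 'I_m.+1 -> V, (forall i, S1 (v i)) /\ independent v.
  by move=> /asboolP/mP; rewrite ltnn.
move/forallNP => /(_ (fun i => oapp v x (unlift ord0 i))).
move=> /not_andP[H|].
  exfalso; apply: H => i; case: (unlift _ _) => //= j; exact: S1v.
move=> /existsNP[c] /not_implyP[].
rewrite big_ord_recl unlift_none/=.
under eq_bigr do rewrite liftK/=.
have [c0|c0] := eqVneq (c ord0) 0.
  rewrite c0 scale0r add0r => /iv ci0 nc; exfalso; apply: nc => i.
  by case: (unliftP ord0 i) => [j|] ->; [exact: ci0|].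
move=> /eqP; rewrite addr_eq0 => /eqP cx _.
exists (fun i => - (c ord0)^-1 * c (lift ord0 i)).
under eq_bigr do rewrite -scalerA.
by rewrite -scaler_sumr scaleNr -scalerN -cx scalerA mulVf// scale1r.
Qed.

End Dimension.

(** * Lebesgue measure on row vectors *)

Section AffineDerivative.
Context {R : realType} {V W X : normedModType R}.
Variables (f : W -> X) (S : V -> W) (a v : V) (w : W).
Hypothesis SE : forall h : R, S (h *: v + a) = h *: w + S a.

Let quotE : (fun h : R => h^-1 *: (((f \o S) \o shift a) (h *: v) - (f \o S) a)) =
  (fun h => h^-1 *: ((f \o shift (S a)) (h *: w) - f (S a))).
Proof. by apply/funext => h /=; rewrite SE. Qed.

(** [S] carries the line through [a] along [v] to the line through [S a] along [w], so the two
    difference quotients are the same function of [h]. *)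
Lemma derive_affine : 'D_v (f \o S) a = 'D_w f (S a).
Proof. by rewrite /derive quotE. Qed.

Lemma derivable_affine : derivable f (S a) w -> derivable (f \o S) a v.
Proof. by rewrite /derivable quotE. Qed.

End AffineDerivative.

Section MeasurableRow.
Context d (T : measurableType d) {R : realType} {N : nat}.
Variable phi : T -> 'rV[R]_N.
Hypothesis mphi : forall i, measurable_fun [set: T] (fun x => phi x 0 i).

Lemma measurable_row_ball y e : measurable (phi @^-1` ball y e).
Proof.
have [e0|e0] := ltP 0 e; last first.
  rewrite (_ : _ @^-1` _ = set0)//; apply/seteqP; split=> x //= -[].
  by rewrite ltNge e0.
rewrite (_ : _ @^-1` _ = \bigcap_(i in [set: 'I_N]) ((fun x => phi x 0 i) @^-1` ball (y 0 i) e)).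
  apply: fin_bigcap_measurable => // i _.
  by rewrite -[X in measurable X]setTI; apply: mphi => //; exact: measurable_ball.
apply/seteqP; split=> x /=; first by move=> [_ xy] i _; exact: xy.
by move=> xy; split=> // i j; rewrite ord1; exact: xy.
Qed.

(** [O] is the union of the balls with rational centre and radius [1 / (k + 1)] that it contains,
    and there are countably many of them; for a single ball, measurability is that of the
    coordinates. *)
Lemma measurable_row_open O : open O -> measurable (phi @^-1` O).
Proof.
move=> oO.
pose B (q : 'rV[rat]_N * nat) : set 'rV[R]_N :=
  ball (map_mx (@ratr R) q.1) (q.2.+1%:R^-1).
pose F (q : 'rV[rat]_N * nat) := if `[< B q `<=` O >] then phi @^-1` B q else set0.
rewrite (_ : phi @^-1` O = \bigcup_q F q).
  apply: countable_bigcupT_measurable => [|q]; first exact: countableP.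
  by rewrite /F; case: ifP => // _; exact: measurable_row_ball.
apply/seteqP; split=> x /= => [Ox|[q _]]; last first.
  by rewrite /F; case: asboolP => // BO; exact: BO.
have [e /= e0 eO] : exists2 e : R, 0 < e & ball (phi x) e `<=` O.
  by have /nbhs_ballP[e e0 eO] := open_nbhs_nbhs (conj oO Ox); exists e.
have [k ke] : exists k : nat, k.+1%:R^-1 < e / 2.
  near \oo => k; exists k; near: k; exact: (near_infty_natSinv_lt (PosNum (divr_gt0 e0 _))).
have k0 : 0 < k.+1%:R^-1 :> R by [].
have /choice[q qP] : forall i : 'I_N, exists q : rat, `|phi x 0 i - ratr q| < k.+1%:R^-1.
  move=> i; have [|q] := @rat_in_itvoo R (phi x 0 i - k.+1%:R^-1) (phi x 0 i + k.+1%:R^-1).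
    by rewrite ltrD2l gtrN.
  rewrite in_itv/= => /andP[H1 H2]; exists q.
  by rewrite distrC ltr_distl H1 H2.
pose Q : 'rV[rat]_N * nat := (\row_i q i, k).
have xQ : B Q (phi x).
  split=> // i j; rewrite ord1 /ball/= !mxE distrC; exact: qP.
exists Q => //; rewrite /F; case: asboolP => // -[] z Qz; apply: eO.
rewrite (splitr e); apply: (@ball_triangle _ _ (map_mx (@ratr R) Q.1)).
  by apply: ball_sym; apply: le_ball xQ; exact: ltW.
by apply: le_ball Qz; exact: ltW.
Unshelve. all: by end_near. Qed.

Lemma measurable_fun_row (U : set 'rV[R]_N) (g : 'rV[R]_N -> R) :
  open U -> (forall y, U y -> {for y, continuous g}) ->
  measurable_fun (phi @^-1` U) (g \o phi).
Proof.
move=> oU cg; apply: (measurability _ (RGenOpens.measurableE R)).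
move=> _ [_ [a [b ->] <-]].
rewrite (_ : _ `&` _ = phi @^-1` (U `&` g @^-1` `]a, b[)).
  apply: measurable_row_open; rewrite openE => y [Uy gy].
  apply: filterI; first exact: open_nbhs_nbhs.
  apply: (cg y Uy); apply: open_nbhs_nbhs.
  by split; [exact: itv_open|exact: gy].
by apply/seteqP; split.
Qed.

Variable mu : {measure set T -> \bar R}.

(** A continuous function is bounded on a closed box, this one vanishes outside, and the preimage of
    the box has finite measure by assumption. *)
Lemma integrable_row_cpt (g : 'rV[R]_N -> R) (M : R) :
  (mu (phi @^-1` [set y : 'rV[R]_N | forall i, `|y 0%R i| < M + 1]%R) < +oo)%E ->
  continuous g -> (forall y : 'rV[R]_N, (exists i, M <= `|y 0 i|) -> g y = 0) ->
  mu.-integrable [set: T] (EFin \o (g \o phi)).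
Proof.
set A := phi @^-1` _ => mA cg g0.
have measA : measurable A.
  rewrite (_ : A = \bigcap_(i in [set: 'I_N]) ((fun x => phi x 0 i) @^-1` ball 0 (M + 1))).
    apply: fin_bigcap_measurable => // i _.
    by rewrite -[X in measurable X]setTI; apply: mphi => //; exact: measurable_ball.
  apply/seteqP; split=> x /= H i; have := H i; rewrite /ball/= sub0r normrN//.
  by apply.
rewrite (_ : EFin \o _ = (EFin \o (g \o phi)) \_ A); last first.
  apply/funext => x; rewrite patchE; case: ifPn => // /negP xA /=.
  rewrite g0//; apply: contrapT => /forallNP H; apply: xA; rewrite inE => i /=.
  by apply: ltr_wpDr => //; rewrite ltNge; apply/negP; exact: H.
apply: (iffLR (integrable_mkcond _ measA)); apply: (@measurable_bounded_integrable _ T R mu (g \o phi) A) => //.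
  have := @measurable_fun_row setT g openT (fun y _ => cg y).
  by rewrite preimage_setT; exact: measurable_funTS.
pose K := [set v : 'rV[R]_N | forall i, `[- (M + 1), M + 1]%classic (v 0 i)].
have cK : compact K by apply: (@rV_compact R N (fun=> `[- (M + 1), M + 1]%classic)) => i;
  exact: segment_compact.
have : compact (g @` K).
  by apply: continuous_compact => //; exact: continuous_subspaceT.
move=> /compact_bounded[B [Br BP]]; exists B; split=> // r Br' x Ax /=.
apply: (BP r Br'); exists (phi x) => // i /=.
have := Ax i; rewrite in_itv/= => /ltW; by rewrite ler_norml.
Qed.

End MeasurableRow.

Section LebesgueRow.
Context {R : realType}.
Local Notation lam n := (ms_meas (leb R n)).

Lemma measurable_ms_crd n i :
  measurable_fun [set: ms_type (leb R n)] (fun x => ms_crd x i).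
Proof.
elim: n i => [|n IH] i /=; first exact: measurable_cst.
case: i => [|i]; first exact: measurable_fst.
exact: (measurableT_comp (IH i) measurable_snd).
Qed.

Lemma measurable_leb_row n i :
  measurable_fun [set: ms_type (leb R n)] (fun x => leb_row x 0 i).
Proof.
rewrite (_ : (fun _ => _) = (fun x => ms_crd x i)); first exact: measurable_ms_crd.
by apply/funext => x; rewrite mxE.
Qed.

(** Cubes serve two opposite purposes: bounded sets have finite measure, and nonempty open sets have
    positive measure. *)
Lemma leb_box n (c : nat -> R) (e : R) : 0 <= e ->
  let B := [set x : ms_type (leb R n) | forall i, (i < n)%N -> `|ms_crd x i - c i| < e] in
  measurable B /\ lam n B = ((2 * e) ^+ n)%:E.
Proof.
move=> e0; elim: n c => [|n IH] c /=.
  rewrite (_ : [set _ | _] = setT); last by apply/seteqP; split.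
  by split=> //; rewrite diracT.
have [mB BE] := IH (fun i => c i.+1); set B := [set x | _] in mB BE.
rewrite (_ : [set x | _] = ball (c 0%N) e `*` B); last first.
  apply/seteqP; split=> -[t x] /=.
    move=> H; split; first by rewrite /ball/= distrC; exact: (H 0%N).
    by move=> i ni; exact: (H i.+1).
  move=> [t0 xB] [|i] /=; first by move: t0; rewrite /ball/= distrC.
  exact: xB.
have mb := measurable_ball (c 0%N) e.
split; first exact: measurableX.
transitivity ((e *+ 2)%:E * ((2 * e) ^+ n)%:E)%E.
  by rewrite -(lebesgue_measure_ball (c 0%N) e0) -BE; exact: product_measure1E.
by rewrite -EFinM exprS mulr_natl.
Qed.

Definition cons_row n (t : R) (v : 'rV[R]_n) : 'rV[R]_n.+1 :=
  \row_i oapp (v 0) t (unlift ord0 i).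

Lemma leb_row_cons n (p : ms_type (leb R n.+1)) :
  leb_row p = cons_row p.1 (leb_row p.2).
Proof.
apply/rowP => i; rewrite !mxE; case: unliftP => [j|] ->/=; last by [].
by rewrite mxE.
Qed.

Lemma cons_row_lshift n h t (v : 'rV[R]_n) :
  cons_row (h *: 1 + t) v = h *: evec ord0 + cons_row t v.
Proof.
apply/rowP => i; rewrite !mxE; case: unliftP => [j|] ->/=.
  by rewrite mulr0 add0r.
by rewrite mulr1 [h *: 1]mulr1.
Qed.

Lemma cons_row_rshift n h t (v : 'rV[R]_n) j :
  cons_row t (h *: evec j + v) = h *: evec (lift ord0 j) + cons_row t v.
Proof.
apply/rowP => i; rewrite !mxE; case: unliftP => [k|] ->/=.
  by rewrite !mxE/= (inj_eq lift_inj).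
by rewrite mulr0 add0r.
Qed.

Lemma continuous_row (T : topologicalType) n (f : T -> 'rV[R]_n) x :
  (forall i, {for x, continuous (fun y => f y 0 i)}) -> {for x, continuous f}.
Proof.
move=> cf; apply/cvg_ballP => e e0.
have : \forall y \near x, forall i, ball (f x 0 i) e (f y 0 i).
  by apply: filter_forall => i; move/cvg_ballP: (cf i); apply.
by apply: filterS => y H; split=> // i j; rewrite ord1; exact: H.
Qed.

Lemma integral_derive_cpt (f f' : R -> R) (M : R) :
  (forall x, has_der f x (f' x)) -> continuous f' ->
  (forall x, M <= `|x| -> f x = 0) ->
  (\int[@lebesgue_measure R]_x (f' x)%:E = 0)%E.
Proof.
move=> df cf f0.
(* Whatever the sign of [M], [L] is positive and strictly larger than [M], so that [f] vanishes at
   both ends of [[-L, L]] and [f'] vanishes outside. *)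
pose L : R := `|M| + 1.
have ML : M < L by rewrite /L (le_lt_trans (ler_norm M))// ltrDl.
have L0 : 0 < L by rewrite ltr_wpDl.
have f'0 x : M < `|x| -> f' x = 0.
  move=> Mx; rewrite -(has_der_derive1 (df x)).
  apply: (@has_der_derive1 _ _ _ 0); apply: (@has_der_near _ (fun=> 0)); last exact: has_der_cst.
  near=> y; rewrite f0// ltW//; near: y.
  exact: near_normr_gt.
transitivity (\int[@lebesgue_measure R]_(x in `[(- L)%R, L]) (f' x)%:E)%E.
  rewrite [RHS]integral_mkcond; apply: eq_integral => x _; rewrite patchE.
  case: ifPn => // /negP xL; rewrite f'0//; apply: (lt_trans ML).
  rewrite ltNge; apply/negP => xL'; apply: xL.
  by rewrite inE/= in_itv/= -ler_norml.
rewrite (@continuous_FTC2 _ f' f).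
- by rewrite !f0 ?subee// ?normrN gtr0_norm// ltW.
- by rewrite gtrN.
- exact: continuous_subspaceT.
- split=> [x _||]; first by have [] := df x.
  + by apply: cvg_at_right_filter; exact: has_der_continuous (df _).
  + by apply: cvg_at_left_filter; exact: has_der_continuous (df _).
- by move=> x _; exact: has_der_derive1.
Unshelve. all: by end_near. Qed.

Lemma box_finite n (M : R) :
  (lam n (@leb_row R n @^-1` [set y : 'rV[R]_n | forall i, `|y 0%R i| < M + 1]%R) < +oo)%E.
Proof.
have [mB BE] := @leb_box n (fun=> 0) (`|M + 1|) (normr_ge0 _).
apply: le_lt_trans (ltry ((2 * `|M + 1|) ^+ n)); rewrite -BE.
apply: le_measure; rewrite ?inE//.
  apply: measurable_row_open; first exact: measurable_leb_row.
  rewrite openE => y /= H.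
  have : \forall z \near y, forall i, `|(z : 'rV[R]_n) 0 i| < M + 1.
    apply: (@filter_forall _ 'I_n (fun i (z : 'rV[R]_n) => `|z 0 i| < M + 1) (nbhs y)) => i.
    exact: (coord_continuous (near_normr_lt (H i))).
  by [].
move=> x /= H i ni; have := H (Ordinal ni); rewrite mxE subr0/= => /lt_le_trans; apply.
exact: ler_norm.
Qed.

(** By Fubini the variable of differentiation can be integrated first, and there the fundamental
    theorem gives 0. The induction peels off the first coordinate: it is either the differentiated
    one, or a parameter of slices to which the induction hypothesis applies. *)
Lemma integral_partial_leb n (j : 'I_n) (g : 'rV[R]_n -> R^o) (M : R) :
  (forall x, derivable g x (evec j)) -> continuous (partial j g) ->
  (forall x : 'rV[R]_n, (exists i, M <= `|x 0 i|) -> g x = 0) ->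
  (forall x : 'rV[R]_n, (exists i, M <= `|x 0 i|) -> partial j g x = 0) ->
  (\int[lam n]_x (partial j g (leb_row x))%:E = 0)%E.
Proof.
elim: n j g => [[]//|n IH] j g dg cg g0 pg0.
have ig : (lam n.+1).-integrable setT (EFin \o (partial j g \o @leb_row R n.+1)).
  apply: (integrable_row_cpt (@measurable_leb_row n.+1) _ cg pg0).
  exact: box_finite.
case: (unliftP ord0 j) ig dg cg pg0 => [j'|] -> ig dg cg pg0.
- rewrite -(integral12_prod_meas1 ig)/=.
  rewrite [X in integral _ _ X](_ : _ = cst 0%E) ?integral0//.
  apply/funext => t /=; rewrite /fubini_F/=.
  under eq_integral do rewrite leb_row_cons/=.
  have E v : partial j' (g \o cons_row t) v = partial (lift ord0 j') g (cons_row t v).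
    by rewrite /partial (@derive_affine _ _ _ _ g (cons_row t) v _ (evec (lift ord0 j')))// => h;
      rewrite cons_row_rshift.
  have out (v : 'rV[R]_n) : (exists i, M <= `|v 0 i|) -> exists i, M <= `|cons_row t v 0 i|.
    by move=> [i vi]; exists (lift ord0 i); rewrite mxE liftK.
  under eq_integral do rewrite -E.
  apply: IH => [v||v /out|v /out].
  + apply: (@derivable_affine _ _ _ _ g (cons_row t) v _ (evec (lift ord0 j'))) => // h.
    by rewrite cons_row_rshift.
  + rewrite (_ : partial _ _ = partial (lift ord0 j') g \o cons_row t); last exact/funext.
    move=> v; apply: (@continuous_comp _ _ _ (cons_row t)); last exact: cg.
    apply: continuous_row => i.
    case: (unliftP ord0 i) => [k|] ->.
      apply: (@eq_continuous_for _ _ _ (fun y : 'rV[R]_n => y 0 k)) => [y|].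
        by rewrite mxE liftK.
      exact: coord_continuous.
    apply: (@eq_continuous_for _ _ _ (fun=> t)) => [y|]; last exact: cst_continuous.
    by rewrite mxE unlift_none.
  + exact: g0.
  + by rewrite E; exact: pg0.
- rewrite -(integral21_prod_meas1 ig)/=.
  rewrite [X in integral _ _ X](_ : _ = cst 0%E) ?integral0//.
  apply/funext => x /=; rewrite /fubini_G/=.
  under eq_integral do rewrite leb_row_cons/=.
  set v := leb_row x.
  have SE (t h : R) : cons_row (h *: (1 : R) + t) v = h *: evec ord0 + cons_row t v.
    exact: cons_row_lshift.
  apply: (@integral_derive_cpt (fun t => g (cons_row t v)) _ M).
  + move=> t; split.
      exact: (@derivable_affine _ _ _ _ g (fun t => cons_row t v) t 1 (evec ord0) (SE t)).
    exact: (@derive_affine _ _ _ _ g (fun t => cons_row t v) t 1 (evec ord0) (SE t)).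
  + move=> t; apply: (@continuous_comp _ _ _ (fun t => cons_row t v)); last exact: cg.
    apply: continuous_row => i.
    case: (unliftP ord0 i) => [k|] ->.
      apply: (@eq_continuous_for _ _ _ (fun=> v 0 k)) => [y|]; last exact: cst_continuous.
      by rewrite mxE liftK.
    apply: (@eq_continuous_for _ _ _ id) => [y|]; last exact: cvg_id.
    by rewrite mxE unlift_none.
  + by move=> t Mt; apply: g0; exists ord0; rewrite mxE unlift_none.
Qed.

Definition par_row n (p : measurableTypeR R * ms_type (leb R n)) : 'rV[R]_(n + 1) :=
  row_mx (leb_row p.2) p.1%:M.

Lemma measurable_par_row n i : measurable_fun
  [set: (measurableTypeR R * ms_type (leb R n))%type] (fun p => par_row p 0 i).
Proof.
rewrite /par_row; case: (splitP i) => [j ij|j ij].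
  have -> : i = lshift 1 j by apply: val_inj.
  under [fun p => _]funext do rewrite row_mxEl.
  exact: (measurableT_comp (measurable_leb_row j) measurable_snd).
have -> : i = rshift n j by apply: val_inj.
under [fun p => _]funext do rewrite row_mxEr ord1 mxE eqxx mulr1n.
exact: measurable_fst.
Qed.

(** The parameter space is [leb R n.+1] by computation, but with the height as first coordinate,
    whereas points of the ambient space carry it last. The map [S] reorders the coordinates. *)
Lemma integral_partial_par n (j : 'I_(n + 1)) (g : 'rV[R]_(n + 1) -> R^o) (M : R) :
  (forall x, derivable g x (evec j)) -> continuous (partial j g) ->
  (forall x : 'rV[R]_(n + 1), (exists i, M <= `|x 0 i|) -> g x = 0) ->
  (forall x : 'rV[R]_(n + 1), (exists i, M <= `|x 0 i|) -> partial j g x = 0) ->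
  (prod_meas (@lebesgue_measure R) (lam n)).-integrable setT
    (EFin \o (partial j g \o @par_row n)) /\
  (\int[prod_meas (@lebesgue_measure R) (lam n)]_p
    (partial j g (par_row p))%:E = 0)%E.
Proof.
move=> dg cg g0 pg0.
pose S (q : 'rV[R]_n.+1) : 'rV[R]_(n + 1) :=
  row_mx (\row_i q 0 (lift ord0 i)) (q 0 ord0)%:M.
have SE (p : ms_type (leb R n.+1)) : par_row p = S (leb_row p).
  rewrite /par_row /S leb_row_cons; congr row_mx.
    by apply/rowP => i; rewrite !mxE liftK/= mxE.
  by rewrite mxE unlift_none.
have EA m (A B : 'rV[R]_m) i : (A + B) 0 i = A 0 i + B 0 i by rewrite mxE.
have EZ m c (A : 'rV[R]_m) i : (c *: A) 0 i = c * A 0 i by rewrite mxE.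
have [k Sh] : exists k, forall q h, S (h *: evec k + q) = h *: evec j + S q.
  rewrite -(splitK j); case: (fintype.split j) => j'; [exists (lift ord0 j')|exists ord0];
    move=> q h; apply/rowP => i; rewrite EA EZ [evec _ _ _]mxE -(splitK i);
    case: (fintype.split i) => i'; rewrite /S/= ?row_mxEl ?row_mxEr !(EA, EZ, mxE)/=
      ?ord1 ?(inj_eq lift_inj) ?eq_lshift ?eq_rshift ?eq_lrshift ?eq_rlshift ?eqxx
      ?mulr1n ?mulr0 ?mulr1 ?add0r//.
have E q : partial k (g \o S) q = partial j g (S q).
  by rewrite /partial (@derive_affine _ _ _ _ g S q _ (evec j)).
have cS : continuous S.
  move=> q; apply: continuous_row => i; rewrite -(splitK i).
  case: (fintype.split i) => i' /=.
    apply: (@eq_continuous_for _ _ _ (fun y : 'rV[R]_n.+1 => y 0 (lift ord0 i'))) => [y|].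
      by rewrite /S row_mxEl mxE.
    exact: coord_continuous.
  apply: (@eq_continuous_for _ _ _ (fun y : 'rV[R]_n.+1 => y 0 ord0)) => [y|].
    by rewrite /S row_mxEr ord1 mxE eqxx mulr1n.
  exact: coord_continuous.
have out (q : 'rV[R]_n.+1) : (exists i, M <= `|q 0 i|) -> exists i, M <= `|S q 0 i|.
  move=> [i]; case: (unliftP ord0 i) => [i'|] -> Mi.
    by exists (lshift 1 i'); rewrite /S row_mxEl mxE.
  by exists (rshift n ord0); rewrite /S row_mxEr mxE.
have cp : continuous (partial k (g \o S)).
  rewrite (_ : partial _ _ = partial j g \o S); last exact/funext.
  by move=> q; apply: continuous_comp; [exact: cS|exact: cg].
have p0 (q : 'rV[R]_n.+1) : (exists i, M <= `|q 0 i|) -> partial k (g \o S) q = 0.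
  by move=> /out; rewrite E; exact: pg0.
have PE : (fun p => (partial j g (par_row p))%:E) =
    (fun p : ms_type (leb R n.+1) => (partial k (g \o S) (leb_row p))%:E).
  by apply/funext => p; rewrite E SE.
split.
  have := integrable_row_cpt (@measurable_leb_row n.+1) (@box_finite n.+1 M) cp p0.
  by rewrite -[EFin \o _]/(fun p : ms_type (leb R n.+1) => (partial k (g \o S) (leb_row p))%:E)
    -PE.
rewrite [X in integral _ _ X]PE; apply: (@integral_partial_leb n.+1 k (g \o S) M) => //.
- by move=> q; apply: (@derivable_affine _ _ _ _ g S q _ (evec j)).
- by move=> q /out; exact: g0.
Qed.

End LebesgueRow.

(** * The profile of the catenoid *)

(** By the mean value theorem each difference quotient at [a] is a value of [D] at a point other
    than [a] between the two arguments, and [D] is continuous at [a]. This provides derivatives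
    where a function changes its formula: at the neck of the profile, and at the corner of the
    positive part. *)
Lemma is_derive_continuous_ext (R : realType) (F D : R -> R) (a e : R) :
  0 < e -> (forall t, `|t - a| < e -> {for t, continuous F}) ->
  (forall t, `|t - a| < e -> t != a -> has_der F t (D t)) ->
  {for a, continuous D} -> has_der F a (D a).
Proof.
move=> e0 cF dF cD.
suff H : (fun h => h^-1 *: ((F \o shift a) (h *: 1) - F a)) @ 0^' --> D a.
  by split; [apply/cvg_ex; exists (D a)|exact/cvg_lim].
apply/cvgrPdist_le => r r0.
have [d /= d0 dP] : exists2 d : R, 0 < d & forall s, `|s - a| < d ->
    `|D a - D s| <= r.
  move/cvgrPdist_le : cD => /(_ _ r0)[d d0 dP]; exists d => // s sd.
  by apply: dP; rewrite /ball/= distrC.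
near=> h.
have h0 : h != 0 by near: h; exact: nbhs_dnbhs_neq.
have hd : `|h| < Num.min d e.
  by near: h; apply: dnbhs0_lt; rewrite lt_min d0.
move: hd; rewrite lt_min => /andP[hd he].
rewrite /= [h *: 1]mulr1 -[_ *: _]/(_ * _).
have key x y : x < y -> `|x - a| <= `|h| -> `|y - a| <= `|h| ->
    (x = a \/ y = a) -> exists2 c, `|c - a| < d & F y - F x = D c * (y - x).
  move=> xy xh yh xya.
  have bet c : c \in `[x, y] -> `|c - a| <= `|h|.
    rewrite in_itv/= => /andP[xc cy]; move: xh yh; rewrite !ler_norml.
    by move=> /andP[H1 H2] /andP[H3 H4]; apply/andP; split; lra.
  have [] := @MVT _ F D x y xy.
  - move=> c cxy; apply: dF.
      by rewrite (le_lt_trans _ he)// bet// subset_itv_oo_cc.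
    move: cxy; rewrite in_itv/= => /andP[xc cy].
    by case: xya => <-; [rewrite gt_eqF|rewrite lt_eqF].
  - apply/continuous_in_subspaceT => c /set_mem/bet ch.
    by apply: cF; exact: le_lt_trans he.
  - move=> c cxy ->; exists c => //.
    by rewrite (le_lt_trans _ hd)// bet// subset_itv_oo_cc.
have [hneg|hpos|/eqP] := ltgtP h 0; last by rewrite (negbTE h0).
- have [||||c cd Fc] := key (h + a) a.
  + by rewrite gtrDr.
  + by rewrite addrK.
  + by rewrite subrr normr0.
  + by right.
  have -> : F (h + a) - F a = D c * h.
    by rewrite -[LHS]opprB Fc -mulrN opprB addrK.
  by rewrite mulrC mulfK// dP.
- have [||||c cd Fc] := key a (h + a).
  + by rewrite ltrDr.
  + by rewrite subrr normr0.
  + by rewrite addrK.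
  + by left.
  by rewrite Fc addrK mulrC mulfK// dP.
Unshelve. all: by end_near. Qed.

Section Profile.
Context {R : realType}.
Variables (n : nat) (h0 : R).
Hypotheses (hn : (3 <= n)%N) (h0_gt0 : 0 < h0).
Local Notation mu := (@lebesgue_measure R).
Local Notation m := n.-1.

Let h0_neq0 : h0 != 0. Proof. exact: lt0r_neq0. Qed.

(** At radius [tau = h t] this is the square of the slope [h' t]. *)
Definition slope2 (tau : R) : R := cat_a n h0 * tau ^+ (2 * m) - 1.
Definition cat_kernel (tau : R) : R := (Num.sqrt (slope2 tau))^-1.

Lemma slope2E tau : slope2 tau = (tau / h0) ^+ (2 * m) - 1.
Proof. by rewrite /slope2 /cat_a expr_div_n mulrC. Qed.

Lemma slope2_h0 : slope2 h0 = 0.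
Proof. by rewrite slope2E divff// expr1n subrr. Qed.

Let m2_gt0 : (0 < 2 * m)%N.
Proof. by case: n hn => [|[]]. Qed.

Lemma slope2_gt0 tau : h0 < tau -> 0 < slope2 tau.
Proof.
move=> ht; rewrite slope2E subr_gt0 exprn_egt1//.
  by rewrite -lt0n.
by rewrite ltr_pdivlMr// mul1r.
Qed.

Lemma slope2_ge0 tau : h0 <= tau -> 0 <= slope2 tau.
Proof.
by rewrite le_eqVlt => /predU1P[<-|/slope2_gt0/ltW//]; rewrite slope2_h0.
Qed.

Lemma is_derive_slope2 (tau : R) : has_der slope2 tau (2 * (m%:R * cat_a n h0 * tau ^+ (2 * m).-1)).
Proof.
apply: has_der_eq (has_derB (has_derZ _ (has_derX _ (has_der_id tau)))
  (has_der_cst 1 tau)) _.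
by rewrite natrM; ring.
Qed.

Lemma slope2_continuous : continuous slope2.
Proof.
by move=> x; exact: has_der_continuous (is_derive_slope2 x).
Qed.

Lemma cat_kernel_ge0 tau : 0 <= cat_kernel tau.
Proof. by rewrite invr_ge0 sqrtr_ge0. Qed.

Lemma cat_kernel_gt0 tau : h0 < tau -> 0 < cat_kernel tau.
Proof. by move=> ht; rewrite invr_gt0 sqrtr_gt0 slope2_gt0. Qed.

Lemma cat_kernel_continuous tau : h0 < tau -> {for tau, continuous cat_kernel}.
Proof.
move=> ht; apply: cvgV; first by rewrite gt_eqF// sqrtr_gt0 slope2_gt0.
apply: (@continuous_comp _ _ _ slope2 Num.sqrt).
  exact: slope2_continuous.
exact: sqrt_continuous.
Qed.

Lemma measurable_cat_kernel D : measurable_fun D cat_kernel.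
Proof.
have mk : measurable_fun [set: R] cat_kernel.
  apply: (@measurableT_comp _ _ _ _ _ _ (@GRing.inv R)).
    exact: measurable_invr.
  apply: (@measurableT_comp _ _ _ _ _ _ (@Num.sqrt R)).
    by apply: continuous_measurable_fun; exact: sqrt_continuous.
  by apply: continuous_measurable_fun; exact: slope2_continuous.
exact: measurable_funTS.
Qed.

(* With sigma = tau / h0, sigma^2 (sigma - 1) <= sigma^4 - 1, so the kernel is
   dominated by the derivative of a bounded function. *)
Definition cat_primitive (tau : R) : R := 2 * h0 * atan (Num.sqrt (tau / h0 - 1)).
Definition cat_dominant (tau : R) : R :=
  (tau / h0 * Num.sqrt (tau / h0 - 1))^-1.

Let ratio_gt1 tau : h0 < tau -> 0 < tau / h0 - 1.
Proof. by move=> ht; rewrite subr_gt0 ltr_pdivlMr// mul1r. Qed.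

Lemma is_derive_cat_primitive (tau : R) : h0 < tau ->
  has_der cat_primitive tau (cat_dominant tau).
Proof.
move=> ht; rewrite /cat_primitive.
have s0 := ratio_gt1 ht.
have d1 : has_der (fun t : R => t / h0 - 1) tau h0^-1.
  apply: has_der_eq (has_derB (has_derM (has_der_id tau) (has_der_cst h0^-1 tau))
    (has_der_cst 1 tau)) _.
  by rewrite mulr0 add0r mulr1 subr0.
have d2 := has_der_comp (@has_der_sqrt R (fun t => t / h0 - 1) tau _ s0 d1)
  (is_derive1_atan _).
apply: has_der_eq (has_derZ (2 * h0) d2) _.
rewrite /cat_dominant/= sqr_sqrtr ?ltW// subrKC.
have : Num.sqrt (tau / h0 - 1) != 0 by rewrite gt_eqF// sqrtr_gt0.
have : tau != 0 by rewrite gt_eqF// (lt_trans h0_gt0).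
by move: (Num.sqrt _) => s t0 s0'; field; rewrite h0_neq0 t0 s0'.
Qed.

Lemma cat_kernel_le tau : h0 < tau -> cat_kernel tau <= cat_dominant tau.
Proof.
move=> ht; have s0 := ratio_gt1 ht; set s := tau / h0 in s0 *.
have s1 : 1 < s by rewrite -subr_gt0.
rewrite /cat_kernel /cat_dominant -/s lef_pV2 ?posrE; last 2 first.
- by rewrite sqrtr_gt0 slope2_gt0.
- by rewrite mulr_gt0 ?sqrtr_gt0// (lt_trans _ s1).
rewrite -[X in X * _](ger0_norm (ltW (lt_trans ltr01 s1))) -sqrtr_sqr -sqrtrM ?sqr_ge0//.
rewrite ler_sqrt; last by rewrite slope2_ge0// ltW.
rewrite slope2E -/s.
(* Since [n >= 3], the exponent [2 (n - 1)] is at least 4. *)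
apply: (@le_trans _ _ (s ^+ 4 - 1)).
  rewrite -subr_ge0 (_ : _ - _ = (s - 1) * (s ^+ 3 + s + 1)); last by ring.
  by rewrite mulr_ge0 ?ltW// !addr_gt0 ?exprn_gt0 ?(lt_trans _ s1).
rewrite lerD2r ler_weXn2l ?ltW//.
by case: n hn => [|[|[|k]]]//= _; rewrite !mulnS.
Qed.

Lemma cat_dominant_continuous tau : h0 < tau -> {for tau, continuous cat_dominant}.
Proof.
move=> ht; have s0 := ratio_gt1 ht.
apply: cvgV.
  rewrite mulf_neq0// gt_eqF ?sqrtr_gt0// divr_gt0//; exact: lt_trans ht.
have c1 : {for tau, continuous (fun t : R => t / h0)}.
  by apply: cvgM; [exact: cvg_id|exact: cvg_cst].
apply: cvgM => //; apply: (@continuous_comp _ _ _ (fun t : R => t / h0 - 1) Num.sqrt).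
  by apply: cvgB => //; exact: cvg_cst.
exact: sqrt_continuous.
Qed.

(** Origin of the constant [h0 * pi] that bounds all heights: [2 * h0] times the supremum [pi / 2]
    of [atan]. *)
Lemma cat_primitive_bounds tau : 0 <= cat_primitive tau <= h0 * pi.
Proof.
rewrite /cat_primitive; apply/andP; split.
  apply: mulr_ge0; first by rewrite mulr_ge0// ltW.
  by rewrite -(@atan0 R); apply: le_atan; exact: sqrtr_ge0.
rewrite mulrAC -mulrA [2 * _]mulrC mulrAC [leRHS]mulrC ler_pM2r//.
by rewrite -ler_pdivlMr// ltW// atan_ltpi2.
Qed.

(** The kernel and its dominant are unbounded near [h0]. The fundamental theorem is applied to the
    dominant on [[h0 + 1 / (k + 1), u]], with a bound independent of [k], and monotone convergence
    reaches the full interval. *)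
Lemma integral_cat_kernel_le u :
  (\int[mu]_(t in `[h0, u]) (cat_kernel t)%:E <= (h0 * pi)%:E)%E.
Proof.
have [uh|hu] := ltP u h0.
  rewrite set_itv_ge ?bnd_simp -?ltNge// integral_set0 lee_fin.
  by rewrite mulr_ge0// ?ltW// pi_gt0.
rewrite -integral_itv_obnd_cbnd; last first.
  by apply/measurable_EFinP; exact: measurable_cat_kernel.
rewrite itv_open_bnd_bigcup.
have cvgI := @ge0_nondecreasing_set_cvg_integral _ (measurableTypeR R) R
  (fun k => `[h0 + k.+1%:R^-1, u]%classic) (fun t => (cat_kernel t)%:E) mu.
rewrite -(cvg_lim _ (cvgI _ _ _ _))//.
- apply: lime_le.
    apply: ereal_nondecreasing_is_cvgn.
    apply: ge0_nondecreasing_set_nondecreasing_integral => //.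
    + move=> a b ab; apply/subsetPset; apply: subset_itvr.
      by rewrite bnd_simp lerD2l lef_pV2 ?posrE// ler_nat.
    + by move=> i; apply/measurable_EFinP; exact: measurable_cat_kernel.
    + by move=> i x _; rewrite lee_fin cat_kernel_ge0.
  near=> k; set a := h0 + _.
  have ha : h0 < a by rewrite ltrDl invr_gt0.
  have [ua|au] := leP u a.
    have -> : (\int[mu]_(t in `[a, u]) (cat_kernel t)%:E = 0)%E.
      move: ua; rewrite le_eqVlt => /predU1P[->|ua].
        by rewrite set_itv1 integral_set1.
      by rewrite set_itv_ge ?bnd_simp -?ltNge// integral_set0.
    by rewrite lee_fin mulr_ge0// ?ltW// pi_gt0.
  have cat t : `[a, u]%classic t -> h0 < t.
    by rewrite /= in_itv/= => /andP[/(lt_le_trans ha)].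
  apply: (@le_trans _ _ (\int[mu]_(t in `[a, u]) (cat_dominant t)%:E)%E).
    apply: ge0_le_integral => //.
    + by move=> t _; rewrite lee_fin cat_kernel_ge0.
    + by apply/measurable_EFinP; exact: measurable_cat_kernel.
    + apply/measurable_EFinP; apply: (@measurable_funS _ _ _ _ `]h0, +oo[) => //.
        by move=> t /cat ht; rewrite /= in_itv/= ht.
      apply: open_continuous_measurable_fun; first exact: interval_open.
      by move=> t /set_mem; rewrite /= in_itv/= andbT; exact: cat_dominant_continuous.
    + by move=> t /cat ht; rewrite lee_fin cat_kernel_le.
  rewrite (@continuous_FTC2 _ _ cat_primitive)//.
  + have /andP[? ?] := cat_primitive_bounds a.
    have /andP[? ?] := cat_primitive_bounds u.
    by rewrite -EFinB lee_fin; lra.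
  + by apply/continuous_in_subspaceT => t /set_mem/cat; exact: cat_dominant_continuous.
  + have dp t : h0 < t -> {for t, continuous cat_primitive}.
      by move=> ht; exact: has_der_continuous (is_derive_cat_primitive ht).
    split.
    * move=> t /subset_itv_oo_cc/cat ht.
      by have [] := is_derive_cat_primitive ht.
    * by apply: cvg_at_right_filter; exact: dp.
    * by apply: cvg_at_left_filter; apply: dp; exact: lt_trans au.
  + move=> t /subset_itv_oo_cc/cat ht; rewrite derive1E.
    by have [_ ->] := is_derive_cat_primitive ht.
- move=> a b ab; apply/subsetPset; apply: subset_itvr.
  by rewrite bnd_simp lerD2l lef_pV2 ?posrE// ler_nat.
- by move=> i; apply/measurable_EFinP; exact: measurable_cat_kernel.
- by move=> i x _; rewrite lee_fin cat_kernel_ge0.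
Unshelve. all: by end_near. Qed.

Lemma integrable_cat_kernel u : mu.-integrable `[h0, u] (EFin \o cat_kernel).
Proof.
apply/integrableP; split.
  by apply/measurable_EFinP; exact: measurable_cat_kernel.
apply: le_lt_trans (ltry (h0 * pi)); apply: le_trans (integral_cat_kernel_le u).
rewrite le_eqVlt; apply/orP; left; apply/eqP; apply: eq_integral => t _ /=.
by rewrite ger0_norm// cat_kernel_ge0.
Qed.

Local Notation s := (@cat_s R n h0).

Lemma cat_s_h0 : s h0 = 0.
Proof. by rewrite /cat_s set_itv1 Rintegral_set1. Qed.

Lemma cat_s_continuous u : h0 <= u -> {within `[h0, u], continuous s}.
Proof.
move=> hu; exact: (parameterized_integral_continuous hu (integrable_cat_kernel u)).
Qed.

Lemma has_der_cat_s u : h0 < u -> has_der s u (cat_kernel u).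
Proof.
move=> hu; have [||||d1 d2] := @continuous_FTC1_closed R cat_kernel h0 u (u + 1).
- by rewrite ltrDl.
- exact: integrable_cat_kernel.
- exact: hu.
- exact: cat_kernel_continuous.
by split; [exact: d1|rewrite -derive1E; exact: d2].
Qed.

Lemma cat_s_lt u v : h0 <= u -> u < v -> s u < s v.
Proof.
move=> hu uv; have hv : h0 < v by exact: le_lt_trans uv.
apply: (@gtr0_derive1_lt_cc _ s h0 v).
- by move=> x /[!in_itv]/= /andP[hx _]; have [] := has_der_cat_s hx.
- move=> x /[!in_itv]/= /andP[hx _].
  by rewrite (has_der_derive1 (has_der_cat_s hx)) cat_kernel_gt0.
- exact/cat_s_continuous/ltW.
- by rewrite in_itv/= hu ltW.
- by rewrite in_itv/= lexx ltW.
- exact: uv.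
Qed.

Lemma cat_s_le u v : h0 <= u -> u <= v -> s u <= s v.
Proof. by move=> hu; rewrite le_eqVlt => /predU1P[->//|/(cat_s_lt hu)/ltW]. Qed.

Lemma cat_s_inj u v : h0 <= u -> h0 <= v -> s u = s v -> u = v.
Proof.
move=> hu hv E; have [uv|vu|//] := ltgtP u v.
  by have := cat_s_lt hu uv; rewrite E ltxx.
by have := cat_s_lt hv vu; rewrite E ltxx.
Qed.

Lemma cat_s_bounds u : h0 <= u -> 0 <= s u <= h0 * pi.
Proof.
move=> hu; rewrite -cat_s_h0 (cat_s_le (lexx _) hu)/= -lee_fin.
rewrite /cat_s /Rintegral fineK; first exact: integral_cat_kernel_le.
exact: integrable_fin_num (integrable_cat_kernel u).
Qed.

Local Notation dom := (@cat_dom R n h0).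
Local Notation h := (@cat_h R n h0).

Lemma cat_domP t : dom t <-> exists2 u, h0 <= u & `|t| < s u.
Proof.
split=> [/ereal_sup_gt[_ [u hu <-]]|[u hu tu]].
  by rewrite lte_fin => tu; exists u.
rewrite /cat_dom/=; apply: (@lt_le_trans _ _ (s u)%:E); first by rewrite lte_fin.
by apply: ereal_sup_ubound; exists u.
Qed.

Lemma cat_dom_lt t : dom t -> `|t| < h0 * pi.
Proof.
by move=> /cat_domP[u hu tu]; have /andP[_] := cat_s_bounds hu; exact: lt_le_trans.
Qed.

Lemma cat_dom_s u : h0 <= u -> dom (s u).
Proof.
move=> hu; apply/cat_domP; exists (u + 1); first by rewrite ler_wpDr.
have /andP[s0 _] := cat_s_bounds hu.
by rewrite ger0_norm// cat_s_lt// ltrDl.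
Qed.

Lemma cat_dom_sub t t' : `|t'| <= `|t| -> dom t -> dom t'.
Proof. by move=> tt'; apply: le_lt_trans; rewrite lee_fin. Qed.

Lemma cat_dom0 : dom 0.
Proof. by rewrite -cat_s_h0; exact: cat_dom_s. Qed.

Lemma cat_dom_open : open dom.
Proof.
rewrite openE => t /cat_domP[u hu tu]; near=> t'; apply/cat_domP; exists u => //.
near: t'; exact: near_normr_lt.
Unshelve. all: by end_near. Qed.

Lemma cat_h_spec t : dom t -> h0 <= h t /\ s (h t) = `|t|.
Proof.
move=> /cat_domP[u hu tu].
suff : exists v, h0 <= v /\ s v = `|t| by move=> /getPex.
have [|c] := @IVT R s h0 u `|t| hu (cat_s_continuous hu).
  have /andP[s0 _] := cat_s_bounds hu.
  by rewrite cat_s_h0 min_l// max_r// normr_ge0 ltW.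
by rewrite in_itv/= => /andP[hc _] sc; exists c.
Qed.

Lemma cat_h_ge t : dom t -> h0 <= h t.
Proof. by move=> /cat_h_spec[]. Qed.

Lemma cat_h_gt0 t : dom t -> 0 < h t.
Proof. by move=> /cat_h_ge; exact: lt_le_trans. Qed.

Lemma cat_hK u : h0 <= u -> h (s u) = u.
Proof.
move=> hu; have [hh E] := cat_h_spec (cat_dom_s hu).
apply: cat_s_inj => //; rewrite E ger0_norm//.
by have /andP[] := cat_s_bounds hu.
Qed.

Lemma cat_hN t : h (- t) = h t.
Proof. by rewrite /cat_h normrN. Qed.

Lemma cat_h0 : h 0 = h0.
Proof. by rewrite -cat_s_h0 cat_hK. Qed.

Lemma cat_h_lt u t : h0 <= u -> dom t -> `|t| < s u -> h t < u.
Proof.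
move=> hu dt tu; have [hh E] := cat_h_spec dt.
by rewrite ltNge; apply/negP => /(cat_s_le hu); rewrite E leNgt tu.
Qed.

Lemma cat_h_gt u t : h0 <= u -> dom t -> s u < `|t| -> u < h t.
Proof.
move=> hu dt tu; have [hh E] := cat_h_spec dt.
by rewrite ltNge; apply/negP => /(cat_s_le hh); rewrite E leNgt tu.
Qed.

(** [cat_h1] and [cat_h2] are [h'] and [h'']. The sign makes [h'] odd and zero at the neck; [h'']
    comes from differentiating [h'^2 = a h^(2(n-1)) - 1] and cancelling [2 h'], which leaves an
    expression that is regular at the neck. *)
Definition cat_h1 (t : R) : R := Num.sg t * Num.sqrt (slope2 (h t)).
Definition cat_h2 (t : R) : R := m%:R * cat_a n h0 * h t ^+ (2 * m).-1.

Lemma cat_h_gt_h0 t : dom t -> t != 0 -> h0 < h t.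
Proof. by move=> dt t0; apply: cat_h_gt => //; rewrite cat_s_h0 normr_gt0. Qed.

Lemma has_der_cat_h_pos t : dom t -> 0 < t -> has_der h t (cat_h1 t).
Proof.
move=> dt t0; have [_ E] := cat_h_spec dt.
have hh : h0 < h t by rewrite cat_h_gt_h0// gt_eqF.
rewrite /cat_h1 gtr0_sg// mul1r -[X in has_der _ X](gtr0_norm t0) -E.
rewrite -(invrK (Num.sqrt _)); apply: is_derive_inverse.
- near=> v; rewrite cat_hK// ltW//; near: v; exact: lt_nbhsr.
- near=> v; apply: has_der_continuous (has_der_cat_s _).
  by near: v; exact: lt_nbhsr.
- exact: has_der_cat_s.
- by rewrite gt_eqF// cat_kernel_gt0.
Unshelve. all: by end_near. Qed.

Lemma has_der_cat_h_neq0 t : dom t -> t != 0 -> has_der h t (cat_h1 t).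
Proof.
move=> dt; rewrite neq_lt => /orP[t0|]; last exact: has_der_cat_h_pos.
have dNt : dom (- t) by apply: cat_dom_sub dt; rewrite normrN.
have Nt0 : 0 < - t by rewrite oppr_gt0.
have := has_der_comp (has_derN (has_der_id t)) (has_der_cat_h_pos dNt Nt0).
under [fun t => _]funext do rewrite cat_hN.
by move/has_der_eq; apply; rewrite /cat_h1 sgrN cat_hN mulrN1 mulNr opprK.
Qed.

Lemma cat_h_continuous t : dom t -> {for t, continuous h}.
Proof.
have [->{t} _|t0 dt] := eqVneq t 0; last exact: has_der_continuous (has_der_cat_h_neq0 dt t0).
apply/cvgrPdist_lt => e e0; near=> t'.
have dt : dom t'.
  near: t'; apply: (open_nbhs_nbhs (A := dom)); split; [exact: cat_dom_open|exact: cat_dom0].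
have hh := cat_h_ge dt.
rewrite cat_h0 distrC ger0_norm ?subr_ge0// ltrBlDl.
have he : h0 < h0 + e by rewrite ltrDl.
apply: cat_h_lt => //; first exact: ltW.
near: t'; apply: near_normr_lt.
have he : h0 < h0 + e by rewrite ltrDl.
by have := cat_s_lt (lexx h0) he; rewrite cat_s_h0 normr0.
Unshelve. all: by end_near. Qed.

Lemma dom_ball : exists2 e : R, 0 < e & forall t, `|t - 0| < e -> dom t.
Proof.
have : nbhs 0 dom by apply: open_nbhs_nbhs; split; [exact: cat_dom_open|exact: cat_dom0].
move=> /nbhs_ballP[e /= e0 H]; exists e => // t te; apply: H.
by rewrite /ball/= distrC.
Qed.

Lemma cat_h1_0 : cat_h1 0 = 0.
Proof. by rewrite /cat_h1 sgr0 mul0r. Qed.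

Lemma cat_h1_continuous0 : {for 0, continuous cat_h1}.
Proof.
have c : {for 0, continuous (fun t => Num.sqrt (slope2 (h t)))}.
  apply: (@continuous_comp _ _ _ (fun t => slope2 (h t)) Num.sqrt).
    apply: (@continuous_comp _ _ _ h slope2); first exact/cat_h_continuous/cat_dom0.
    exact: slope2_continuous.
  exact: sqrt_continuous.
apply/cvgrPdist_le => e e0; move/cvgrPdist_le : c => /(_ _ e0).
apply: filterS => t; rewrite cat_h0 slope2_h0 sqrtr0 !sub0r !normrN cat_h1_0 sub0r normrN.
apply: le_trans; rewrite /cat_h1 normrM ler_piMl// normr_sg; by case: eqP.
Qed.

(** At the neck the derivative of [cat_s] blows up and the inverse function rule is silent; but [h]
    is continuous there and the derivative found elsewhere tends to 0. *)
Lemma has_der_cat_h t : dom t -> has_der h t (cat_h1 t).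
Proof.
have [->{t} _|t0 dt] := eqVneq t 0; last exact: has_der_cat_h_neq0.
have [e e0 eD] := dom_ball.
apply: (is_derive_continuous_ext e0) => [t te|t te t0|].
- exact/cat_h_continuous/eD.
- by apply: has_der_cat_h_neq0 => //; exact: eD.
- exact: cat_h1_continuous0.
Qed.

Lemma has_der_cat_h1_neq0 t : dom t -> t != 0 -> has_der cat_h1 t (cat_h2 t).
Proof.
move=> dt t0.
have hh := cat_h_gt_h0 dt t0.
have s0 := slope2_gt0 hh.
have d1 := @has_der_sqrt R (fun t => slope2 (h t)) t _ s0
  (has_der_comp (has_der_cat_h dt) (is_derive_slope2 _)).
(* Away from the neck the sign is locally constant and can be frozen. *)
apply: (@has_der_near _ (fun u => Num.sg t * Num.sqrt (slope2 (h u)))).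
  have : (0 < t) || (t < 0) by rewrite orbC -neq_lt.
  move=> /orP[tp|tn]; near=> u; rewrite /cat_h1; congr (_ * _).
    have up : 0 < u by near: u; exact: lt_nbhsr.
    by rewrite !gtr0_sg.
  have un : u < 0 by near: u; exact: lt_nbhsl.
  by rewrite !ltr0_sg.
apply: has_der_eq (has_derZ _ d1) _.
rewrite /cat_h1 /cat_h2; have : Num.sqrt (slope2 (h t)) != 0.
  by rewrite gt_eqF// sqrtr_gt0.
have : Num.sg t * Num.sg t = 1 by rewrite -expr2 sqr_sg t0.
move: (Num.sg t) (Num.sqrt _) => g q gg q0.
transitivity (g * g * (m%:R * cat_a n h0 * h t ^+ (2 * m).-1)); last by rewrite gg mul1r.
by field.
Unshelve. all: by end_near. Qed.

Lemma cat_h2_continuous t : dom t -> {for t, continuous cat_h2}.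
Proof.
move=> dt; apply: has_der_continuous.
exact: has_derZ (has_derX _ (has_der_cat_h dt)).
Qed.

Lemma has_der_cat_h1 t : dom t -> has_der cat_h1 t (cat_h2 t).
Proof.
have [->{t} _|t0 dt] := eqVneq t 0; last exact: has_der_cat_h1_neq0.
have [e e0 eD] := dom_ball.
apply: (is_derive_continuous_ext e0) => [t te|t te t0|].
- have [->|t0] := eqVneq t 0; first exact: cat_h1_continuous0.
  exact: has_der_continuous (has_der_cat_h1_neq0 (eD _ te) t0).
- by apply: has_der_cat_h1_neq0 => //; exact: eD.
- exact/cat_h2_continuous/cat_dom0.
Qed.

Lemma derive1_cat_h t : dom t -> derive1 h t = cat_h1 t.
Proof. by move=> dt; rewrite (has_der_derive1 (has_der_cat_h dt)). Qed.

Lemma cat_h1_sqr t : dom t -> cat_h1 t ^+ 2 = (h t / h0) ^+ (2 * m) - 1.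
Proof.
move=> dt; rewrite -slope2E /cat_h1 exprMn sqr_sg sqr_sqrtr; last first.
  exact/slope2_ge0/cat_h_ge.
have [->|] := eqVneq t 0; last by rewrite mul1r.
by rewrite mul0r cat_h0 slope2_h0.
Qed.

Lemma cat_h1N t : cat_h1 (- t) = - cat_h1 t.
Proof. by rewrite /cat_h1 sgrN cat_hN mulNr. Qed.

Lemma cat_h1_ge0 t : 0 <= t -> 0 <= cat_h1 t.
Proof. by move=> t0; rewrite mulr_ge0 ?sqrtr_ge0// sgr_ge0. Qed.

Lemma cat_h2E t : dom t -> cat_h2 t = m%:R * (h t / h0) ^+ (2 * m) / h t.
Proof.
move=> dt; have ht := lt0r_neq0 (cat_h_gt0 dt).
rewrite /cat_h2 /cat_a expr_div_n -[in RHS](prednK m2_gt0) exprS.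
rewrite prednK//; have : h0 ^+ (2 * m) != 0 by rewrite expf_neq0.
by move: (h0 ^+ _) (h t ^+ _) => p q p0; field; rewrite ht p0.
Qed.

End Profile.

(** * Gradients and smooth functions *)

(** Both maps have the same first-order expansion at [x], and such an expansion determines the
    differential. *)
Lemma near_eq_differentiable (R : realType) (V W : normedModType R)
    (f g : V -> W) x :
  (\near x, f x = g x) -> differentiable f x -> differentiable g x.
Proof.
move=> fg df.
have E : g \o shift x = cst (g x) + 'd f x +o_ (0 : V) id.
  apply/eqaddoP => e e0.
  have /eqaddoP/(_ e e0) := diff_locally df.
  have fg0 : \forall h \near (0 : V), f (h + x) = g (h + x).
    by move: fg; rewrite (near_shift 0) subr0.
  apply: filterS2 fg0 => h fgh; rewrite !fctE /= => He.
  by rewrite -fgh -(nbhs_singleton fg).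
have dE := diff_unique (diff_continuous df) E.
by apply/diff_locallyP; rewrite dE; split=> //; exact: diff_continuous.
Qed.

Section Gradient.
Context {R : realType} {N : nat}.
Local Notation V := 'rV[R]_N.
Implicit Types (f g : V -> R^o) (x : V) (G : 'I_N -> R).

(** Keeps differentiability and the values of the partial derivatives together, so that the rules of
    calculus propagate both at once. *)
Definition has_grad f x G :=
  differentiable f x /\ forall i, partial i f x = G i.

Lemma has_grad_eq f x G G' : has_grad f x G -> G =1 G' -> has_grad f x G'.
Proof. by move=> [df fG] GG'; split=> // i; rewrite fG. Qed.

Lemma has_grad_near f g x G :
  (\near x, f x = g x) -> has_grad f x G -> has_grad g x G.
Proof.
move=> fg [df fG]; split; first exact: near_eq_differentiable fg df.
by move=> i; rewrite -fG; apply/esym/near_eq_derive.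
Qed.

Lemma has_gradP f x : differentiable f x -> has_grad f x (fun i => partial i f x).
Proof. by split. Qed.

Lemma has_grad_derive f x G v :
  has_grad f x G -> 'D_v f x = \sum_i v 0 i * G i.
Proof.
move=> [df fG]; rewrite deriveE// {1}(row_sum_delta v) linear_sum/=.
by apply: eq_bigr => i _; rewrite linearZ/= -deriveE// -fG.
Qed.

Lemma has_grad_cst c x : has_grad (fun=> c) x (fun=> 0).
Proof.
split; first exact: differentiable_cst.
by move=> i; rewrite /partial derive_cst.
Qed.

Lemma has_grad_coord k x :
  has_grad (fun y => y 0 k) x (fun i => (i == k)%:R).
Proof.
split; first exact: differentiable_coord.
move=> i; rewrite /partial.
have @l : {linear V -> R^o}.
  by exists (fun y : V => y 0 k : R^o); do 2![eexists]; do ?[constructor];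
     rewrite ?mxE// => ? *; rewrite ?mxE//; move=> ?; rewrite !mxE.
rewrite (_ : (fun y : V => y 0 k) = l)//.
rewrite deriveE; last exact/linear_differentiable/coord_continuous.
rewrite diff_lin/=; last exact: coord_continuous.
by rewrite /evec mxE eqxx/= eq_sym.
Qed.

Lemma has_gradD f g x F G : has_grad f x F -> has_grad g x G ->
  has_grad (fun y => f y + g y) x (fun i => F i + G i).
Proof.
move=> [df fF] [dg gG]; split; first exact: differentiableD.
move=> i; rewrite -fF -gG /partial; apply: deriveD; exact: diff_derivable.
Qed.

Lemma has_gradM f g x F G : has_grad f x F -> has_grad g x G ->
  has_grad (fun y => f y * g y) x (fun i => f x * G i + g x * F i).
Proof.
move=> [df fF] [dg gG]; split; first exact: differentiableM.
move=> i; rewrite -fF -gG /partial; apply: deriveM; exact: diff_derivable.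
Qed.

Lemma has_grad_comp (g : R -> R) dg f x F :
  is_derive (f x) 1 (g : R -> R^o) dg -> has_grad f x F ->
  has_grad (fun y => g (f y)) x (fun i => dg * F i).
Proof.
move=> [dgf gE] [df fF].
have dg1 : differentiable (g : R -> R^o) (f x) by exact/derivable1_diffP.
split; first exact: (@differentiable_comp _ _ _ _ f g).
move=> i; rewrite /partial deriveE; last first.
  exact: (@differentiable_comp _ _ _ _ f g).
have dfi : 'd f x (evec i) = F i by rewrite -fF /partial deriveE.
by rewrite (@diff_comp _ _ _ _ f g)//= dfi deriv1E// derive1E gE/= mulrC.
Qed.

Lemma has_gradN f x F : has_grad f x F ->
  has_grad (fun y => - f y) x (fun i => - F i).
Proof.
move=> [df fF]; split; first exact: differentiableN.
by move=> i; rewrite -fF /partial; apply: deriveN; exact: diff_derivable.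
Qed.

Lemma has_gradZ c f x F : has_grad f x F ->
  has_grad (fun y => c * f y) x (fun i => c * F i).
Proof.
move=> fF; apply: has_grad_eq (has_gradM (has_grad_cst c x) fF) _ => i.
by rewrite mulr0 addr0.
Qed.

Lemma has_grad_sum (I : finType) (f : I -> V -> R^o) x F :
  (forall k, has_grad (f k) x (F k)) ->
  has_grad (fun y => \sum_k f k y) x (fun i => \sum_k F k i).
Proof.
move=> fF; rewrite /index_enum; case: index_enum_key => /=.
elim: (Finite.enum I) => [|k s IH].
  under [fun y => _]funext do rewrite big_nil.
  by apply: has_grad_eq (has_grad_cst 0 x) _ => i; rewrite big_nil.
under [fun y => _]funext do rewrite big_cons.
by apply: has_grad_eq (has_gradD (fF k) IH) _ => i; rewrite big_cons.
Qed.

End Gradient.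

Section Smooth.
Context {R : realType} {N : nat}.
Local Notation V := 'rV[R]_N.
Variable U : set V.
Hypothesis oU : open U.
Implicit Types (f g : V -> R^o) (S : set (V -> R^o)).

Inductive generated_alg S : (V -> R^o) -> Prop :=
| alg_gen f : S f -> generated_alg S f
| alg_cst c : generated_alg S (fun=> c)
| alg_add f g : generated_alg S f -> generated_alg S g ->
    generated_alg S (fun x => f x + g x)
| alg_mul f g : generated_alg S f -> generated_alg S g ->
    generated_alg S (fun x => f x * g x).

Lemma eq_on_near f g x : {in U, f =1 g} -> U x -> \near x, f x = g x.
Proof.
move=> fg Ux; near=> y; apply: fg; rewrite inE; near: y.
exact: open_nbhs_nbhs.
Unshelve. all: by end_near. Qed.

Lemma eq_on_partial f g i : {in U, f =1 g} -> {in U, partial i f =1 partial i g}.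
Proof.
by move=> fg x /set_mem Ux; apply: near_eq_derive; exact: eq_on_near.
Qed.

(** If the partial derivatives of the generators agree on [U] with elements of the algebra, then by
    the Leibniz rule so do those of every element. All iterated derivatives thus stay in the
    algebra, whose elements are differentiable on [U]. *)
Lemma smooth_bootstrap S :
  (forall s x, S s -> U x -> differentiable s x) ->
  (forall s i, S s -> exists2 g, generated_alg S g & {in U, partial i s =1 g}) ->
  forall g, generated_alg S g -> smooth_on U g.
Proof.
move=> dS pS.
have dA g x : generated_alg S g -> U x -> differentiable g x.
  elim=> [f Sf|c|f h _ IHf _ IHg|f h _ IHf _ IHg] Ux.
  - exact: dS.
  - exact: differentiable_cst.
  - by apply: differentiableD; [exact: IHf|exact: IHg].
  - by apply: differentiableM; [exact: IHf|exact: IHg].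
have pA g i : generated_alg S g ->
    exists2 h, generated_alg S h & {in U, partial i g =1 h}.
  elim=> {g}[f Sf|c|f g Sf [f' Sf' ff'] Sg [g' Sg' gg']
            |f g Sf [f' Sf' ff'] Sg [g' Sg' gg']].
  - exact: pS.
  - exists (fun=> 0); first exact: alg_cst.
    by move=> x _; rewrite /partial derive_cst.
  - exists (fun x => f' x + g' x); first exact: alg_add.
    move=> x Ux; rewrite -ff'// -gg'//; move/set_mem : Ux => Ux.
    by have [_ ->] := has_gradD (has_gradP (dA _ _ Sf Ux))
      (has_gradP (dA _ _ Sg Ux)).
  - exists (fun x => f x * g' x + g x * f' x).
      by apply: alg_add; exact: alg_mul.
    move=> x Ux; rewrite -ff'// -gg'//; move/set_mem : Ux => Ux.
    by have [_ ->] := has_gradM (has_gradP (dA _ _ Sf Ux))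
      (has_gradP (dA _ _ Sg Ux)).
move=> g0 Sg0 l x Ux.
(* Derivatives are known on [U] only, so the induction runs over functions that agree on [U] with an
   element of the algebra. The derivative taken first is the last index of [l], whence the induction
   from the end of the list. *)
suff H : forall g, (exists2 h, generated_alg S h & {in U, g =1 h}) ->
    differentiable (foldr partial g l) x.
  by apply: H; exists g0.
elim/last_ind: l => [|l i IH] g [h Sh gh].
  rewrite /=; apply: near_eq_differentiable (dA _ _ Sh Ux).
  by apply: eq_on_near => // y Uy; rewrite gh.
rewrite foldr_rcons; apply: IH; have [k Sk hk] := pA _ i Sh.
by exists k => // y Uy; rewrite -hk// (eq_on_partial i gh).
Qed.

Lemma smooth_on_partial f i : smooth_on U f -> smooth_on U (partial i f).
Proof. by move=> sf l x Ux; rewrite -foldr_rcons; exact: sf. Qed.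

Lemma smooth_on_differentiable f x : smooth_on U f -> U x -> differentiable f x.
Proof. by move=> sf Ux; exact: (sf [::]). Qed.

(** The bootstrap with all smooth functions as generators: their partial derivatives are generators
    again. *)
Lemma smooth_on_alg f : generated_alg (smooth_on U) f -> smooth_on U f.
Proof.
apply: smooth_bootstrap => [s x ss Ux|s i ss].
  exact: smooth_on_differentiable ss Ux.
by exists (partial i s) => //; apply: alg_gen; exact: smooth_on_partial.
Qed.

Lemma smooth_onM f g : smooth_on U f -> smooth_on U g ->
  smooth_on U (fun x => f x * g x).
Proof. by move=> sf sg; apply: smooth_on_alg; apply: alg_mul; apply: alg_gen. Qed.

Lemma eq_smooth_on f g : {in U, f =1 g} -> smooth_on U f -> smooth_on U g.
Proof.
move=> fg sf l x Ux; elim/last_ind: l f g fg sf => [|l i IH] f g fg sf.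
  exact: near_eq_differentiable (eq_on_near fg Ux) (sf [::] x Ux).
rewrite foldr_rcons; apply: (IH (partial i f)).
  exact: eq_on_partial.
exact: smooth_on_partial.
Qed.

End Smooth.

(** * Euclidean norm, and the splitting into horizontal and vertical coordinates *)

Section DotProduct.
Context {R : realType} {n : nat}.
Implicit Types (u v : 'rV[R]_n).

Lemma dotpE u v : dotp u v = \sum_i u 0 i * v 0 i. Proof. by []. Qed.

Lemma dotp_ge0 u : 0 <= dotp u u.
Proof. by apply: sumr_ge0 => i _; rewrite -expr2 sqr_ge0. Qed.

Lemma dotp_eq0 u : (dotp u u == 0) = (u == 0).
Proof.
apply/eqP/eqP => [/eqP|->]; last by rewrite dotpE big1// => i _; rewrite mxE mul0r.
rewrite psumr_eq0; last by move=> i _; rewrite -expr2 sqr_ge0.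
move=> /allP u0; apply/rowP => i; rewrite mxE; apply/eqP.
by have := u0 i (mem_index_enum _); rewrite mulf_eq0 orbb.
Qed.

Lemma dotp_gt0 u : u != 0 -> 0 < dotp u u.
Proof. by move=> u0; rewrite lt_neqAle dotp_ge0 eq_sym dotp_eq0 u0. Qed.

Lemma enorm_ge0 u : 0 <= enorm u. Proof. exact: sqrtr_ge0. Qed.

Lemma enorm_gt0 u : (0 < enorm u) = (u != 0).
Proof. by rewrite sqrtr_gt0 lt_neqAle dotp_ge0 andbT eq_sym dotp_eq0. Qed.

Lemma sqr_enorm u : enorm u ^+ 2 = dotp u u.
Proof. by rewrite sqr_sqrtr// dotp_ge0. Qed.

Lemma dotpZ c u v : dotp (c *: u) v = c * dotp u v.
Proof. by rewrite /dotp mulr_sumr; apply: eq_bigr => i _; rewrite mxE mulrA. Qed.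

Lemma dotpC u v : dotp u v = dotp v u.
Proof. by apply: eq_bigr => i _; rewrite mulrC. Qed.

Lemma enormZ c u : enorm (c *: u) = `|c| * enorm u.
Proof.
by rewrite /enorm dotpZ dotpC dotpZ mulrA -expr2 sqrtrM ?sqr_ge0// sqrtr_sqr.
Qed.

Lemma enorm_udir u : u != 0 -> enorm (udir u) = 1.
Proof.
move=> u0; rewrite /udir enormZ ger0_norm ?invr_ge0 ?enorm_ge0// mulVf//.
by rewrite gt_eqF// enorm_gt0.
Qed.

Lemma udirZ c u : 0 < c -> udir (c *: u) = udir u.
Proof.
move=> c0; rewrite /udir enormZ gtr0_norm// scalerA; congr (_ *: _).
by rewrite invfM mulrAC mulVf ?mul1r// gt_eqF.
Qed.

Lemma udir_unit u : enorm u = 1 -> udir u = u.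
Proof. by move=> u1; rewrite /udir u1 invr1 scale1r. Qed.

Lemma udir_id u : udir (udir u) = udir u.
Proof.
have [->|u0] := eqVneq u 0; first by rewrite /udir !scaler0.
by rewrite udir_unit// enorm_udir.
Qed.

End DotProduct.

Section Split.
Context {R : realType} {n : nat}.
Local Notation N := (n + 1)%N.
Local Notation hi k := (lshift 1 k : 'I_N).
Local Notation vi := (rshift n (@ord0 0) : 'I_N).

Definition grad_split (a : 'I_n -> R) (b : R) (i : 'I_N) : R :=
  match fintype.split i with inl k => a k | inr _ => b end.

Lemma grad_splitl a b k : grad_split a b (hi k) = a k.
Proof. by rewrite /grad_split (unsplitK (inl k)). Qed.

Lemma grad_splitr a b : grad_split a b vi = b.
Proof. by rewrite /grad_split (unsplitK (inr ord0)). Qed.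

Lemma split_ind (P : 'I_N -> Prop) : (forall k, P (hi k)) -> P vi -> forall i, P i.
Proof.
move=> Ph Pv i; rewrite -(splitK i); case: (fintype.split i) => k //=.
by rewrite ord1.
Qed.

Lemma sum_split (F : 'I_N -> R) : \sum_i F i = \sum_k F (hi k) + F vi.
Proof. by rewrite big_split_ord/= big_ord1. Qed.

Lemma hpartE (y : 'rV[R]_N) k : hpart y 0 k = y 0 (hi k).
Proof. by rewrite mxE. Qed.

Lemma vpartE (y : 'rV[R]_N) : vpart y = y 0 vi.
Proof. by rewrite /vpart mxE. Qed.

Lemma hpart_row (x : 'rV[R]_n) t : hpart (row_mx x t%:M) = x.
Proof. by rewrite /hpart row_mxKl. Qed.

Lemma vpart_row (x : 'rV[R]_n) t : vpart (row_mx x t%:M) = t.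
Proof. by rewrite /vpart row_mxKr mxE eqxx mulr1n. Qed.

Lemma dotp_split (u v : 'rV[R]_N) :
  dotp u v = dotp (hpart u) (hpart v) + vpart u * vpart v.
Proof.
rewrite /dotp sum_split !vpartE; congr (_ + _).
by apply: eq_bigr => k _; rewrite !hpartE.
Qed.

Lemma has_grad_split f (y : 'rV[R]_N) G a b : has_grad f y G ->
  (forall k, G (hi k) = a k) -> G vi = b -> has_grad f y (grad_split a b).
Proof.
move=> fG Ga Gb; apply: has_grad_eq fG _; apply: split_ind => [k|].
  by rewrite grad_splitl.
by rewrite grad_splitr.
Qed.

Lemma has_grad_hcoord k (y : 'rV[R]_N) :
  has_grad (fun z => z 0 (hi k)) y (grad_split (fun j => (j == k)%:R) 0).
Proof.
apply: has_grad_split (has_grad_coord _ _) _ _ => [j|].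
  by rewrite eq_lshift.
by rewrite eq_rlshift.
Qed.

Lemma has_grad_vpart (g : R -> R) dg (y : 'rV[R]_N) : has_der g (vpart y) dg ->
  has_grad (fun z => g (vpart z)) y (grad_split (fun=> 0) dg).
Proof.
move=> gd; have : has_grad (fun z : 'rV[R]_N => vpart z) y (grad_split (fun=> 0) 1).
  rewrite (_ : (fun z => vpart z) = (fun z : 'rV[R]_N => z 0 vi)); last by apply/funext => z; rewrite vpartE.
  apply: has_grad_split (has_grad_coord _ _) _ _ => [j|].
    by rewrite eq_lrshift.
  by rewrite eqxx.
move=> /(has_grad_comp gd) H; apply: has_grad_split H _ _ => [k|].
  by rewrite grad_splitl mulr0.
by rewrite grad_splitr mulr1.
Qed.

Lemma has_grad_enorm (y : 'rV[R]_N) : hpart y != 0 ->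
  has_grad (fun z => enorm (hpart z)) y
    (grad_split (fun k => y 0 (hi k) / enorm (hpart y)) 0).
Proof.
move=> y0.
have H : has_grad (fun z : 'rV[R]_N => \sum_k z 0 (hi k) * z 0 (hi k)) y _ :=
  has_grad_sum (fun k => has_gradM (has_grad_hcoord k y) (has_grad_hcoord k y)).
have E z : dotp (hpart z) (hpart z) = \sum_k z 0 (hi k) * z 0 (hi k) :> R.
  by rewrite dotpE; apply: eq_bigr => k _; rewrite !hpartE.
have dp : 0 < \sum_k y 0 (hi k) * y 0 (hi k) by rewrite -E dotp_gt0.
have := has_grad_comp (is_derive1_sqrt dp) H.
rewrite -E -/(enorm _).
rewrite (_ : (fun z => Num.sqrt _) = (fun z => enorm (hpart z))); last first.
  by apply/funext => z; rewrite /enorm E.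
have r0 : enorm (hpart y) != 0 by rewrite gt_eqF// enorm_gt0.
move=> K; apply: has_grad_split K _ _ => [k|].
  rewrite (bigD1 k)//= big1 => [|j jk]; rewrite !grad_splitl ?eqxx.
    by rewrite addr0 mulr1; field.
  by rewrite eq_sym (negbTE jk) !mulr0 addr0.
by rewrite big1 ?mulr0// => k _; rewrite grad_splitr !mulr0 addr0.
Qed.

End Split.

(** * Tangential calculus on the catenoid *)

Section Geometry.
Context {R : realType}.
Variables (n : nat) (h0 : R).
Hypotheses (hn : (3 <= n)%N) (h0_gt0 : 0 < h0).
Local Notation N := (n + 1)%N.
Local Notation m := n.-1.
Local Notation hi k := (lshift 1 k : 'I_N).
Local Notation vi := (rshift n (@ord0 0) : 'I_N).
Local Notation dom := (@cat_dom R n h0).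
Local Notation h := (@cat_h R n h0).
Local Notation h1 := (cat_h1 n h0).
Local Notation h2 := (cat_h2 n h0).
Local Notation C := (@catenoid R n h0).
Local Notation U := (@cat_nbhd R n h0).
Local Notation ret := (@cat_retr R n h0).
Local Notation nu := (@cat_nu R n h0).
Local Notation rad y := (enorm (hpart y)).
Implicit Types (y z p : 'rV[R]_N) (f : 'rV[R]_N -> R^o) (X : 'rV[R]_N -> 'rV[R]_N).

Let h0_neq0 : h0 != 0. Proof. exact: lt0r_neq0. Qed.

(* 1 / sqrt(1 + h'^2) *)
Definition cat_u (t : R) : R := (h0 / h t) ^+ m.

Lemma cat_u_gt0 t : dom t -> 0 < cat_u t.
Proof. by move=> dt; rewrite exprn_gt0// divr_gt0//; exact: cat_h_gt0 dt. Qed.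

Lemma cat_h1_u t : dom t -> h1 t ^+ 2 * cat_u t ^+ 2 = 1 - cat_u t ^+ 2.
Proof.
move=> dt; rewrite cat_h1_sqr// mulrBl mul1r /cat_u -exprM mulnC -exprMn.
have ht : h t != 0 by rewrite gt_eqF//; exact: cat_h_gt0 dt.
by rewrite [X in X ^+ _ - _](_ : _ = 1) ?expr1n//; field; rewrite h0_neq0 ht.
Qed.

(** The minimal surface equation [h h'' = (n-1) (1 + h'^2)] of the rotation profile, since
    [u^-2 = 1 + h'^2]. *)
Lemma cat_h2_u t : dom t -> h2 t * cat_u t ^+ 2 = m%:R / h t.
Proof.
move=> dt; have ht : h t != 0 by rewrite gt_eqF//; exact: cat_h_gt0 dt.
have E : (h t / h0) ^+ (2 * m) * cat_u t ^+ 2 = 1.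
  rewrite /cat_u -exprM [(m * 2)%N]mulnC -exprMn.
  by rewrite [X in X ^+ _](_ : _ = 1) ?expr1n//; field; rewrite h0_neq0 ht.
by rewrite cat_h2E// -[RHS]mulr1 -E mulrAC -!mulrA [_^-1 * (_ * _)]mulrC !mulrA.
Qed.

Lemma has_der_cat_u t : dom t -> has_der cat_u t (- m%:R * cat_u t * h1 t / h t).
Proof.
move=> dt; have ht : h t != 0 by rewrite gt_eqF//; exact: cat_h_gt0 dt.
apply: has_der_eq (has_derX m (has_derZ h0 (has_derV ht (has_der_cat_h hn h0_gt0 dt)))) _.
have -> : cat_u t = (h0 / h t) ^+ m.-1 * (h0 / h t).
  by rewrite -exprSr prednK//; case: n hn => [|[]].
by move: (_ ^+ m.-1) => P; field.
Qed.

Lemma sqrt_1h1 t : dom t -> Num.sqrt (1 + derive1 h t ^+ 2) = (cat_u t)^-1.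
Proof.
move=> dt; rewrite (derive1_cat_h hn h0_gt0 dt) cat_h1_sqr// subrKC mulnC exprM.
rewrite sqrtr_sqr ger0_norm; first by rewrite /cat_u -exprVn invf_div.
by rewrite exprn_ge0// divr_ge0 ?ltW//; exact: cat_h_gt0 dt.
Qed.

Lemma nbhd_dom y : U y -> dom (vpart y). Proof. by case. Qed.

Lemma nbhd_rad y : U y -> 0 < rad y. Proof. by case=> _; rewrite enorm_gt0. Qed.

Lemma nbhd_h y : U y -> 0 < h (vpart y).
Proof. by move=> /nbhd_dom; exact: cat_h_gt0. Qed.

Lemma cat_nu_h y k : U y -> nu y 0 (hi k) = cat_u (vpart y) * (y 0 (hi k) / rad y).
Proof.
move=> Uy; rewrite /cat_nu mxE row_mxEl (sqrt_1h1 (nbhd_dom Uy)) invrK.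
by rewrite !mxE mulrC [_^-1 * _]mulrC mulrC.
Qed.

Lemma cat_nu_v y : U y -> nu y 0 vi = - h1 (vpart y) * cat_u (vpart y).
Proof.
move=> Uy; rewrite /cat_nu mxE row_mxEr (sqrt_1h1 (nbhd_dom Uy)) invrK.
by rewrite (derive1_cat_h hn h0_gt0 (nbhd_dom Uy)) mxE eqxx mulr1n mulrC.
Qed.

Lemma hpart_ret y : hpart (ret y) = h (vpart y) *: udir (hpart y).
Proof. by rewrite /cat_retr /catF hpart_row. Qed.

Lemma vpart_ret y : vpart (ret y) = vpart y.
Proof. by rewrite /cat_retr /catF vpart_row. Qed.

Lemma rad_ret y : U y -> rad (ret y) = h (vpart y).
Proof.
move=> Uy; rewrite hpart_ret enormZ enorm_udir ?mulr1; last by case: Uy.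
by rewrite gtr0_norm// nbhd_h.
Qed.

Lemma ret_coord y k : ret y 0 (hi k) = h (vpart y) * (y 0 (hi k) / rad y).
Proof. by rewrite -hpartE hpart_ret /udir !mxE [_ * y 0 _]mulrC. Qed.

Lemma ret_nbhd y : U y -> U (ret y).
Proof.
move=> Uy; split; first by rewrite vpart_ret; exact: nbhd_dom.
by rewrite -enorm_gt0 rad_ret// nbhd_h.
Qed.

Lemma ret_scale y c : 0 < c -> ret (row_mx (c *: hpart y) (vpart y)%:M) = ret y.
Proof. by move=> c0; rewrite /cat_retr hpart_row vpart_row udirZ. Qed.

Lemma ret_ret y : U y -> ret (ret y) = ret y.
Proof.
move=> Uy; rewrite {1}/cat_retr hpart_ret vpart_ret udirZ ?nbhd_h//.
by rewrite udir_id.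
Qed.

Lemma ret_catenoid y : U y -> C (ret y).
Proof.
move=> Uy; exists (vpart y); first exact: nbhd_dom.
by exists (udir (hpart y)) => //; apply: enorm_udir; case: Uy.
Qed.

Lemma catenoidP y : C y -> U y /\ ret y = y.
Proof.
move=> [t dt [w w1 <-]]; have ht := cat_h_gt0 hn h0_gt0 dt.
rewrite /catF /cat_retr; split.
  split; first by rewrite vpart_row.
  by rewrite hpart_row -enorm_gt0 enormZ w1 mulr1 normr_gt0 gt_eqF.
by rewrite hpart_row vpart_row udirZ// udir_unit.
Qed.

Lemma catenoid_nbhd y : C y -> U y. Proof. by move=> /catenoidP[]. Qed.

Lemma cat_nu_ret y : U y -> nu (ret y) = nu y.
Proof.
by move=> Uy; rewrite /cat_nu vpart_ret hpart_ret udirZ ?udir_id// nbhd_h.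
Qed.

Lemma cat_nbhd_open : open U.
Proof.
have H1 : open [set y : 'rV[R]_N | dom (y 0 vi)].
  apply: (@open_comp _ _ (fun y : 'rV[R]_N => y 0 vi) dom).
    by move=> y _; exact: coord_continuous.
  exact: cat_dom_open.
have H2 : open (\bigcup_(k in [set: 'I_n]) [set y : 'rV[R]_N | y 0 (hi k) != 0]).
  apply: bigcup_open => k _; apply: (@open_comp _ _ (fun y : 'rV[R]_N => y 0 (hi k)) [set x | x != 0]).
    by move=> y _; exact: coord_continuous.
  rewrite (_ : [set x | x != 0] = ~` [set 0]).
    by rewrite openC; apply: accessible_closed_set1; exact: hausdorff_accessible.
  by apply/seteqP; split=> x /= /eqP.
rewrite (_ : U = [set y : 'rV[R]_N | dom (y 0 vi)] `&`
  \bigcup_(k in [set: 'I_n]) [set y : 'rV[R]_N | y 0 (hi k) != 0]); first exact: openI.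
apply/seteqP; split=> y /=.
  move=> [dy y0]; split; first by rewrite /= -vpartE.
  apply: contrapT => H; move/eqP: y0; apply.
  apply/rowP => k; rewrite hpartE mxE; apply: contrapT => /eqP yk.
  by apply: H; exists k.
move=> [/= dy [k _ /= yk]]; split; first by rewrite /= vpartE.
by apply: contra_neq yk => y0; rewrite -hpartE y0 mxE.
Qed.

Lemma near_nbhd y : U y -> \forall z \near y, U z.
Proof. by move=> Uy; apply: open_nbhs_nbhs; split=> //; exact: cat_nbhd_open. Qed.

Definition scale_h (c : R) (y : 'rV[R]_N) : 'rV[R]_N := row_mx (c *: hpart y) (vpart y)%:M.

Lemma scale_h_coord c y k : scale_h c y 0 (hi k) = c * y 0 (hi k).
Proof. by rewrite /scale_h row_mxEl mxE hpartE. Qed.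

Lemma scale_h_vert c y : scale_h c y 0 vi = y 0 vi.
Proof. by rewrite /scale_h row_mxEr mxE eqxx mulr1n vpartE. Qed.

Lemma scale_h_ret y : U y -> scale_h (h (vpart y) / rad y) y = ret y.
Proof. by move=> Uy; rewrite /scale_h /cat_retr /catF /udir scalerA. Qed.

(* Functions lifted by the retraction are homogeneous of degree 0 in the
   horizontal variable, hence their horizontal gradients have degree -1. *)
Lemma partial_lift_h f y k : U y -> differentiable (f \o ret) (ret y) ->
  partial (hi k) (f \o ret) (ret y) = rad y / h (vpart y) * partial (hi k) (f \o ret) y.
Proof.
move=> Uy df; have ry := nbhd_rad Uy; have hy := nbhd_h Uy.
set c := h (vpart y) / rad y; have c0 : 0 < c by rewrite divr_gt0.
have E : f \o ret = (f \o ret) \o scale_h c.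
  by apply/funext => z; rewrite /= /scale_h ret_scale.
have S (s : R) : scale_h c (s *: evec (hi k) + y) = s *: (c *: evec (hi k)) + scale_h c y.
  apply/rowP; apply: split_ind => [j|]; rewrite [RHS]mxE.
    by rewrite !scale_h_coord !mxE; ring.
  rewrite !scale_h_vert !mxE eq_rlshift/=; ring.
rewrite [in RHS]E /partial (derive_affine (f \o ret) S) scale_h_ret//.
rewrite [in RHS]deriveE// linearZ/= -[in RHS]deriveE// mulrA /c.
by rewrite [X in _ = X * _](_ : _ = 1) ?mul1r//; field; rewrite !gt_eqF.
Qed.

Lemma partial_lift_v f y : U y ->
  partial vi (f \o ret) (ret y) = partial vi (f \o ret) y.
Proof.
move=> Uy; have ry := nbhd_rad Uy; have hy := nbhd_h Uy.
set c := h (vpart y) / rad y; have c0 : 0 < c by rewrite divr_gt0.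
have E : f \o ret = (f \o ret) \o scale_h c.
  by apply/funext => z; rewrite /= /scale_h ret_scale.
have S (s : R) : scale_h c (s *: evec vi + y) = s *: evec vi + scale_h c y.
  apply/rowP; apply: split_ind => [j|]; rewrite [RHS]mxE.
    by rewrite !scale_h_coord !mxE eq_lrshift/=; ring.
  by rewrite !scale_h_vert !mxE.
by rewrite [in RHS]E /partial (derive_affine (f \o ret) S) scale_h_ret.
Qed.

(** Euler's identity in degree 0: the lift is constant along the horizontal ray through [y], so its
    radial derivative vanishes. *)
Lemma partial_lift_euler f y : differentiable (f \o ret) y ->
  \sum_k y 0 (hi k) * partial (hi k) (f \o ret) y = 0.
Proof.
move=> df.
pose v : 'rV[R]_N := row_mx (hpart y) 0.
have vh k : v 0 (hi k) = y 0 (hi k) by rewrite /v row_mxEl hpartE.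
have vv : v 0 vi = 0 by rewrite /v row_mxEr mxE.
have -> : \sum_k y 0 (hi k) * partial (hi k) (f \o ret) y = 'D_v (f \o ret) y.
  rewrite (has_grad_derive v (has_gradP df)) sum_split vv mul0r addr0.
  by apply: eq_bigr => k _; rewrite vh.
pose L (s : R^o) : 'rV[R]_N := s *: v + y.
have LE (s : R) : L (s *: (1 : R^o) + 0) = s *: v + L 0.
  by rewrite /L scale0r add0r addr0 [s *: 1]mulr1.
have := derive_affine (f \o ret) LE; rewrite {2}/L scale0r add0r => <-.
rewrite (@near_eq_derive _ _ _ _ (cst ((f \o ret) y))) ?derive_cst//.
near=> s; rewrite /= ; have s1 : 0 < 1 + s.
  rewrite -ltrBlDl sub0r; apply: (@lt_le_trans _ _ (- `|s|)); last first.
    by rewrite lerNl; rewrite -normrN ler_norm.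
  rewrite ltrN2; near: s; apply: near_normr_lt.
  by rewrite normr0.
rewrite (_ : L s = scale_h (1 + s) y); first by rewrite /scale_h ret_scale.
apply/rowP; apply: split_ind => [k|]; rewrite /L mxE [X in X + _]mxE.
  by rewrite vh scale_h_coord; ring.
by rewrite vv scale_h_vert mulr0 add0r.
Unshelve. all: by end_near. Qed.

Lemma tgradE f y i : tgrad h0 f y 0 i = partial i (f \o ret) y -
  (\sum_k partial k (f \o ret) y * nu y 0 k) * nu y 0 i.
Proof.
rewrite /tgrad mulmxBr mulmx1 mxE [X in X + _]mxE; congr (_ + _).
rewrite mxE mulmxA [in X in - X]mxE big_ord1; congr (- (_ * _)).
by rewrite mxE; apply: eq_bigr => k _; rewrite !mxE.
Qed.

Lemma sum_nu_sqr y : U y -> \sum_k nu y 0 k * nu y 0 k = 1.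
Proof.
move=> Uy; rewrite sum_split cat_nu_v//.
have -> : \sum_k nu y 0 (hi k) * nu y 0 (hi k) = cat_u (vpart y) ^+ 2.
  under eq_bigr do rewrite cat_nu_h//.
  have r0 : rad y != 0 by rewrite gt_eqF// nbhd_rad.
  transitivity (cat_u (vpart y) ^+ 2 * (dotp (hpart y) (hpart y) / rad y ^+ 2)).
    rewrite dotpE mulr_suml mulr_sumr; apply: eq_bigr => k _; rewrite hpartE.
    by field.
  by rewrite sqr_enorm divff ?mulr1// dotp_eq0; case: Uy.
have := cat_h1_u (nbhd_dom Uy); move: (h1 _) (cat_u _) => a b E.
by transitivity (b ^+ 2 + a ^+ 2 * b ^+ 2); [ring|rewrite E; ring].
Qed.

Lemma tgrad_nu f y : U y -> dotp (tgrad h0 f y) (nu y) = 0.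
Proof.
move=> Uy; rewrite dotpE; under eq_bigr do rewrite tgradE mulrBl -mulrA.
by rewrite big_split/= sumrN -mulr_sumr sum_nu_sqr// mulr1 subrr.
Qed.

Lemma tangential_tgrad f : tangential h0 (tgrad h0 f).
Proof. by move=> y /catenoid_nbhd; exact: tgrad_nu. Qed.

Lemma div_CM f X p : C p -> differentiable (f \o ret) p ->
  (forall i, differentiable ((fun z => X z 0 i : R^o) \o ret) p) ->
  div_C h0 (fun z => f z *: X z) p =
    f p * div_C h0 X p + dotp (tgrad h0 f p) (X p).
Proof.
move=> /catenoidP[_ rp] df dX.
rewrite /div_C mulr_sumr dotpE -big_split/=; apply: eq_bigr => i _.
rewrite /tpartial !tgradE.
have P k : partial k ((fun z => (f z *: X z) 0 i : R^o) \o ret) p =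
    f p * partial k ((fun z => X z 0 i : R^o) \o ret) p + X p 0 i * partial k (f \o ret) p.
  have [_ H] := has_gradM (has_gradP df) (has_gradP (dX i)).
  rewrite (_ : _ \o ret = (fun z => (f \o ret) z * ((fun z => X z 0 i : R^o) \o ret) z)).
    by rewrite H/= rp.
  by apply/funext => z /=; rewrite mxE.
under eq_bigr do rewrite P mulrDl -!mulrA.
by rewrite P big_split/= -!mulr_sumr; ring.
Qed.

Section Divergence.
Variable X : 'rV[R]_N -> 'rV[R]_N.
Hypothesis tX : tangential h0 X.
Local Notation Z i := ((fun z => X z 0 i : R^o) \o ret).
Hypothesis dX : forall i y, U y -> differentiable (Z i) y.

(** The tangency condition at [ret y], with the normal [u (w, - h')] written out and the positive
    factor [u / rad y] removed. *)
Lemma tangential_lift y : U y ->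
  \sum_k y 0 (hi k) * Z (hi k) y = rad y * h1 (vpart y) * Z vi y.
Proof.
move=> Uy; have := tX (ret_catenoid Uy); rewrite dotpE sum_split cat_nu_ret//.
rewrite cat_nu_v//; under eq_bigr do rewrite cat_nu_h//.
move=> H; have ry := nbhd_rad Uy; have u0 := cat_u_gt0 (nbhd_dom Uy).
have r0 : rad y != 0 by rewrite gt_eqF.
have u0' : cat_u (vpart y) != 0 by rewrite gt_eqF.
have E : \sum_k X (ret y) 0 (hi k) * (cat_u (vpart y) * (y 0 (hi k) / rad y)) =
    cat_u (vpart y) / rad y * \sum_k y 0 (hi k) * Z (hi k) y.
  by rewrite mulr_sumr; apply: eq_bigr => k _ /=; field.
move: H; rewrite E => /eqP; rewrite addr_eq0 => /eqP H.
apply: (@mulfI _ (cat_u (vpart y) / rad y)); first by rewrite mulf_neq0// invr_neq0.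
by rewrite H /=; field.
Qed.

(** The tangency relation holds on an open set, so it can be differentiated in the height; this is
    where [h''] enters the divergence. *)
Lemma tangential_lift_v y : U y ->
  \sum_k y 0 (hi k) * partial vi (Z (hi k)) y =
  rad y * (h2 (vpart y) * Z vi y + h1 (vpart y) * partial vi (Z vi) y).
Proof.
move=> Uy.
have H1 := has_grad_sum (fun k => has_gradM (has_grad_hcoord k y)
  (has_gradP (dX (hi k) Uy))).
have H2 := has_gradM (has_gradM (has_grad_enorm Uy.2)
  (has_grad_vpart (has_der_cat_h1 hn h0_gt0 (nbhd_dom Uy)))) (has_gradP (dX vi Uy)).
have [_ H3] := has_grad_near (f := fun z => \sum_k z 0 (hi k) * Z (hi k) z)
  (g := fun z => rad z * h1 (vpart z) * Z vi z)
  (filterS (fun z => @tangential_lift z) (near_nbhd Uy)) H1.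
have [_ H4] := H2.
have := H3 vi; rewrite H4 !grad_splitr mulr0 addr0.
rewrite (eq_bigr (fun k => y 0 (hi k) * partial vi (Z (hi k)) y)); last first.
  by move=> k _; rewrite grad_splitr mulr0 addr0.
by move=> <-; ring.
Qed.

(** The divergence is the full trace of the derivative minus its normal-normal part. By the
    differentiated tangency relation that part is [- h' h'' u^2] times the vertical component of
    [X], and [h'' u^2 = (n-1) / h] turns it into the last term. The factor [rad y / h] converts
    horizontal derivatives at [y] into those at [ret y]. *)
Lemma div_CE y : U y -> div_C h0 X (ret y) =
  rad y / h (vpart y) * \sum_k partial (hi k) (Z (hi k)) y +
  partial vi (Z vi) y + m%:R * h1 (vpart y) / h (vpart y) * Z vi y.
Proof.
move=> Uy; have Ur := ret_nbhd Uy.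
set t := vpart y; have ht : h t != 0 by rewrite gt_eqF// nbhd_h.
have r0 : rad y != 0 by rewrite gt_eqF// nbhd_rad.
have nuh k : nu (ret y) 0 (hi k) = cat_u t * (y 0 (hi k) / rad y).
  by rewrite cat_nu_ret// cat_nu_h.
have nuv : nu (ret y) 0 vi = - h1 t * cat_u t by rewrite cat_nu_ret// cat_nu_v.
(* The horizontal part of the normal is radial, hence killed by Euler's identity; only the vertical
   term of the normal derivative survives. *)
have N i : \sum_k partial k (Z i) (ret y) * nu (ret y) 0 k =
    - h1 t * cat_u t * partial vi (Z i) y.
  rewrite sum_split nuv partial_lift_v// [X in X + _](_ : _ = 0) ?add0r; last first.
    under eq_bigr do rewrite nuh.
    transitivity (cat_u t / h t * \sum_k ret y 0 (hi k) * partial (hi k) (Z i) (ret y)).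
      rewrite mulr_sumr; apply: eq_bigr => k _; rewrite ret_coord -/t; by field; rewrite ht r0.
    by rewrite partial_lift_euler ?mulr0//; exact: dX.
  by rewrite mulrC.
rewrite /div_C /tpartial; under eq_bigr do rewrite tgradE N.
rewrite big_split/= sumrN sum_split partial_lift_v//.
rewrite [X in X + _ - _](_ : _ = rad y / h t * \sum_k partial (hi k) (Z (hi k)) y); last first.
  by rewrite mulr_sumr; apply: eq_bigr => k _; rewrite partial_lift_h//; exact: dX.
rewrite [X in _ - X](_ : _ = - (m%:R * h1 t / h t * Z vi y)); first by rewrite opprK.
have -> : \sum_i - h1 t * cat_u t * partial vi (Z i) y * nu (ret y) 0 i =
    - h1 t * cat_u t * (cat_u t / rad y * (\sum_k y 0 (hi k) * partial vi (Z (hi k)) y)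
      - h1 t * cat_u t * partial vi (Z vi) y).
  rewrite sum_split nuv mulrBr mulr_sumr mulr_sumr; congr (_ + _); last by ring.
  by apply: eq_bigr => k _; rewrite nuh; field.
rewrite tangential_lift_v// -/t.
have E2 := cat_h2_u (nbhd_dom Uy); rewrite -/t in E2.
transitivity (- h1 t * (h2 t * cat_u t ^+ 2) * Z vi y); last by rewrite E2; ring.
by field.
Qed.

End Divergence.
End Geometry.

(** * Horizontal translation fields *)

Section Jacobi.
Context {R : realType}.
Variables (n : nat) (h0 : R).
Hypotheses (hn : (3 <= n)%N) (h0_gt0 : 0 < h0).
Local Notation N := (n + 1)%N.
Local Notation m := n.-1.
Local Notation hi k := (lshift 1 k : 'I_N).
Local Notation vi := (rshift n (@ord0 0) : 'I_N).
Local Notation dom := (@cat_dom R n h0).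
Local Notation h := (@cat_h R n h0).
Local Notation h1 := (cat_h1 n h0).
Local Notation h2 := (cat_h2 n h0).
Local Notation u := (cat_u n h0).
Local Notation C := (@catenoid R n h0).
Local Notation U := (@cat_nbhd R n h0).
Local Notation ret := (@cat_retr R n h0).
Local Notation nu := (@cat_nu R n h0).
Local Notation rad y := (enorm (hpart y)).
Implicit Types (y z p : 'rV[R]_N) (f : 'rV[R]_N -> R^o).

Let nE : n%:R = m%:R + 1 :> R.
Proof. by rewrite natr1 prednK//; case: n hn. Qed.

Definition wdir (k : 'I_n) (y : 'rV[R]_N) : R := y 0 (hi k) / rad y.

Lemma wdir_ret k y : U y -> wdir k (ret y) = wdir k y.
Proof.
move=> Uy; rewrite /wdir rad_ret// ret_coord mulrC mulKf//.
by rewrite gt_eqF//; exact: nbhd_h Uy.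
Qed.

Lemma sum_wdir2 y : U y -> \sum_k wdir k y * wdir k y = 1.
Proof.
move=> Uy; have r0 : rad y != 0 by rewrite gt_eqF//; exact: nbhd_rad Uy.
transitivity (dotp (hpart y) (hpart y) / rad y ^+ 2).
  by rewrite dotpE mulr_suml; apply: eq_bigr => k _; rewrite hpartE /wdir; field.
by rewrite sqr_enorm divff// dotp_eq0; case: Uy.
Qed.

Lemma has_grad_radV y : U y -> has_grad (fun z => (rad z)^-1) y
  (grad_split (fun j => - wdir j y * ((rad y)^-1 * (rad y)^-1)) 0).
Proof.
move=> Uy; have r0 : rad y != 0 by rewrite gt_eqF//; exact: nbhd_rad Uy.
have H := @has_grad_comp R _ (fun t => t^-1) _ (fun z : 'rV[R]_N => rad z) y _
  (@has_derV R (fun t => t) (rad y) 1 r0 (has_der_id _))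
  (has_grad_enorm Uy.2).
apply: has_grad_split H _ _ => [k|]; last by rewrite grad_splitr mulr0.
by rewrite grad_splitl /wdir; field.
Qed.

Lemma has_grad_wdir k y : U y -> has_grad (wdir k) y
  (grad_split (fun j => ((j == k)%:R - wdir k y * wdir j y) * (rad y)^-1) 0).
Proof.
move=> Uy; have r0 : rad y != 0 by rewrite gt_eqF//; exact: nbhd_rad Uy.
have H := has_gradM (has_grad_hcoord k y) (has_grad_radV Uy).
apply: has_grad_split H _ _ => [j|]; last by rewrite !grad_splitr !mulr0 addr0.
by rewrite !grad_splitl /wdir; field.
Qed.

Section Combination.
Variable c : 'I_n -> R.

Definition cdir (y : 'rV[R]_N) : R := \sum_k c k * wdir k y.

Lemma cdir_ret y : U y -> cdir (ret y) = cdir y.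
Proof. by move=> Uy; apply: eq_bigr => k _; rewrite wdir_ret. Qed.

Lemma has_grad_cdir y : U y -> has_grad cdir y
  (grad_split (fun j => (c j - cdir y * wdir j y) * (rad y)^-1) 0).
Proof.
move=> Uy; have H := has_grad_sum (fun k => has_gradZ (c k) (has_grad_wdir k Uy)).
apply: has_grad_split H _ _ => [j|]; last first.
  by rewrite big1// => k _; rewrite grad_splitr mulr0.
under eq_bigr do rewrite grad_splitl mulrA mulrBr.
rewrite -mulr_suml big_split/= (bigD1 j)//= eqxx mulr1 big1 ?addr0; last first.
  by move=> k kj; rewrite eq_sym (negbTE kj) mulr0.
by congr (_ * _); rewrite /cdir sumrN mulr_suml; congr (_ - _); apply: eq_bigr => k _; ring.
Qed.

Variable f : 'rV[R]_N -> R^o.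
Hypothesis fE : forall y, C y -> f y = u (vpart y) * cdir y.

Lemma comb_lift y : U y -> (f \o ret) y = u (vpart y) * cdir y.
Proof. by move=> Uy; rewrite /= fE ?vpart_ret ?cdir_ret//; exact: ret_catenoid. Qed.

Local Notation u1 t := (- m%:R * u t * h1 t / h t).

Lemma has_grad_comb y : U y -> has_grad (f \o ret) y (grad_split
  (fun j => u (vpart y) * ((c j - cdir y * wdir j y) / rad y))
  (u1 (vpart y) * cdir y)).
Proof.
move=> Uy; apply: (has_grad_near (f := fun z => u (vpart z) * cdir z)).
  by apply: filterS (near_nbhd Uy) => z Uz; rewrite comb_lift.
have H := has_gradM (has_grad_vpart (has_der_cat_u hn h0_gt0 (nbhd_dom Uy)))
  (has_grad_cdir Uy).
apply: has_grad_split H _ _ => [j|]; first by rewrite !grad_splitl mulr0 addr0.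
by rewrite !grad_splitr mulr0 add0r mulrC.
Qed.

(** Coefficients of the tangential gradient of [u <c,w>]: its horizontal part is
    [(u / h) c + comb_B <c,w> w], its vertical part [comb_C <c,w>]. *)
Definition comb_B (t : R) : R := - (u t / h t) - m%:R * (u t * (1 - u t ^+ 2)) / h t.
Definition comb_C (t : R) : R := - m%:R * u t ^+ 3 * h1 t / h t.

Let sum_cw y : U y -> \sum_k (c k - cdir y * wdir k y) * wdir k y = 0.
Proof.
move=> Uy; under eq_bigr do rewrite mulrBl -mulrA.
by rewrite big_split/= sumrN -mulr_sumr sum_wdir2// mulr1 subrr.
Qed.

Let tg_dot y : U y ->
  \sum_k partial k (f \o ret) (ret y) * nu (ret y) 0 k =
  - (m%:R * u (vpart y) ^+ 2 * h1 (vpart y) / h (vpart y)) * (- h1 (vpart y) * cdir y).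
Proof.
move=> Uy; have Ur := ret_nbhd hn h0_gt0 Uy; have [_ H] := has_grad_comb Ur.
rewrite sum_split cat_nu_v// H grad_splitr !vpart_ret cdir_ret//.
rewrite [X in X + _](_ : _ = 0) ?add0r; first by ring.
under eq_bigr do rewrite H grad_splitl cat_nu_h// -/(wdir _ _) vpart_ret cdir_ret// !wdir_ret//.
transitivity (u (vpart y) ^+ 2 / rad (ret y) * \sum_k (c k - cdir y * wdir k y) * wdir k y).
  by rewrite mulr_sumr; apply: eq_bigr => k _; ring.
by rewrite sum_cw// mulr0.
Qed.

Lemma tgrad_comb_h y k : U y -> tgrad h0 f (ret y) 0 (hi k) =
  u (vpart y) / h (vpart y) * c k + comb_B (vpart y) * (cdir y * wdir k y).
Proof.
move=> Uy; have Ur := ret_nbhd hn h0_gt0 Uy; have [_ H] := has_grad_comb Ur.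
rewrite tgradE tg_dot// H grad_splitl cat_nu_h// -/(wdir _ _) !vpart_ret.
rewrite cdir_ret// wdir_ret// rad_ret// /comb_B.
have := cat_h1_u hn h0_gt0 (nbhd_dom Uy).
have : h (vpart y) != 0 by rewrite gt_eqF//; exact: nbhd_h Uy.
move: (h1 _) (h _) (u _) (cdir y) (wdir _ _) => a b d q w b0 E.
rewrite -E; field; exact: b0.
Qed.

Lemma tgrad_comb_v y : U y -> tgrad h0 f (ret y) 0 vi = comb_C (vpart y) * cdir y.
Proof.
move=> Uy; have Ur := ret_nbhd hn h0_gt0 Uy; have [_ H] := has_grad_comb Ur.
rewrite tgradE tg_dot// H grad_splitr cat_nu_v// !vpart_ret cdir_ret// /comb_C.
have := cat_h1_u hn h0_gt0 (nbhd_dom Uy).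
have : h (vpart y) != 0 by rewrite gt_eqF//; exact: nbhd_h Uy.
move: (h1 _) (h _) (u _) (cdir y) => a b d q b0 E.
transitivity (- m%:R * d / b * a * q * (1 - a ^+ 2 * d ^+ 2)); first by field.
by rewrite E; field.
Qed.

Let has_der_uh t : dom t -> {d | has_der (fun t => u t / h t) t d}.
Proof.
move=> dt; have ht : h t != 0 by rewrite gt_eqF//; exact: cat_h_gt0 dt.
eexists; exact: has_derM (has_der_cat_u hn h0_gt0 dt) (has_derV ht (has_der_cat_h hn h0_gt0 dt)).
Qed.

Let has_der_B t : dom t -> {d | has_der comb_B t d}.
Proof.
move=> dt; have ht : h t != 0 by rewrite gt_eqF//; exact: cat_h_gt0 dt.
have [d Hd] := has_der_uh dt.
have Hu := has_der_cat_u hn h0_gt0 dt.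
have HV := has_derV ht (has_der_cat_h hn h0_gt0 dt).
eexists; apply: (has_derB (has_derN Hd)); apply: has_derM HV.
exact: has_derZ (has_derM Hu (has_derB (has_der_cst 1 t) (has_derX 2 Hu))).
Qed.

Lemma has_der_comb_C t : dom t -> has_der comb_C t
  (- m%:R * (u t * (1 - u t ^+ 2) * (- 3 * m%:R - 1) + m%:R * u t) / h t ^+ 2).
Proof.
move=> dt; have ht : h t != 0 by rewrite gt_eqF//; exact: cat_h_gt0 dt.
have Hu := has_der_cat_u hn h0_gt0 dt.
have HV := has_derV ht (has_der_cat_h hn h0_gt0 dt).
have H := has_derM (has_derM (has_derZ (- m%:R) (has_derX 3 Hu))
  (has_der_cat_h1 hn h0_gt0 dt)) HV.
apply: has_der_eq H _.
have E1 := cat_h1_u hn h0_gt0 dt; have E2 := cat_h2_u hn h0_gt0 dt.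
rewrite -E1.
transitivity (- m%:R * (u t * (h1 t ^+ 2 * u t ^+ 2) * (- 3 * m%:R - 1) / h t ^+ 2
   + u t * (h2 t * u t ^+ 2) / h t)); first by field.
by rewrite E2; field.
Qed.

Lemma has_grad_tgrad_h y k : U y -> {d | has_grad ((fun z => tgrad h0 f z 0 (hi k) : R^o) \o ret) y
  (grad_split (fun j => comb_B (vpart y) *
     (cdir y * (((j == k)%:R - wdir k y * wdir j y) * (rad y)^-1) +
      wdir k y * ((c j - cdir y * wdir j y) * (rad y)^-1))) d)}.
Proof.
move=> Uy; have dy := nbhd_dom Uy.
have [dA HA] := has_der_uh dy; have [dB HB] := has_der_B dy.
have H := has_gradD (has_gradM (has_grad_vpart HA) (has_grad_cst (c k) y))
  (has_gradM (has_grad_vpart HB) (has_gradM (has_grad_cdir Uy) (has_grad_wdir k Uy))).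
eexists; apply: (has_grad_near (f := fun y => u (vpart y) / h (vpart y) * c k +
    comb_B (vpart y) * (cdir y * wdir k y))).
  by apply: filterS (near_nbhd Uy) => z Uz; rewrite /= tgrad_comb_h.
apply: has_grad_split H _ _ => [j|]; last by [].
by rewrite !grad_splitl; ring.
Qed.

Lemma has_grad_tgrad_v y : U y -> has_grad ((fun z => tgrad h0 f z 0 vi : R^o) \o ret) y
  (grad_split (fun j => comb_C (vpart y) * ((c j - cdir y * wdir j y) * (rad y)^-1))
    (- m%:R * (u (vpart y) * (1 - u (vpart y) ^+ 2) * (- 3 * m%:R - 1) + m%:R * u (vpart y))
      / h (vpart y) ^+ 2 * cdir y)).
Proof.
move=> Uy; have dy := nbhd_dom Uy.
have H := has_gradM (has_grad_vpart (has_der_comb_C dy)) (has_grad_cdir Uy).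
apply: (has_grad_near (f := fun y => comb_C (vpart y) * cdir y)).
  by apply: filterS (near_nbhd Uy) => z Uz; rewrite /= tgrad_comb_v.
apply: has_grad_split H _ _ => [j|].
  by rewrite !grad_splitl mulr0 addr0.
by rewrite !grad_splitr mulr0 add0r mulrC.
Qed.

Lemma differentiable_tgrad_comb i y : U y ->
  differentiable ((fun z => tgrad h0 f z 0 i : R^o) \o ret) y.
Proof.
move=> Uy; move: i; apply: split_ind => [k|].
  by have [d []] := has_grad_tgrad_h k Uy.
by have [] := has_grad_tgrad_v Uy.
Qed.

(** The gradient is tangential, so [div_CE] applies to it. The horizontal trace contributes the
    factor [n - 1] as the trace of [1 - w^T w], the projection orthogonal to the direction. The
    factor multiplying [- f] turns out to be [|A|^2], which is the Jacobi equation. *)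
Lemma laplace_comb y : C y ->
  laplace_C h0 f y = - (n%:R * m%:R * u (vpart y) ^+ 2 / h (vpart y) ^+ 2) * f y.
Proof.
move=> Cy; have [Uy ry] := catenoidP hn h0_gt0 Cy.
rewrite fE// /laplace_C -{1}ry div_CE//; last exact: differentiable_tgrad_comb.
  have r0 : rad y != 0 by rewrite gt_eqF//; exact: nbhd_rad Uy.
  have ht : h (vpart y) != 0 by rewrite gt_eqF//; exact: nbhd_h Uy.
  rewrite [X in _ * X + _ + _](_ : _ = comb_B (vpart y) * cdir y * m%:R / rad y); last first.
    under eq_bigr => k _.
      have [d [_ ->]] := has_grad_tgrad_h k Uy; rewrite grad_splitl eqxx.
      over.
    transitivity (comb_B (vpart y) / rad y *
      (cdir y * (n%:R - \sum_k wdir k y * wdir k y) +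
       \sum_k (c k - cdir y * wdir k y) * wdir k y)).
      rewrite (_ : n%:R = \sum_(k < n) 1); last by rewrite sumr_const card_ord.
      rewrite -sumrB mulr_sumr -big_split/= mulr_sumr.
      by apply: eq_bigr => k _; ring.
    by rewrite sum_wdir2// sum_cw// nE; ring.
  have [_ ->] := has_grad_tgrad_v Uy; rewrite grad_splitr /= tgrad_comb_v//.
  have E := cat_h1_u hn h0_gt0 (nbhd_dom Uy).
  rewrite /comb_B /comb_C nE; move: E ht.
  move: (h1 _) (h _) (u _) (cdir y) (rad y) r0 => a b d q r r0 E b0.
  transitivity (- (d / b) * q * m%:R / b - m%:R * (d * (1 - d ^+ 2)) / b * q * m%:R / b
    - m%:R * (d * (1 - d ^+ 2) * (- 3 * m%:R - 1) + m%:R * d) / b ^+ 2 * q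
    - m%:R * m%:R * d * (a ^+ 2 * d ^+ 2) / b ^+ 2 * q); first by field; rewrite r0 b0.
  by rewrite E; field.
exact: tangential_tgrad.
Qed.

(** Pythagoras in an adapted frame: the first term comes from the parallel through the point, where
    [c - <c,w> w] is the tangential part of [c]; the second is the squared derivative
    [(n-1) u^2 h' <c,w> / h] along the meridian. *)
Lemma sum_tgrad_comb_sqr y : U y -> \sum_i tgrad h0 f (ret y) 0 i ^+ 2 =
  (u (vpart y) / h (vpart y)) ^+ 2 * (\sum_k c k ^+ 2 - cdir y ^+ 2) +
  (m%:R * u (vpart y) / h (vpart y)) ^+ 2 * (1 - u (vpart y) ^+ 2)
    * cdir y ^+ 2.
Proof.
move=> Uy; rewrite sum_split tgrad_comb_v//.
under eq_bigr do rewrite tgrad_comb_h//.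
have S (A B q : R) : \sum_k (A * c k + B * (q * wdir k y)) ^+ 2 =
    A ^+ 2 * (\sum_k c k ^+ 2) + 2 * A * B * q * (\sum_k c k * wdir k y) +
    B ^+ 2 * q ^+ 2 * (\sum_k wdir k y * wdir k y).
  rewrite !mulr_sumr -!big_split/=; apply: eq_bigr => k _.
  by move: (c k) (wdir k y) => a b; ring.
rewrite S sum_wdir2// -/(cdir y) /comb_B /comb_C; move: (cdir y) => q.
have E := cat_h1_u hn h0_gt0 (nbhd_dom Uy).
have ht : h (vpart y) != 0 by rewrite gt_eqF//; exact: nbhd_h Uy.
move: E ht; move: (\sum_k _) (h1 _) (h _) (u _) => s a b d E b0.
transitivity (d ^+ 2 / b ^+ 2 * s + (2 * (d / b) * (- (d / b) - m%:R * (d * (1 - d ^+ 2)) / b) +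
   (- (d / b) - m%:R * (d * (1 - d ^+ 2)) / b) ^+ 2
   + m%:R ^+ 2 * d ^+ 4 / b ^+ 2 * (a ^+ 2 * d ^+ 2)) * q ^+ 2).
  by field.
by rewrite E; field.
Qed.

End Combination.

(** In absolute value the principal curvatures are [u / h], with multiplicity [n - 1], and
    [(n-1) u / h] along the meridian; their squares add up to [n (n-1) u^2 / h^2]. *)
Lemma A2_ret y : U y ->
  A2 h0 (ret y) = n%:R * m%:R * u (vpart y) ^+ 2 / h (vpart y) ^+ 2.
Proof.
move=> Uy; have ht : h (vpart y) != 0 by rewrite gt_eqF//; exact: nbhd_h Uy.
rewrite /A2 exchange_big sum_split/=.
have E := cat_h1_u hn h0_gt0 (nbhd_dom Uy).
(* Each horizontal component of the normal is a function [u <e_j,w>], so the squared-gradient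
   formula for combinations applies to it. *)
have hor j : \sum_i tgrad h0 (fun z => nu z 0 (hi j)) (ret y) 0 i ^+ 2 =
    (u (vpart y) / h (vpart y)) ^+ 2 * (1 - wdir j y ^+ 2) +
    (m%:R * u (vpart y) / h (vpart y)) ^+ 2 * (1 - u (vpart y) ^+ 2)
    * wdir j y ^+ 2.
  pose c k := (k == j)%:R : R.
  have cE z : cdir c z = wdir j z.
    rewrite /cdir (bigD1 j)//= /c eqxx mul1r big1 ?addr0// => k kj.
    by rewrite (negbTE kj) mul0r.
  rewrite (@sum_tgrad_comb_sqr c) => [|z /(catenoid_nbhd hn h0_gt0) Uz|//].
    rewrite cE (bigD1 j)//= /c eqxx expr1n big1 ?addr0// => k kj.
    by rewrite (negbTE kj) expr0n.
  by rewrite cE cat_nu_h.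
have ver : \sum_i tgrad h0 (fun z => nu z 0 vi) (ret y) 0 i ^+ 2 =
    (m%:R * u (vpart y) / h (vpart y)) ^+ 2 * u (vpart y) ^+ 2.
  have G z : U z -> has_grad ((fun z => nu z 0 vi : R^o) \o ret) z
      (grad_split (fun=> 0) (- m%:R * u (vpart z) / h (vpart z))).
    move=> Uz; have dz := nbhd_dom Uz.
    have hz : h (vpart z) != 0 by rewrite gt_eqF//; exact: nbhd_h Uz.
    apply: (has_grad_near (f := fun z => - h1 (vpart z) * u (vpart z))).
      by apply: filterS (near_nbhd Uz) => x Ux; rewrite /= cat_nu_ret// cat_nu_v.
    have H := has_grad_vpart (has_derM (has_derN (has_der_cat_h1 hn h0_gt0 dz))
      (has_der_cat_u hn h0_gt0 dz)).
    apply: has_grad_split H _ _ => [k|]; first by rewrite grad_splitl.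
    rewrite grad_splitr.
    have E1 := cat_h1_u hn h0_gt0 dz; have E2 := cat_h2_u hn h0_gt0 dz.
    have u0 : u (vpart z) != 0 by rewrite gt_eqF//; exact: cat_u_gt0 dz.
    transitivity ((m%:R * (h1 (vpart z) ^+ 2 * u (vpart z) ^+ 2) / h (vpart z)
      - h2 (vpart z) * u (vpart z) ^+ 2) / u (vpart z)); first by field; rewrite hz u0.
    by rewrite E1 E2; field; rewrite hz u0.
  have Ur := ret_nbhd hn h0_gt0 Uy; have [_ H] := G _ Ur.
  have D : \sum_k partial k ((fun z => nu z 0 vi : R^o) \o ret) (ret y) * nu (ret y) 0 k =
      m%:R * u (vpart y) / h (vpart y) * (h1 (vpart y) * u (vpart y)).
    rewrite sum_split big1 ?add0r => [|k _]; last by rewrite H grad_splitl mul0r.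
    by rewrite H grad_splitr cat_nu_v// vpart_ret; ring.
  rewrite sum_split; under eq_bigr do rewrite tgradE D H grad_splitl cat_nu_ret// cat_nu_h// -/(wdir _ _).
  rewrite tgradE D H grad_splitr cat_nu_v// vpart_ret.
  move: E ht; move: (h1 _) (h _) (u _) => a b d E b0.
  transitivity ((m%:R * d / b) ^+ 2 * (a ^+ 2 * d ^+ 2 * d ^+ 2 * (\sum_k wdir k y * wdir k y)
    + (1 - a ^+ 2 * d ^+ 2) ^+ 2)).
    rewrite mulrDr mulr_sumr mulr_sumr; congr (_ + _); last by field.
    by apply: eq_bigr => k _; field.
  by rewrite E sum_wdir2//; field.
transitivity (\sum_j ((u (vpart y) / h (vpart y)) ^+ 2 * (1 - wdir j y ^+ 2) +
    (m%:R * u (vpart y) / h (vpart y)) ^+ 2 * (1 - u (vpart y) ^+ 2) * wdir j y ^+ 2) +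
    (m%:R * u (vpart y) / h (vpart y)) ^+ 2 * u (vpart y) ^+ 2).
  by congr (_ + _); [apply: eq_bigr => j _; exact: hor|exact: ver].
transitivity ((u (vpart y) / h (vpart y)) ^+ 2 * (n%:R - \sum_k wdir k y * wdir k y) +
    (m%:R * u (vpart y) / h (vpart y)) ^+ 2 * (1 - u (vpart y) ^+ 2)
    * (\sum_k wdir k y * wdir k y) + (m%:R * u (vpart y) / h (vpart y)) ^+ 2 * u (vpart y) ^+ 2).
  rewrite (_ : n%:R = \sum_(k < n) 1); last by rewrite sumr_const card_ord.
  congr (_ + _); rewrite -sumrB !mulr_sumr -big_split/=.
  by apply: eq_bigr => k _; ring.
rewrite sum_wdir2// nE; move: (h _) (u _) ht => b d b0.
by field.
Qed.

Lemma A2_catenoid y : C y ->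
  A2 h0 y = n%:R * m%:R * u (vpart y) ^+ 2 / h (vpart y) ^+ 2.
Proof. by move=> /(catenoidP hn h0_gt0)[Uy ry]; rewrite -{1}ry A2_ret. Qed.

End Jacobi.

(** * Smoothness and independence of the horizontal translation fields *)

Section GeneratedAlgebra.
Context {R : realType} {N : nat}.
Implicit Types (S : set ('rV[R]_N -> R^o)) (g : 'rV[R]_N -> R^o).

Lemma alg_exp S g k : generated_alg S g -> generated_alg S (fun x => g x ^+ k).
Proof.
move=> Sg; elim: k => [|k IH].
  by under [fun x => _]funext do rewrite expr0; exact: alg_cst.
by under [fun x => _]funext do rewrite exprS; exact: alg_mul.
Qed.

Lemma alg_opp S g : generated_alg S g -> generated_alg S (fun x => - g x).
Proof.
move=> Sg; under [fun x => _]funext do rewrite -mulN1r.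
by apply: alg_mul => //; exact: alg_cst.
Qed.

Lemma alg_sum S (I : finType) (g : I -> 'rV[R]_N -> R^o) :
  (forall i, generated_alg S (g i)) -> generated_alg S (fun x => \sum_i g i x).
Proof.
move=> Sg; rewrite /index_enum; case: index_enum_key => /=.
elim: (Finite.enum I) => [|i s IH].
  by under [fun x => _]funext do rewrite big_nil; exact: alg_cst.
by under [fun x => _]funext do rewrite big_cons; exact: alg_add.
Qed.

End GeneratedAlgebra.

Section JacobiFields.
Context {R : realType}.
Variables (n : nat) (h0 : R).
Hypotheses (hn : (3 <= n)%N) (h0_gt0 : 0 < h0).
Local Notation N := (n + 1)%N.
Local Notation hi k := (lshift 1 k : 'I_N).
Local Notation h := (@cat_h R n h0).
Local Notation h1 := (cat_h1 n h0).
Local Notation u := (cat_u n h0).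
Local Notation C := (@catenoid R n h0).
Local Notation U := (@cat_nbhd R n h0).
Local Notation ret := (@cat_retr R n h0).
Local Notation rad y := (enorm (hpart y)).
Implicit Types (y z : 'rV[R]_N).

(** A finite family whose partial derivatives are polynomials in the family. Reciprocals are listed
    because the generated algebra has no division, and [h''] needs no place since it is a multiple
    of a power of [h]. *)
Definition cat_generators : set ('rV[R]_N -> R^o) :=
  [set g | [\/ exists k, g = wdir k, g = (fun y => (rad y)^-1),
     g = (fun y => h (vpart y)) | g = (fun y => (h (vpart y))^-1) \/
     g = (fun y => h1 (vpart y))]].
Local Notation alg := (generated_alg cat_generators).

Let alg_wdir k : alg (@wdir R n k).
Proof. by apply: alg_gen; constructor 1; exists k. Qed.

Let alg_radV : alg (fun y => (rad y)^-1).
Proof. by apply: alg_gen; constructor 2. Qed.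

Let alg_h : alg (fun y => h (vpart y)).
Proof. by apply: alg_gen; constructor 3. Qed.

Let alg_hV : alg (fun y => (h (vpart y))^-1).
Proof. by apply: alg_gen; constructor 4; left. Qed.

Let alg_h1 : alg (fun y => h1 (vpart y)).
Proof. by apply: alg_gen; constructor 4; right. Qed.

Let partial_alg s (a : 'I_n -> 'rV[R]_N -> R^o) (b : 'rV[R]_N -> R^o) :
  (forall y, U y -> has_grad s y (grad_split (fun j => a j y) (b y))) ->
  (forall j, alg (a j)) -> alg b ->
  (forall x, U x -> differentiable s x) /\
  (forall i, exists2 g, alg g & {in U, partial i s =1 g}).
Proof.
move=> sG aa ab; split=> [x /sG[]//|]; apply: split_ind => [j|].
  by exists (a j) => // y /set_mem /sG[_ ->]; rewrite grad_splitl.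
by exists b => // y /set_mem /sG[_ ->]; rewrite grad_splitr.
Qed.

Let gen_partial s : cat_generators s ->
  (forall x, U x -> differentiable s x) /\
  (forall i, exists2 g, alg g & {in U, partial i s =1 g}).
Proof.
have der g (dg : R -> R) : (forall y, U y -> has_der g (vpart y) (dg (vpart y))) ->
    alg (fun y => dg (vpart y)) ->
    (forall x : 'rV[R]_N, U x -> differentiable (fun y => g (vpart y) : R^o) x) /\
    (forall i, exists2 g', alg g' & {in U, partial i (fun y => g (vpart y) : R^o) =1 g'}).
  move=> gd ad; apply: (partial_alg (a := fun _ _ => 0) (b := fun y => dg (vpart y))) => //.
    by move=> y Uy; exact: has_grad_vpart (gd _ Uy).
  by move=> j; exact: alg_cst.
case=> [[k ->]|->|->|[->|->]].
- apply: (partial_alg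
    (a := fun j y => ((j == k)%:R + - (wdir k y * wdir j y)) * (rad y)^-1)
    (b := fun=> 0)) => [y Uy|j|]; last exact: alg_cst.
    exact: has_grad_wdir Uy.
  apply: alg_mul => //; apply: alg_add; first exact: alg_cst.
  by apply: alg_opp; exact: alg_mul.
- apply: (partial_alg
    (a := fun j y => - wdir j y * ((rad y)^-1 * (rad y)^-1)) (b := fun=> 0)) => [y Uy|j|];
    last exact: alg_cst.
    exact: has_grad_radV Uy.
  by apply: alg_mul; [exact: alg_opp|exact: alg_mul].
- by apply: (der h h1) => // y Uy; exact: has_der_cat_h (nbhd_dom Uy).
- apply: (der (fun t => (h t)^-1) (fun t => - h1 t * ((h t)^-1 * (h t)^-1))).
    move=> y Uy; have ht : h (vpart y) != 0 by rewrite gt_eqF//; exact: nbhd_h Uy.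
    apply: has_der_eq (has_derV ht (has_der_cat_h hn h0_gt0 (nbhd_dom Uy))) _.
    by rewrite expr2 invfM.
  by apply: alg_mul; [exact: alg_opp|exact: alg_mul].
- apply: (der h1 (cat_h2 n h0)); first by move=> y Uy; exact: has_der_cat_h1 (nbhd_dom Uy).
  rewrite /cat_h2; apply: alg_mul; first exact: alg_cst.
  exact: (alg_exp _ alg_h).
Qed.

Lemma smooth_cat_alg g : alg g -> smooth_on U g.
Proof.
apply: smooth_bootstrap; first exact: cat_nbhd_open.
  by move=> s x /gen_partial[H _]; exact: H.
by move=> s i /gen_partial[_ H]; exact: H.
Qed.

Section Combination.
Variables (c : 'I_n -> R) (f : 'rV[R]_N -> R^o).
Hypothesis fE : forall y, C y -> f y = u (vpart y) * cdir c y.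

Lemma smooth_comb : smooth_C h0 f.
Proof.
have sm : smooth_on U (fun y => u (vpart y) * cdir c y : R^o).
  apply: smooth_cat_alg; apply: alg_mul.
    apply: (@alg_exp _ _ _ (fun y => h0 / h (vpart y))).
    by apply: alg_mul => //; exact: alg_cst.
  apply: (@alg_sum _ _ _ _ (fun k y => c k * wdir k y)) => k.
  by apply: alg_mul => //; exact: alg_cst.
have E : {in U, (fun y => u (vpart y) * cdir c y : R^o) =1 f \o ret}.
  by move=> y /set_mem Uy; rewrite (comb_lift hn h0_gt0 fE).
exact: (eq_smooth_on (@cat_nbhd_open R n h0) E sm).
Qed.

Lemma jacobi_comb : (forall y, ~ C y -> f y = 0) -> jacobi_fields h0 f.
Proof.
move=> f0; split=> //; first exact: smooth_comb.
move=> y Cy; rewrite (laplace_comb hn h0_gt0 fE)// A2_catenoid//.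
by rewrite mulNr addNr.
Qed.

End Combination.

Lemma transl_field_out i y : ~ C y -> transl_field n h0 i y = 0.
Proof. by move=> Cy; rewrite /transl_field /normal_field memNset. Qed.

Lemma transl_fieldE k y : C y -> transl_field n h0 (hi k) y = u (vpart y) * wdir k y.
Proof.
move=> Cy; rewrite /transl_field /normal_field mem_set// dotpE.
have Uy := catenoid_nbhd hn h0_gt0 Cy.
rewrite (bigD1 (hi k))//= big1 => [|i ik].
  by rewrite addr0 [X in _ * X]mxE !eqxx mulr1 cat_nu_h.
by rewrite [X in _ * X]mxE eqxx (negbTE ik) mulr0.
Qed.

Lemma sum_transl_fieldE (c : 'I_n -> R) y :
  (\sum_k c k *: transl_field n h0 (hi k)) y =
  \sum_k c k * transl_field n h0 (hi k) y.
Proof. by rewrite fct_sumE. Qed.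

Lemma sum_transl_field_in (c : 'I_n -> R) y : C y ->
  (\sum_k c k *: transl_field n h0 (hi k)) y = u (vpart y) * cdir c y.
Proof.
move=> Cy; rewrite sum_transl_fieldE mulr_sumr; apply: eq_bigr => k _.
by rewrite transl_fieldE// mulrCA.
Qed.

Lemma transl_field_cdir k y : C y ->
  transl_field n h0 (hi k) y = u (vpart y) * cdir (fun j => (j == k)%:R) y.
Proof.
move=> Cy; rewrite transl_fieldE// /cdir (bigD1 k)//= eqxx mul1r big1 ?addr0// => j jk.
by rewrite (negbTE jk) mul0r.
Qed.

Lemma jacobi_transl k : jacobi_fields h0 (transl_field n h0 (hi k)).
Proof.
apply: (jacobi_comb (c := fun j => (j == k)%:R)) => y.
  exact: transl_field_cdir.
exact: transl_field_out.
Qed.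

Lemma unit_nbhd (x : 'rV[R]_n) t : x != 0 -> cat_dom n h0 t -> U (row_mx x t%:M).
Proof. by move=> x0 dt; split; rewrite /= ?vpart_row ?hpart_row. Qed.

(** At the neck, in the direction of the basis vector [e_i], a combination of the fields reduces to
    its [i]-th coefficient times a positive factor. *)
Lemma independent_transl : independent (fun k => transl_field n h0 (hi k)).
Proof.
move=> c c0 i.
have Ui : U (row_mx (evec i) 0%:M).
  apply: unit_nbhd; last exact: cat_dom0.
  apply/eqP => /(congr1 (fun v : 'rV_n => v 0 i)); rewrite !mxE !eqxx => /eqP.
  by rewrite oner_eq0.
have := sum_transl_field_in c (ret_catenoid Ui).
rewrite c0 cdir_ret// => /esym/eqP; rewrite mulf_eq0 gt_eqF/=; last first.
  exact: cat_u_gt0 (nbhd_dom (ret_nbhd hn h0_gt0 Ui)).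
have wE k : wdir k (row_mx (evec i) 0%:M) = (k == i)%:R / enorm (evec i).
  by rewrite /wdir row_mxEl hpart_row /evec mxE eqxx.
have e0 : 0 < enorm (evec i : 'rV[R]_n).
  by have := nbhd_rad Ui; rewrite hpart_row.
rewrite /cdir (bigD1 i)//= wE eqxx div1r big1 ?addr0; last first.
  by move=> k ki; rewrite wE (negbTE ki) mul0r mulr0.
by rewrite mulf_eq0 invr_eq0 (gt_eqF e0) orbF => /eqP.
Qed.

End JacobiFields.

(** * Integration on the catenoid *)

Section Cutoff.
Context {R : realType}.
Implicit Types (w : R).

Definition pospart w : R := (w + `|w|) / 2.

Lemma pospart_ge w : 0 <= w -> pospart w = w.
Proof. by move=> w0; rewrite /pospart ger0_norm//; lra. Qed.

Lemma pospart_le w : w <= 0 -> pospart w = 0.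
Proof. by move=> w0; rewrite /pospart ler0_norm// subrr mul0r. Qed.

Lemma pospart_ge0 w : 0 <= pospart w.
Proof. by case: (leP 0 w) => [w0|/ltW w0]; [rewrite pospart_ge|rewrite pospart_le]. Qed.

Lemma pospart_continuous : continuous pospart.
Proof.
move=> w; apply: cvgMr_tmp; apply: cvgD; [exact: cvg_id|exact: norm_continuous].
Qed.

Lemma has_der_pospart2 w : has_der (fun t => pospart t ^+ 2) w (2 * pospart w).
Proof.
have neq0 t : t != 0 -> has_der (fun t => pospart t ^+ 2) t (2 * pospart t).
  rewrite neq_lt => /orP[t0|t0].
    rewrite pospart_le ?ltW// mulr0; apply: (has_der_near (f := fun=> 0)); last exact: has_der_cst.
    near=> s; rewrite pospart_le ?expr0n//; apply: ltW; near: s; exact: lt_nbhsl.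
  rewrite pospart_ge ?ltW//; apply: (has_der_near (f := fun s => s ^+ 2)).
    near=> s; rewrite pospart_ge//; apply: ltW; near: s; exact: lt_nbhsr.
  by apply: has_der_eq (has_derX 2 (has_der_id t)) _; rewrite mulr1.
have [->|] := eqVneq w 0; last exact: neq0.
have c2 : continuous (fun t => 2 * pospart t).
  by move=> t; apply: cvgM; [exact: cvg_cst|exact: pospart_continuous].
apply: (is_derive_continuous_ext ltr01 _ _ (c2 0)) => [t _|t _]; last exact: neq0.
by apply: cvgM; exact: pospart_continuous.
Unshelve. all: by end_near. Qed.

(** A transition from 0 to 1, equal to [1 - (1 - w^2)^2] on [[0, 1]]. The derivative [4 (1 - w^2) w]
    vanishes at both ends, so the function is continuously differentiable, which suffices for
    integrating a divergence. *)
Definition step w : R := 1 - pospart (1 - pospart w ^+ 2) ^+ 2.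
Definition step' w : R := 4 * pospart (1 - pospart w ^+ 2) * pospart w.

Lemma has_der_step w : has_der step w (step' w).
Proof.
have H := has_der_comp (has_derB (has_der_cst 1 w) (has_der_pospart2 w))
  (has_der_pospart2 _).
by apply: has_der_eq (has_derB (has_der_cst 1 w) H) _; rewrite /step'; ring.
Qed.

Lemma step'_continuous : continuous step'.
Proof.
move=> w; apply: cvgM; last exact: pospart_continuous.
apply: cvgM; first exact: cvg_cst.
apply: (@continuous_comp _ _ _ (fun w => 1 - pospart w ^+ 2) pospart).
  apply: cvgB; first exact: cvg_cst.
  by apply: cvgM; exact: pospart_continuous.
exact: pospart_continuous.
Qed.

Lemma step_le0 w : w <= 0 -> step w = 0.
Proof. by move=> w0; rewrite /step (pospart_le w0) expr0n subr0 pospart_ge// expr1n subrr. Qed.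

Lemma step_ge1 w : 1 <= w -> step w = 1.
Proof.
move=> w1; have w0 : 0 <= w by exact: le_trans w1.
rewrite /step (pospart_ge w0) pospart_le ?expr0n ?subr0//.
by rewrite subr_le0 exprn_ege1.
Qed.

Lemma step_bounds w : 0 <= step w <= 1.
Proof.
have p0 : 0 <= 1 - pospart (1 - pospart w ^+ 2) ^+ 2.
  rewrite subr_ge0 expr_le1// ?pospart_ge0//.
  have [a0|a0] := leP 0 (1 - pospart w ^+ 2); last by rewrite pospart_le ?ltW.
  by rewrite pospart_ge// gerBl sqr_ge0.
by rewrite /step p0 gerBl sqr_ge0.
Qed.

End Cutoff.

Section CatenoidIntegrals.
Context {R : realType}.
Variables (n : nat) (h0 : R).
Hypotheses (hn : (3 <= n)%N) (h0_gt0 : 0 < h0).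
Local Notation N := (n + 1)%N.
Local Notation m := n.-1.
Local Notation hi k := (lshift 1 k : 'I_N).
Local Notation vi := (rshift n (@ord0 0) : 'I_N).
Local Notation dom := (@cat_dom R n h0).
Local Notation h := (@cat_h R n h0).
Local Notation h1 := (cat_h1 n h0).
Local Notation u := (cat_u n h0).
Local Notation C := (@catenoid R n h0).
Local Notation U := (@cat_nbhd R n h0).
Local Notation ret := (@cat_retr R n h0).
Local Notation rad y := (enorm (hpart y)).
Local Notation rho := (par_density n h0).
Local Notation lam := (ms_meas (leb R n)).
Local Notation mu := (prod_meas (@lebesgue_measure R) lam).
Local Notation pdom := (@par_dom R n h0).
Local Notation prow := (@par_row R n).
Implicit Types (y z : 'rV[R]_N) (g : 'rV[R]_N -> R).

Definition cat_ball : set 'rV[R]_N := [set y | U y /\ rad y < 1].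

Lemma par_domE : pdom = prow @^-1` cat_ball.
Proof.
apply/seteqP; split=> p /=; rewrite /par_row.
  move=> [dp /andP[p0 p1]]; split; last by rewrite hpart_row.
  by split; rewrite ?vpart_row// hpart_row -enorm_gt0.
by move=> [[/=]]; rewrite vpart_row hpart_row => dp p0 p1; split=> //=; rewrite enorm_gt0 p0.
Qed.

Lemma par_pullE g p : par_pull h0 g p = (g \o ret) (prow p) * rho (vpart (prow p)).
Proof. by rewrite /par_pull /par_row /= /cat_retr hpart_row vpart_row. Qed.

Lemma continuous_rad y : hpart y != 0 -> {for y, continuous (fun z : 'rV[R]_N => rad z)}.
Proof.
move=> y0; apply: (@differentiable_continuous _ _ R^o).
by have [] := has_grad_enorm y0.
Qed.

Lemma cat_ball_open : open cat_ball.
Proof.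
rewrite openE => y [Uy y1]; apply: filterI; first exact: near_nbhd.
have r1 : `|rad y| < 1 by rewrite ger0_norm ?enorm_ge0.
near=> z; rewrite /= -[rad z]ger0_norm ?enorm_ge0//; near: z.
exact: (continuous_rad Uy.2 (near_normr_lt r1)).
Unshelve. all: by end_near. Qed.

Lemma measurable_par_dom : measurable pdom.
Proof.
rewrite par_domE; apply: measurable_row_open; last exact: cat_ball_open.
exact: measurable_par_row.
Qed.

Lemma coord_le_enorm k (x : 'rV[R]_n) : `|x 0 k| <= enorm x.
Proof.
rewrite -sqrtr_sqr; apply: ler_wsqrtr; rewrite dotpE (bigD1 k)//= expr2 lerDl.
by apply: sumr_ge0 => i _; rewrite -expr2 sqr_ge0.
Qed.

(** Heights are below [h0 * pi] and horizontal parameters lie in the unit ball, so the domain fits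
    in a cube. Integrability on the catenoid can then be checked by bounding a function times the
    density. *)
Lemma measure_par_dom : (mu pdom < +oo)%E.
Proof.
pose e := 1 + h0 * pi.
have hp : 0 < h0 * pi by rewrite mulr_gt0// pi_gt0.
have e0 : 0 <= e by rewrite addr_ge0// ltW.
have [mB BE] := @leb_box R n.+1 (fun=> 0) e e0.
apply: le_lt_trans (ltry ((2 * e) ^+ n.+1)); rewrite -BE.
apply: (le_measure mu); rewrite ?inE//; first exact: measurable_par_dom.
move=> p [dp /andP[_ p1]] [_|i ni] /=; rewrite subr0.
  by apply: (lt_le_trans (cat_dom_lt hn h0_gt0 dp)); rewrite /e lerDr.
have := coord_le_enorm (Ordinal (ni : (i < n)%N)) (leb_row p.2); rewrite mxE /= => H.
by apply: (le_lt_trans H); apply: (lt_trans p1); rewrite /e ltrDl.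
Qed.

Lemma densityE t : dom t -> rho t = n%:R * h t ^+ m / u t.
Proof. by move=> dt; rewrite /par_density sqrt_1h1. Qed.

Lemma density_u t : dom t -> rho t * u t ^+ 2 = n%:R * h0 ^+ m.
Proof.
move=> dt; rewrite densityE//; have u0 : u t != 0 by rewrite gt_eqF//; exact: cat_u_gt0 dt.
have ht : h t != 0 by rewrite gt_eqF//; exact: cat_h_gt0 dt.
rewrite expr2 mulrA mulfVK// -mulrA; congr (_ * _).
by rewrite /cat_u -exprMn; congr (_ ^+ _); rewrite mulrC mulfVK.
Qed.

Lemma density_gt0 t : dom t -> 0 < rho t.
Proof.
move=> dt; rewrite densityE//; rewrite divr_gt0//; last exact: cat_u_gt0 dt.
rewrite mulr_gt0 ?exprn_gt0//; last exact: cat_h_gt0 dt.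
by rewrite ltr0n; exact: leq_trans hn.
Qed.

Lemma has_der_density t : dom t -> has_der rho t (2 * m%:R * h1 t / h t * rho t).
Proof.
move=> dt; have u0 : u t != 0 by rewrite gt_eqF//; exact: cat_u_gt0 dt.
have ht : h t != 0 by rewrite gt_eqF//; exact: cat_h_gt0 dt.
apply: (has_der_near (f := fun t => n%:R * h t ^+ m / u t)).
  near=> s; rewrite densityE//; near: s.
  by apply: open_nbhs_nbhs; split=> //; exact: cat_dom_open.
have H := has_derM (has_derZ n%:R (has_derX m (has_der_cat_h hn h0_gt0 dt)))
  (has_derV u0 (has_der_cat_u hn h0_gt0 dt)).
apply: has_der_eq H _; rewrite densityE//.
have -> : h t ^+ m = h t ^+ m.-1 * h t.
  by rewrite -exprSr prednK//; case: n hn => [|[]].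
by move: (h t ^+ m.-1) => P; field; rewrite u0 ht.
Unshelve. all: by end_near. Qed.

Lemma has_grad_continuous (f : 'rV[R]_N -> R^o) y G : has_grad f y G ->
  {for y, continuous f}.
Proof. by move=> [df _]; exact: differentiable_continuous. Qed.

Lemma continuous_density y : U y -> {for y, continuous (fun z : 'rV[R]_N => rho (vpart z))}.
Proof.
move=> Uy; exact: has_grad_continuous (has_grad_vpart (has_der_density (nbhd_dom Uy))).
Qed.

Lemma continuous_ret y : U y -> {for y, continuous ret}.
Proof.
move=> Uy; apply: continuous_row; apply: split_ind => [k|].
  have H := has_gradM (has_grad_vpart (has_der_cat_h hn h0_gt0 (nbhd_dom Uy)))
    (has_grad_wdir k Uy).
  apply: has_grad_continuous (has_grad_near _ H).
  by apply: filterS (near_nbhd Uy) => z Uz; rewrite ret_coord.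
apply: (eq_continuous_for (g := fun z : 'rV[R]_N => z 0 vi)); last exact: coord_continuous.
by move=> z; rewrite -vpartE vpart_ret vpartE.
Qed.

Definition lift_continuous g := forall y, U y -> {for y, continuous (g \o ret)}.

Lemma measurable_par_pull g : lift_continuous g -> measurable_fun pdom (par_pull h0 g).
Proof.
move=> cg; rewrite (_ : par_pull h0 g =
    (fun y => (g \o ret) y * rho (vpart y)) \o prow); last first.
  by apply/funext => p; rewrite par_pullE.
rewrite par_domE; apply: measurable_fun_row; first exact: measurable_par_row.
  exact: cat_ball_open.
by move=> y [Uy _]; exact: (cvgM (cg y Uy) (continuous_density Uy)).
Qed.

Lemma par_domP p : pdom p -> U (prow p).
Proof. by rewrite par_domE => -[]. Qed.

Lemma integrable_C_bounded g B : lift_continuous g ->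
  (forall y, U y -> `|g (ret y) * rho (vpart y)| <= B) -> integrable_C h0 g.
Proof.
move=> cg gB; apply: measurable_bounded_integrable.
- exact: measurable_par_dom.
- exact: measure_par_dom.
- exact: measurable_par_pull.
exists B; split; first exact: num_real.
move=> M BM p /par_domP Up /=; rewrite par_pullE; apply: le_trans (ltW BM).
exact: gB.
Qed.

Lemma L1loc_continuous g : lift_continuous g -> L1loc_C h0 g.
Proof.
move=> cg K cK KC.
pose G y := (g \o ret) y * rho (vpart y).
have cG y : U y -> {for y, continuous G}.
  by move=> Uy; exact: (cvgM (cg y Uy) (continuous_density Uy)).
have [B GB] : exists B, forall y, K y -> `|G y| <= B.
  have : compact (G @` K).
    apply: continuous_compact => //; apply: continuous_in_subspaceT => y /set_mem Ky.
    exact/cG/(catenoid_nbhd hn h0_gt0)/KC.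
  move=> /compact_bounded[B [_ BP]]; exists (B + 1) => y Ky.
  by apply: (BP (B + 1)); rewrite ?ltrDl//; exists y.
have clK : closed K.
  by apply: compact_closed => //; exact: norm_hausdorff.
(* Parameters whose point on the catenoid is outside [K]. This set is open, and on the parameter
   domain its indicator is one minus that of [K], which makes the latter measurable. *)
pose O := [set y | cat_ball y /\ ~ K (ret y)].
have oO : open O.
  rewrite openE => y [By nK]; apply: filterI.
    by apply: open_nbhs_nbhs; split=> //; exact: cat_ball_open.
  apply: (continuous_ret By.1 (open_nbhs_nbhs (A := ~` K) _)); split=> //.
  by rewrite openC.
have mO : measurable (prow @^-1` O).
  by apply: measurable_row_open => //; exact: measurable_par_row.
apply: measurable_bounded_integrable.
- exact: measurable_par_dom.
- exact: measure_par_dom.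
- rewrite (_ : par_pull h0 _ = (fun p => par_pull h0 g p * \1_K (ret (prow p)))); last first.
    by apply/funext => p; rewrite !par_pullE/= mulrAC.
  apply: measurable_funM; first exact: measurable_par_pull.
  have mI : measurable_fun pdom (fun p => 1 - \1_(prow @^-1` O) p : R).
    by apply: measurable_funB; [exact: measurable_cst|exact: measurable_indic].
  apply: eq_measurable_fun mI => p /set_mem; rewrite par_domE => Bp; rewrite !indicE.
  have [Kp|nKp] := pselect (K (ret (prow p))).
    by rewrite (mem_set Kp) memNset ?subr0// => -[].
  by rewrite (memNset nKp) mem_set ?subrr.
exists `|B|; split; first exact: num_real.
move=> M BM p /par_domP Up /=; rewrite par_pullE/= indicE.
have [Kp|nKp] := pselect (K (ret (prow p))).
  rewrite (mem_set Kp) mulr1; apply: le_trans (ltW BM).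
  apply: le_trans (ler_norm B); have := GB _ Kp.
  by rewrite /G/= vpart_ret ret_ret.
rewrite (memNset nKp) mulr0 mul0r normr0; apply: le_trans (ltW BM).
exact: normr_ge0.
Qed.

Lemma integrable_C_compact g K : lift_continuous g -> compact K -> K `<=` C ->
  (forall y, C y -> ~ K y -> g y = 0) -> integrable_C h0 g.
Proof.
move=> cg cK KC g0; apply: eq_integrable (L1loc_continuous cg cK KC).
  exact: measurable_par_dom.
move=> p /set_mem/par_domP Up; rewrite /= !par_pullE/= indicE; congr (_ * _)%:E.
have [Kp|nKp] := pselect (K (ret (prow p))); first by rewrite (mem_set Kp) mulr1.
by rewrite (memNset nKp) mulr0 g0//; exact: ret_catenoid.
Qed.

Section DivergenceTheorem.
Variables (X : 'rV[R]_N -> 'rV[R]_N).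
Hypothesis tX : test_field h0 X.
Local Notation Z i := ((fun z => X z 0 i : R^o) \o ret).

Let tanX : tangential h0 X. Proof. by case: tX. Qed.
Let smX i : smooth_on U (Z i). Proof. by case: tX => _ + _; exact. Qed.

Let dX i y : U y -> differentiable (Z i) y.
Proof. by move=> Uy; exact: smooth_on_differentiable (smX i) Uy. Qed.

Let dpX i j y : U y -> differentiable (partial j (Z i)) y.
Proof. by move=> Uy; exact: smooth_on_differentiable (smooth_on_partial j (smX i)) Uy. Qed.

Lemma lift_continuous_div : lift_continuous (div_C h0 X).
Proof.
move=> y Uy.
apply: has_grad_continuous; apply: (has_grad_near (f := fun z =>
  rad z * (h (vpart z))^-1 * (\sum_k partial (hi k) (Z (hi k)) z) +
  partial vi (Z vi) z + m%:R * h1 (vpart z) * (h (vpart z))^-1 * Z vi z)).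
  by apply: filterS (near_nbhd Uy) => z Uz /=; rewrite div_CE.
have ht : h (vpart y) != 0 by rewrite gt_eqF//; exact: nbhd_h Uy.
have HV := has_grad_vpart (has_derV ht (has_der_cat_h hn h0_gt0 (nbhd_dom Uy))).
have H1 := has_grad_vpart (has_der_cat_h1 hn h0_gt0 (nbhd_dom Uy)).
exact: has_gradD (has_gradD (has_gradM (has_gradM (has_grad_enorm Uy.2) HV)
  (has_grad_sum (fun k => has_gradP (dpX (hi k) (hi k) Uy)))) (has_gradP (dpX vi vi Uy)))
  (has_gradM (has_gradM (has_gradM (has_grad_cst _ y) H1) HV) (has_gradP (dX vi Uy))).
Qed.

(** [T0] is the height of a point of [K] where the absolute height is maximal. The field thus
    vanishes in a whole neighbourhood of both ends of the parameter interval. *)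
Lemma test_field_support : exists K T0, [/\ compact K, K `<=` C, dom T0,
  (forall y, C y -> ~ K y -> X y = 0) &
  (forall y, U y -> `|T0| < `|vpart y| -> X (ret y) = 0)].
Proof.
have [_ _ [K [cK KC X0]]] := tX.
have [K0|/set0P[y0 Ky0]] := eqVneq K set0.
  exists K, 0; split=> //; first exact: cat_dom0.
  by move=> y Uy _; apply: X0; [exact: ret_catenoid|rewrite K0].
have cv : {within K, continuous (fun y : 'rV[R]_N => `|vpart y|)}.
  apply: continuous_subspaceT => y.
  apply: (@continuous_comp _ _ _ (fun y : 'rV[R]_N => vpart y) (fun x : R => `|x|)).
    apply: (eq_continuous_for (g := fun z : 'rV[R]_N => z 0 vi)).
      by move=> z; rewrite vpartE.
    exact: coord_continuous.
  exact: norm_continuous.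
have [c Kc cmax] := EVT_max_rV (ex_intro _ _ Ky0) cK cv.
exists K, (vpart c); split=> //.
  exact/nbhd_dom/(catenoid_nbhd hn h0_gt0)/KC/set_mem.
move=> y Uy Ty; apply: X0; first exact: ret_catenoid.
by move=> /mem_set/cmax; rewrite vpart_ret leNgt Ty.
Qed.

Lemma div_C_out K : compact K -> K `<=` C -> (forall y, C y -> ~ K y -> X y = 0) ->
  forall y, C y -> ~ K y -> div_C h0 X y = 0.
Proof.
move=> cK KC X0 y Cy nKy; have [Uy ry] := catenoidP hn h0_gt0 Cy.
have clK : closed K by apply: compact_closed => //; exact: norm_hausdorff.
have Z0 i : \near y, Z i y = (fun=> 0 : R^o) y.
  have : \forall z \near y, ~ K (ret z).
    apply: (continuous_ret Uy (open_nbhs_nbhs (A := ~` K) _)); split.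
      by rewrite openC.
    by rewrite ry.
  move=> H; apply: filterS2 H (near_nbhd Uy) => z nKz Uz /=.
  by rewrite X0 ?mxE//; exact: ret_catenoid.
have P i j : partial j (Z i) y = 0.
  by rewrite /partial (near_eq_derive _ (Z0 i)) derive_cst.
rewrite /div_C big1// => i _; rewrite /tpartial tgradE P big1 ?mul0r ?subr0// => k _.
by rewrite P mul0r.
Qed.

Lemma integrable_C_div : integrable_C h0 (div_C h0 X).
Proof.
have [K [_ [cK KC _ X0 _]]] := test_field_support.
by apply: (integrable_C_compact lift_continuous_div cK KC); exact: div_C_out.
Qed.

End DivergenceTheorem.

End CatenoidIntegrals.

(** * The divergence theorem for compactly supported tangential fields *)

Section DivergenceTheorem.
Context {R : realType}.
Variables (n : nat) (h0 : R).
Hypotheses (hn : (3 <= n)%N) (h0_gt0 : 0 < h0).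
Local Notation N := (n + 1)%N.
Local Notation m := n.-1.
Local Notation hi k := (lshift 1 k : 'I_N).
Local Notation vi := (rshift n (@ord0 0) : 'I_N).
Local Notation dom := (@cat_dom R n h0).
Local Notation h := (@cat_h R n h0).
Local Notation h1 := (cat_h1 n h0).
Local Notation U := (@cat_nbhd R n h0).
Local Notation ret := (@cat_retr R n h0).
Local Notation rad y := (enorm (hpart y)).
Local Notation rho := (par_density n h0).
Local Notation lam := (ms_meas (leb R n)).
Local Notation mu := (prod_meas (@lebesgue_measure R) lam).
Local Notation pdom := (@par_dom R n h0).
Local Notation prow := (@par_row R n).
Implicit Types (y z : 'rV[R]_N).

Lemma smooth_on_coord i : smooth_on U (fun y => y 0 i : R^o).
Proof.
pose S : set ('rV[R]_N -> R^o) := [set s | exists i, s = (fun y => y 0 i)].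
apply: (smooth_bootstrap (@cat_nbhd_open R n h0) (S := S)).
- by move=> s x [j ->] _; exact: differentiable_coord.
- move=> s j [k ->]; exists (fun=> (j == k)%:R); first exact: alg_cst.
  by move=> y _; have [_ ->] := has_grad_coord k y.
- by apply: alg_gen; exists i.
Qed.

Lemma coord_wdir k y : U y -> y 0 (hi k) = rad y * wdir k y.
Proof.
by move=> Uy; rewrite /wdir mulrC mulfVK// gt_eqF//; exact: nbhd_rad Uy.
Qed.

(** Writing [|x|] as [<w,x>] makes it a polynomial in functions already known to be smooth. *)
Lemma smooth_on_rad : smooth_on U (fun y => rad y : R^o).
Proof.
have sm : smooth_on U (fun y => \sum_k wdir k y * y 0 (hi k) : R^o).
  apply: (smooth_on_alg (@cat_nbhd_open R n h0)).
  apply: (@alg_sum _ _ _ _ (fun k y => wdir k y * y 0 (hi k))) => k.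
  apply: alg_mul; apply: alg_gen; last exact: smooth_on_coord.
  by apply: (smooth_cat_alg hn h0_gt0); apply: alg_gen; constructor 1; exists k.
apply: (eq_smooth_on (@cat_nbhd_open R n h0) _ sm) => y /set_mem Uy.
under eq_bigr do rewrite coord_wdir// mulrCA.
by rewrite -mulr_sumr (sum_wdir2 Uy) mulr1.
Qed.

Lemma smooth_on_vgen (g : R -> R) :
  @cat_generators R n h0 (fun y => g (vpart y) : R^o) ->
  smooth_on U (fun y => g (vpart y) : R^o).
Proof. by move=> gg; apply: (smooth_cat_alg hn h0_gt0); exact: alg_gen. Qed.

Lemma smooth_on_density : smooth_on U (fun y => rho (vpart y) : R^o).
Proof.
have sm : smooth_on U (fun y => n%:R * h (vpart y) ^+ m * (h0^-1 * h (vpart y)) ^+ m : R^o).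
  have ah : generated_alg (@cat_generators R n h0) (fun y => h (vpart y)).
    by apply: alg_gen; constructor 3.
  apply: (smooth_cat_alg hn h0_gt0); apply: alg_mul.
    by apply: alg_mul; [exact: alg_cst|exact: (alg_exp _ ah)].
  by apply: (alg_exp _ (alg_mul (alg_cst _ _) ah)).
apply: (eq_smooth_on (@cat_nbhd_open R n h0) _ sm) => y /set_mem Uy.
rewrite (densityE hn h0_gt0 (nbhd_dom Uy)); congr (_ * _).
by rewrite /cat_u -exprVn invf_div mulrC.
Qed.

Variables (X : 'rV[R]_N -> 'rV[R]_N).
Hypothesis tX : test_field h0 X.
Local Notation Z i := ((fun z => X z 0 i : R^o) \o ret).

Let tanX : tangential h0 X. Proof. by case: tX. Qed.

Let smX i : smooth_on U (Z i). Proof. by case: tX => _ + _; exact. Qed.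

Let dX i y : U y -> differentiable (Z i) y.
Proof. by move=> Uy; exact: smooth_on_differentiable (smX i) Uy. Qed.

(* The area density times X, transported to the parameters (x, t) by
   y = F(t, x/|x|), with the radial component of the horizontal part removed:
   it has no radial component, so radial cutoffs do not affect its divergence. *)
Definition flux (j : 'I_N) (y : 'rV[R]_N) : R := grad_split
  (fun k => rho (vpart y) * (h (vpart y))^-1 *
     (rad y * Z (hi k) y + - 1 * (y 0 (hi k) * h1 (vpart y) * Z vi y)))
  (rho (vpart y) * Z vi y) j.

Lemma smooth_on_flux j : smooth_on U (flux j : 'rV[R]_N -> R^o).
Proof.
have oU := @cat_nbhd_open R n h0.
move: j; apply: split_ind => [k|].
  rewrite (_ : flux _ = fun y => rho (vpart y) * (h (vpart y))^-1 *
     (rad y * Z (hi k) y + - 1 * (y 0 (hi k) * h1 (vpart y) * Z vi y))); last first.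
    by apply/funext => y; rewrite /flux grad_splitl.
  apply: (smooth_on_alg oU); apply: alg_mul.
    apply: alg_mul; first by apply: alg_gen; exact: smooth_on_density.
    by apply: alg_gen; apply: (smooth_on_vgen (g := fun t => (h t)^-1)); constructor 4; left.
  apply: alg_add.
    by apply: alg_mul; apply: alg_gen; [exact: smooth_on_rad|exact: smX].
  apply: alg_mul; first exact: alg_cst.
  apply: alg_mul; last by apply: alg_gen; exact: smX.
  apply: alg_mul; apply: alg_gen; first exact: smooth_on_coord.
  by apply: (smooth_on_vgen (g := h1)); constructor 4; right.
rewrite (_ : flux _ = fun y => rho (vpart y) * Z vi y); last first.
  by apply/funext => y; rewrite /flux grad_splitr.
by apply: (smooth_on_alg oU); apply: alg_mul; apply: alg_gen;
  [exact: smooth_on_density|exact: smX].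
Qed.

Lemma sum_coord2 y : \sum_k y 0 (hi k) * y 0 (hi k) = rad y ^+ 2.
Proof. by rewrite sqr_enorm dotpE; apply: eq_bigr => k _; rewrite !hpartE. Qed.

(** Tangency gives [<x,Z> = |x| h' Z_v] for the horizontal part [Z], which is exactly the radial
    contribution subtracted in [flux]. *)
Lemma flux_radial y : U y -> \sum_k flux (hi k) y * y 0 (hi k) = 0.
Proof.
move=> Uy; under eq_bigr do rewrite /flux grad_splitl.
transitivity (rho (vpart y) * (h (vpart y))^-1 *
  (rad y * (\sum_k y 0 (hi k) * Z (hi k) y) - h1 (vpart y) * Z vi y *
    (\sum_k y 0 (hi k) * y 0 (hi k)))).
  rewrite mulrBr !mulr_sumr -sumrB; apply: eq_bigr => k _; ring.
rewrite (tangential_lift hn h0_gt0 tanX Uy) sum_coord2; ring.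
Qed.

Lemma flux_out y j : X (ret y) = 0 -> flux j y = 0.
Proof.
move=> X0; move: j; apply: split_ind => [k|]; rewrite /flux ?grad_splitl ?grad_splitr /= X0 !mxE.
  by rewrite !mulr0 addr0 mulr0.
by rewrite mulr0.
Qed.

Lemma partial_flux_h k y : U y -> partial (hi k) (flux (hi k) : _ -> R^o) y =
  rho (vpart y) / h (vpart y) * (rad y * partial (hi k) (Z (hi k)) y +
    wdir k y * Z (hi k) y - h1 (vpart y) * (y 0 (hi k) * partial (hi k) (Z vi) y + Z vi y)).
Proof.
move=> Uy; have dy := nbhd_dom Uy.
have ht : h (vpart y) != 0 by rewrite gt_eqF//; exact: nbhd_h Uy.
have H1 := has_gradM (has_grad_vpart (has_der_density hn h0_gt0 dy))
  (has_grad_vpart (has_derV ht (has_der_cat_h hn h0_gt0 dy))).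
have H2 := has_gradM (has_grad_enorm Uy.2) (has_gradP (dX (hi k) Uy)).
have H3 := has_gradZ (- 1) (has_gradM (has_gradM (has_grad_hcoord k y)
  (has_grad_vpart (has_der_cat_h1 hn h0_gt0 dy))) (has_gradP (dX vi Uy))).
have [_ H] := has_gradM H1 (has_gradD H2 H3).
rewrite (_ : (flux _ : _ -> R^o) = fun y => rho (vpart y) * (h (vpart y))^-1 *
     (rad y * Z (hi k) y + - 1 * (y 0 (hi k) * h1 (vpart y) * Z vi y))); last first.
  by apply/funext => z; rewrite /flux grad_splitl.
by rewrite H !grad_splitl [(k == k)%:R](_ : _ = 1) ?eqxx// /wdir; ring.
Qed.

Lemma partial_flux_v y : U y -> partial vi (flux vi : _ -> R^o) y =
  rho (vpart y) * (partial vi (Z vi) y + 2 * m%:R * h1 (vpart y) / h (vpart y) * Z vi y).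
Proof.
move=> Uy; have [_ H] := has_gradM (has_grad_vpart
  (has_der_density hn h0_gt0 (nbhd_dom Uy))) (has_gradP (dX vi Uy)).
rewrite (_ : (flux _ : _ -> R^o) = fun y => rho (vpart y) * Z vi y); last first.
  by apply/funext => z; rewrite /flux grad_splitr.
by rewrite H !grad_splitr; ring.
Qed.

(** Count the terms in [h' / h] times the vertical component: the vertical derivative of the density
    gives [2 (n-1)], the factor [|x|] gives 1 by tangency, and removing the radial part gives [- n].
    What remains is the [n - 1] of [div_CE]; the horizontal derivatives of the vertical component
    disappear by Euler's identity. *)
Lemma div_flux y : U y -> \sum_j partial j (flux j : _ -> R^o) y =
  rho (vpart y) * div_C h0 X (ret y).
Proof.
move=> Uy; have ht : h (vpart y) != 0 by rewrite gt_eqF//; exact: nbhd_h Uy.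
have r0 : rad y != 0 by rewrite gt_eqF//; exact: nbhd_rad Uy.
rewrite sum_split (div_CE hn h0_gt0 tanX dX Uy) partial_flux_v//.
under eq_bigr do rewrite partial_flux_h//.
transitivity (rho (vpart y) / h (vpart y) * (rad y * (\sum_k partial (hi k) (Z (hi k)) y) +
  (\sum_k y 0 (hi k) * Z (hi k) y) / rad y - h1 (vpart y) *
   ((\sum_k y 0 (hi k) * partial (hi k) (Z vi) y) + n%:R * Z vi y)) +
  rho (vpart y) * (partial vi (Z vi) y + 2 * m%:R * h1 (vpart y) / h (vpart y) * Z vi y)).
  congr (_ + _); rewrite -mulr_sumr; congr (_ * _).
  rewrite sumrB big_split/= -!mulr_sumr big_split/= sumr_const card_ord -[in LHS]mulr_natl.
  congr (_ + _ - _); rewrite mulr_suml; apply: eq_bigr => k _.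
  by rewrite /wdir; ring.
rewrite (tangential_lift hn h0_gt0 tanX Uy) partial_lift_euler; last exact: dX.
have -> : n%:R = m%:R + 1 :> R by rewrite natr1 prednK//; case: n hn.
by move: (\sum_k _) => S; field; rewrite r0 ht.
Qed.

Definition sqnorm y : R := \sum_k y 0 (hi k) * y 0 (hi k).

Lemma has_grad_sqnorm y : has_grad sqnorm y (grad_split (fun j => 2 * y 0 (hi j)) 0).
Proof.
have H := has_grad_sum (fun k => has_gradM (has_grad_hcoord k y) (has_grad_hcoord k y)).
apply: has_grad_split H _ _ => [j|]; last first.
  by rewrite big1// => k _; rewrite grad_splitr mulr0 addr0.
rewrite (bigD1 j)//= big1 => [|k kj]; rewrite !grad_splitl.
  by rewrite [(j == j)%:R](_ : _ = 1) ?eqxx//; ring.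
by rewrite eq_sym (negbTE kj) !mulr0 addr0.
Qed.

(** With [s = |x|^2], the product [s (1 - s)] is positive exactly on the punctured unit ball. The
    cutoff is 0 where [k s (1 - s) <= 1], in particular near the origin and outside the ball, and 1
    where [k s (1 - s) >= 2]. *)
Definition cut (k : nat) y : R := step (k%:R * (sqnorm y * (1 - sqnorm y)) - 1).
Definition cut' (k : nat) y : R :=
  step' (k%:R * (sqnorm y * (1 - sqnorm y)) - 1) * (k%:R * (1 - 2 * sqnorm y)) * 2.

Lemma has_grad_cut k y :
  has_grad (cut k) y (grad_split (fun j => cut' k y * y 0 (hi j)) 0).
Proof.
pose s := sqnorm y.
have Hs := has_derM (has_der_id s) (has_derB (has_der_cst 1 s) (has_der_id s)).
have H := has_grad_comp (has_der_comp (has_derB (has_derZ k%:R Hs) (has_der_cst 1 s))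
  (has_der_step _)) (has_grad_sqnorm y).
apply: has_grad_split H _ _ => [j|]; last by rewrite grad_splitr mulr0.
by rewrite grad_splitl /cut' /s; ring.
Qed.

Lemma cut_arg_continuous (k : nat) y :
  {for y, continuous (fun z => k%:R * (sqnorm z * (1 - sqnorm z)))}.
Proof.
have Hs := has_derM (has_der_id (sqnorm y)) (has_derB (has_der_cst 1 _) (has_der_id _)).
exact: has_grad_continuous (has_grad_comp (has_derZ k%:R Hs) (has_grad_sqnorm y)).
Qed.

Lemma cut'_continuous k : continuous (cut' k).
Proof.
move=> y; have c1 := cvgB (@cut_arg_continuous k y) (cvg_cst (1 : R)).
have c2 : {for y, continuous
    (fun z => step' (k%:R * (sqnorm z * (1 - sqnorm z)) - 1))}.
  apply: (@continuous_comp _ _ _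
    (fun z => k%:R * (sqnorm z * (1 - sqnorm z)) - 1) step').
    exact: c1.
  exact: step'_continuous.
have c3 := has_grad_continuous (has_gradZ k%:R (has_gradD (has_grad_cst 1 y)
  (has_gradN (has_gradZ 2 (has_grad_sqnorm y))))).
exact: cvgM (cvgM c2 c3) (cvg_cst _).
Qed.

Lemma cut_out k y : (k%:R * (sqnorm y * (1 - sqnorm y)) <= 1) -> cut k y = 0.
Proof. by move=> H; rewrite /cut step_le0// subr_le0. Qed.

(** Extended by 0 outside [cat_nbhd], so as to be integrated over the whole space. *)
Definition cut_flux k j y : R := if `[< U y >] then cut k y * flux j y else 0.

Lemma cut_flux_in k j y : U y -> cut_flux k j y = cut k y * flux j y.
Proof. by move=> Uy; rewrite /cut_flux asboolT. Qed.

Lemma has_grad_cut_flux k j y : U y -> has_grad (cut_flux k j : _ -> R^o) y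
  (fun i => cut k y * partial i (flux j : _ -> R^o) y +
    flux j y * grad_split (fun l => cut' k y * y 0 (hi l)) 0 i).
Proof.
move=> Uy; apply: (has_grad_near (f := fun z => cut k z * flux j z)).
  by apply: filterS (near_nbhd Uy) => z Uz; rewrite cut_flux_in.
apply: has_gradM (has_grad_cut k y) (has_gradP _).
exact: smooth_on_differentiable (smooth_on_flux j) Uy.
Qed.

Lemma div_cut_flux k y : U y -> \sum_j partial j (cut_flux k j : _ -> R^o) y =
  cut k y * (rho (vpart y) * div_C h0 X (ret y)).
Proof.
move=> Uy; under eq_bigr => j _.
  have [_ ->] := has_grad_cut_flux k j Uy; over.
rewrite big_split/= -mulr_sumr div_flux// [X in _ + X](_ : _ = 0) ?addr0//.
rewrite sum_split grad_splitr mulr0 addr0.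
under eq_bigr do rewrite grad_splitl mulrCA.
by rewrite -mulr_sumr flux_radial// mulr0.
Qed.

(** A point leaves [cat_nbhd] in two ways. Its horizontal part is 0, and the cutoff vanishes nearby;
    or its height is outside the profile's domain, hence strictly beyond the support of [X]. *)
Lemma cut_flux_near0 k j y : ~ U y -> \forall z \near y, cut_flux k j z = 0.
Proof.
move=> nUy; have [K [T0 [_ _ dT _ XT]]] := test_field_support hn h0_gt0 tX.
have [dy|ndy] := pselect (dom (vpart y)).
  have y0 : hpart y = 0 by apply: contrapT => /eqP y0; apply: nUy.
  have s0 : sqnorm y = 0.
    by rewrite /sqnorm big1// => l _; rewrite -hpartE y0 mxE mul0r.
  have c : (fun z => k%:R * (sqnorm z * (1 - sqnorm z))) z @[z --> y] --> (0 : R).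
    rewrite [X in _ --> X](_ : _ = k%:R * (sqnorm y * (1 - sqnorm y))); last first.
      by rewrite s0 mul0r mulr0.
    exact: cut_arg_continuous.
  near=> z; rewrite /cut_flux; case: asboolP => // Uz; rewrite cut_out ?mul0r//.
  by apply: ltW; near: z; exact: (cvgr_lt _ c).
have Ty : `|T0| < `|vpart y|.
  by rewrite ltNge; apply/negP => H; apply: ndy; exact: cat_dom_sub H dT.
near=> z; rewrite /cut_flux; case: asboolP => // Uz.
rewrite flux_out ?mulr0//; apply: XT => //; rewrite vpartE; near: z.
by apply: (coord_continuous (near_normr_gt _)); rewrite -vpartE.
Unshelve. all: by end_near. Qed.

Lemma partial_near0 (f : 'rV[R]_N -> R^o) y : (\forall z \near y, f z = 0) ->
  \forall z \near y, has_grad f z (fun=> 0).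
Proof.
move=> /nbhs_interior; apply: filterS => z f0.
apply: has_grad_near (has_grad_cst 0 z).
by move: f0; apply: filterS => x ->.
Qed.

Lemma near_continuous (f g : 'rV[R]_N -> R^o) y : (\forall z \near y, f z = g z) ->
  {for y, continuous f} -> {for y, continuous g}.
Proof.
move=> fg cf; rewrite /prop_for /continuous_at -(nbhs_singleton fg).
exact: (cvg_trans (near_eq_cvg fg) cf).
Qed.

Lemma derivable_cut_flux k j y : derivable (cut_flux k j : _ -> R^o) y (evec j).
Proof.
apply: diff_derivable; have [Uy|nUy] := pselect (U y).
  by have [] := has_grad_cut_flux k j Uy.
by have [] := nbhs_singleton (partial_near0 (cut_flux_near0 k j nUy)).
Qed.

Lemma partial_cut_flux_continuous k j :
  continuous (partial j (cut_flux k j : _ -> R^o)).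
Proof.
move=> y; have [Uy|nUy] := pselect (U y); last first.
  have H := partial_near0 (cut_flux_near0 k j nUy).
  apply: (@near_continuous (fun=> 0)); last exact: cst_continuous.
  by apply: filterS H => z [_ ->].
pose G z := cut k z * partial j (flux j : _ -> R^o) z +
    flux j z * grad_split (fun l => cut' k z * z 0 (hi l)) 0 j.
have GE : \forall z \near y, G z = partial j (cut_flux k j : _ -> R^o) z.
  apply: filterS (near_nbhd Uy) => z Uz.
  by have [_ ->] := has_grad_cut_flux k j Uz.
have cG : {for y, continuous G}.
  have df := smooth_on_differentiable (smooth_on_flux j) Uy.
  have dpf := smooth_on_differentiable (smooth_on_partial j (smooth_on_flux j)) Uy.
  have c1 : {for y, continuous (cut k : _ -> R)} := has_grad_continuous (has_grad_cut k y).
  have c2 : {for y, continuous (partial j (flux j : _ -> R^o) : _ -> R)} :=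
    has_grad_continuous (has_gradP dpf).
  have c3 : {for y, continuous (flux j : _ -> R)} := has_grad_continuous (has_gradP df).
  suff c4 : {for y, continuous (fun z =>
      grad_split (fun l => cut' k z * z 0 (hi l)) 0 j : R)}.
    exact: (cvgD (cvgM c1 c2) (cvgM c3 c4)).
  move: j {G GE df dpf c2 c3}; apply: split_ind => [l|].
    apply: (eq_continuous_for (g := fun z : 'rV[R]_N => cut' k z * z 0 (hi l))).
      by move=> z; rewrite grad_splitl.
    have c5 : {for y, continuous (cut' k : _ -> R)} by exact: cut'_continuous.
    have c6 : {for y, continuous (fun z : 'rV[R]_N => z 0 (hi l))} by exact: coord_continuous.
    exact: (cvgM c5 c6).
  apply: (eq_continuous_for (g := fun=> 0)); last exact: cst_continuous.
  by move=> z; rewrite grad_splitr.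
exact: near_continuous GE cG.
Qed.

(** Exceeds both the unit radius, beyond which the cutoff is 0, and the heights of the profile. *)
Let bound : R := 1 + h0 * pi.

Let cut_flux_bound k j y : (exists i, bound <= `|y 0 i|) -> cut_flux k j y = 0.
Proof.
have hp : 0 < h0 * pi by rewrite mulr_gt0// pi_gt0.
move=> [i yi]; rewrite /cut_flux; case: asboolP => // Uy; move: i yi.
apply: split_ind => [l|] yi.
  rewrite cut_out ?mul0r//; apply: (@le_trans _ _ 0) => //.
  rewrite /sqnorm sum_coord2 mulr_ge0_le0// mulr_ge0_le0 ?sqr_ge0// subr_le0.
  rewrite exprn_ege1//; apply: le_trans (coord_le_enorm l _); rewrite hpartE.
  by apply: le_trans yi; rewrite lerDl ltW.
have := cat_dom_lt hn h0_gt0 (nbhd_dom Uy); rewrite vpartE => /(le_lt_trans yi).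
by rewrite gtrDr ltr10.
Qed.

(** The extra unit makes the field vanish on a neighbourhood of the point and not just at it. *)
Let partial_bound k j y : (exists i, bound + 1 <= `|y 0 i|) ->
  partial j (cut_flux k j : _ -> R^o) y = 0.
Proof.
move=> [i yi].
have H : \forall z \near y, cut_flux k j z = 0.
  have yi' : bound < `|y 0 i| by apply: lt_le_trans yi; rewrite ltrDl.
  near=> z; apply: cut_flux_bound; exists i; apply: ltW; near: z.
  exact: (coord_continuous (near_normr_gt yi')).
by have [_ ->] := nbhs_singleton (partial_near0 H).
Unshelve. all: by end_near. Qed.

Lemma integral_cut_div k :
  (\int[mu]_(p in pdom) (cut k (prow p) * par_pull h0 (div_C h0 X) p)%:E = 0)%E.
Proof.
have H j : mu.-integrable setT (EFin \o (partial j (cut_flux k j : _ -> R^o) \o prow)) /\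
   (\int[mu]_p (partial j (cut_flux k j : _ -> R^o) (prow p))%:E = 0)%E.
  apply: (integral_partial_par (M := bound + 1)).
  - by move=> y; exact: derivable_cut_flux.
  - exact: partial_cut_flux_continuous.
  - move=> y [i yi]; apply: cut_flux_bound; exists i; apply: le_trans yi.
    by rewrite lerDl.
  - exact: partial_bound.
transitivity (\int[mu]_p (\sum_j (partial j (cut_flux k j : _ -> R^o) (prow p))%:E))%E.
  rewrite integral_mkcond; apply: eq_integral => p _; rewrite sumEFin patchE.
  case: ifPn => [/set_mem/(par_domP (h0 := h0)) Up|/negP np].
    by rewrite div_cut_flux// par_pullE/=; congr (_%:E); ring.
  have [Up|nUp] := pselect (U (prow p)); last first.
    rewrite big1// => j _.
    by have [_ ->] := nbhs_singleton (partial_near0 (cut_flux_near0 k j nUp)).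
  rewrite div_cut_flux// cut_out ?mul0r//; apply: (@le_trans _ _ 0) => //.
  have r1 : 1 <= rad (prow p).
    rewrite leNgt; apply/negP => r1; apply: np; rewrite inE par_domE.
    by split.
  rewrite /sqnorm sum_coord2 mulr_ge0_le0// mulr_ge0_le0 ?sqr_ge0// subr_le0.
  by rewrite exprn_ege1.
rewrite integral_sum//; last by move=> j; have [] := H j.
by rewrite big1// => j _; have [] := H j.
Qed.

(** On the parameter domain the cutoffs are eventually equal to 1, and they take values in [[0, 1]].
    Dominated convergence, with the integrable divergence of [X] as majorant, passes from the
    vanishing cut-off integrals to the full one. *)
Theorem divergence_theorem : integral_C h0 (div_C h0 X) = 0.
Proof.
have iD := integrable_C_div hn h0_gt0 tX.
have mD := @measurable_par_dom R n h0.
pose F k p := (cut k (prow p) * par_pull h0 (div_C h0 X) p)%:E.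
have mF k : measurable_fun pdom (F k).
  apply/measurable_EFinP; apply: measurable_funM.
    apply: measurable_funTS.
    have mc := @measurable_fun_row _ _ R N prow (@measurable_par_row R n) setT (cut k)
      openT (fun y _ => has_grad_continuous (has_grad_cut k y)).
    by move: mc; rewrite preimage_setT.
  by apply/measurable_EFinP; exact: measurable_int iD.
have F_cvg p : pdom p -> F ^~ p @ \oo --> (EFin \o par_pull h0 (div_C h0 X)) p.
  rewrite par_domE => -[Up p1]; apply: cvg_near_cst.
  have c0 : 0 < sqnorm (prow p) * (1 - sqnorm (prow p)).
    have r0 := nbhd_rad Up.
    by rewrite /sqnorm sum_coord2 mulr_gt0 ?exprn_gt0// subr_gt0 exprn_ilt1// ltW.
  near=> k; rewrite /F /= /cut step_ge1 ?mul1r//.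
  rewrite lerBrDr -ler_pdivrMr//; near: k; exact: nbhs_infty_ger.
have F_le p k : pdom p -> (`|F k p| <= `|(par_pull h0 (div_C h0 X) p)%:E|)%E.
  move=> _; rewrite lee_fin normrM ler_piMl//.
  by rewrite /cut; have /andP[c0 c1] := step_bounds (k%:R * (sqnorm (prow p) * (1 - sqnorm (prow p))) - 1); rewrite ger0_norm.
have [_ _ cvgI] := @dominated_convergence _ _ R mu pdom mD F
  (EFin \o par_pull h0 (div_C h0 X)) (fun p => `|(par_pull h0 (div_C h0 X) p)%:E|%E)
  mF (measurable_int mu iD) (aeW _ F_cvg) (integrable_abse iD) (aeW _ (fun p k => F_le p k)).
rewrite /integral_C /Rintegral; rewrite (_ : integral _ _ _ = 0%E)//.
apply: cvg_unique cvgI _; first exact: ereal_hausdorff.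
by apply: cvg_near_cst; apply: nearW => k /=; exact: integral_cut_div.
Unshelve. all: by end_near. Qed.

End DivergenceTheorem.

(** * Sobolev membership *)

Section SobolevMembership.
Context {R : realType}.
Variables (n : nat) (h0 : R).
Hypotheses (hn : (3 <= n)%N) (h0_gt0 : 0 < h0).
Local Notation N := (n + 1)%N.
Local Notation m := n.-1.
Local Notation h := (@cat_h R n h0).
Local Notation u := (cat_u n h0).
Local Notation C := (@catenoid R n h0).
Local Notation U := (@cat_nbhd R n h0).
Local Notation ret := (@cat_retr R n h0).
Local Notation rho := (par_density n h0).
Local Notation prow := (@par_row R n).
Implicit Types (y z : 'rV[R]_N).

Lemma integral_CD (f g : 'rV[R]_N -> R) : integrable_C h0 f -> integrable_C h0 g ->
  integral_C h0 (fun y => f y + g y) = integral_C h0 f + integral_C h0 g.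
Proof.
move=> fi gi; rewrite /integral_C -RintegralD//; last exact: measurable_par_dom.
by apply: eq_Rintegral => p _; rewrite /par_pull mulrDl.
Qed.

Lemma eq_integral_C (f g : 'rV[R]_N -> R) : (forall y, C y -> f y = g y) ->
  integral_C h0 f = integral_C h0 g.
Proof.
move=> fg; apply: eq_Rintegral => p /set_mem/par_domP Up.
by rewrite !par_pullE/= fg//; exact: ret_catenoid.
Qed.

Lemma lift_continuous_diff (f : 'rV[R]_N -> R^o) :
  (forall y, U y -> differentiable (f \o ret) y) -> lift_continuous h0 f.
Proof. by move=> df y /df; exact: differentiable_continuous. Qed.

Lemma lift_continuousM (f g : 'rV[R]_N -> R) : lift_continuous h0 f ->
  lift_continuous h0 g -> lift_continuous h0 (fun y => f y * g y).
Proof. by move=> cf cg y Uy; exact: cvgM (cf y Uy) (cg y Uy). Qed.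

Lemma lift_continuous_sum (I : finType) (f : I -> 'rV[R]_N -> R^o) :
  (forall i y, U y -> differentiable (f i \o ret) y) ->
  lift_continuous h0 (fun y => \sum_i f i y).
Proof.
move=> df; apply: lift_continuous_diff => y Uy.
by have [] := has_grad_sum (fun i => has_gradP (df i y Uy)).
Qed.

(* Integration by parts: f X is again a compactly supported field. *)
Lemma weak_grad_tgrad (f : 'rV[R]_N -> R^o) : smooth_C h0 f ->
  (forall i y, U y -> differentiable ((fun z => tgrad h0 f z 0 i : R^o) \o ret) y) ->
  weak_grad h0 f (tgrad h0 f).
Proof.
move=> sf dG; split.
- exact: tangential_tgrad.
- move=> i; apply: (L1loc_continuous hn h0_gt0); apply: lift_continuous_diff => y Uy.
  exact: dG.
move=> X tX; have [tanX smX [K [cK KC X0]]] := tX.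
have tfX : test_field h0 (fun y => f y *: X y).
  split.
  - by move=> y Cy; rewrite dotpZ tanX// mulr0.
  - move=> i; apply: (eq_smooth_on (@cat_nbhd_open R n h0) _
      (smooth_onM (@cat_nbhd_open R n h0) sf (smX i))) => y _ /=.
    by rewrite mxE.
  - by exists K; split=> // y Cy nKy; rewrite X0// scaler0.
have df y : U y -> differentiable (f \o ret) y.
  by move=> Uy; exact: smooth_on_differentiable sf Uy.
have dX i y : U y -> differentiable ((fun z => X z 0 i : R^o) \o ret) y.
  by move=> Uy; exact: smooth_on_differentiable (smX i) Uy.
have := divergence_theorem hn h0_gt0 tfX.
rewrite (eq_integral_C (g := fun y => f y * div_C h0 X y + dotp (tgrad h0 f y) (X y))); last first.
  move=> y Cy; have Uy := catenoid_nbhd hn h0_gt0 Cy.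
  by rewrite (div_CM hn h0_gt0)//; [exact: df|move=> i; exact: dX].
rewrite integral_CD; first by move=> /eqP; rewrite addr_eq0 => /eqP.
- apply: (integrable_C_compact hn h0_gt0 _ cK KC).
    by apply: lift_continuousM; [exact: lift_continuous_diff|exact: lift_continuous_div].
  by move=> y Cy nKy; rewrite (div_C_out hn h0_gt0 cK KC X0)// mulr0.
- apply: (integrable_C_compact hn h0_gt0 _ cK KC).
    rewrite (_ : (fun y => _) = fun y => \sum_i tgrad h0 f y 0 i * X y 0 i); last first.
      by apply/funext => y; rewrite dotpE.
    apply: lift_continuous_sum => i y Uy.
    by have [] := has_gradM (has_gradP (dG i y Uy)) (has_gradP (dX i y Uy)).
  by move=> y Cy nKy; rewrite X0// dotpC -[0 : 'rV_N](scale0r 0) dotpZ mul0r.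
Qed.

Section Combination.
Variables (c : 'I_n -> R) (f : 'rV[R]_N -> R^o).
Hypothesis fE : forall y, C y -> f y = u (vpart y) * cdir c y.

Lemma wdir_le1 k y : U y -> `|wdir k y| <= 1.
Proof.
move=> Uy; rewrite /wdir normrM normfV (ger0_norm (enorm_ge0 _)).
rewrite ler_pdivrMr ?mul1r; last exact: nbhd_rad Uy.
by rewrite -hpartE; exact: coord_le_enorm.
Qed.

Lemma cdir_bound y : U y -> `|cdir c y| <= \sum_k `|c k|.
Proof.
move=> Uy; apply: le_trans (ler_norm_sum _ _ _) _; apply: ler_sum => k _.
by rewrite normrM ler_piMr// wdir_le1.
Qed.

Lemma cdir2_bound y : U y -> cdir c y ^+ 2 <= (\sum_k `|c k|) ^+ 2.
Proof.
by move=> Uy; rewrite -real_normK ?num_real// lerXn2r ?nnegrE ?sumr_ge0// cdir_bound.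
Qed.

Let dfr y : U y -> differentiable (f \o ret) y.
Proof. by move=> Uy; have [] := has_grad_comb hn h0_gt0 fE Uy. Qed.

Let dG i y : U y -> differentiable ((fun z => tgrad h0 f z 0 i : R^o) \o ret) y.
Proof. by move=> Uy; exact: (differentiable_tgrad_comb hn h0_gt0 fE). Qed.

Lemma integrable_C_comb2 : integrable_C h0 (fun y => f y ^+ 2).
Proof.
apply: (integrable_C_bounded hn h0_gt0 (B := n%:R * h0 ^+ m * (\sum_k `|c k|) ^+ 2)).
  apply: (lift_continuousM (f := f) (g := f)); exact: lift_continuous_diff dfr.
move=> y Uy; have dy := nbhd_dom Uy.
have E : f (ret y) ^+ 2 * rho (vpart y) = n%:R * h0 ^+ m * cdir c y ^+ 2.
  have := comb_lift hn h0_gt0 fE Uy; rewrite /= => ->.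
  by rewrite -(density_u hn h0_gt0 dy); ring.
have nh : 0 <= n%:R * h0 ^+ m by rewrite mulr_ge0// exprn_ge0// ltW.
rewrite E ger0_norm; last by rewrite mulr_ge0// sqr_ge0.
by rewrite ler_wpM2l// cdir2_bound.
Qed.

Lemma cat_u_le1 t : cat_dom n h0 t -> u t <= 1.
Proof.
move=> dt; rewrite /cat_u; have ht := cat_h_gt0 hn h0_gt0 dt.
have q0 : 0 <= h0 / h t by rewrite divr_ge0// ltW.
apply: exprn_ile1 => //.
by rewrite ler_pdivrMr ?mul1r//; exact: cat_h_ge dt.
Qed.

Lemma integrable_C_tgrad2 : integrable_C h0 (fun y => enorm (tgrad h0 f y) ^+ 2).
Proof.
(* The density turns the factor [u^2] into the constant [n h0^(n-1)]; then [h >= h0] and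
   [0 <= 1 - u^2 <= 1]. *)
pose B := (n%:R * h0 ^+ m / h0 ^+ 2) * (\sum_k c k ^+ 2 + m%:R ^+ 2 * (\sum_k `|c k|) ^+ 2).
apply: (integrable_C_bounded hn h0_gt0 (B := B)).
  rewrite (_ : (fun y => _) = fun y => \sum_i tgrad h0 f y 0 i * tgrad h0 f y 0 i); last first.
    by apply/funext => y; rewrite sqr_enorm dotpE.
  apply: lift_continuous_sum => i y Uy.
  by have [] := has_gradM (has_gradP (dG i Uy)) (has_gradP (dG i Uy)).
move=> y Uy; have dy := nbhd_dom Uy.
have hy := nbhd_h hn h0_gt0 Uy; have hy0 : h (vpart y) != 0 by rewrite gt_eqF.
have u0 := cat_u_gt0 hn h0_gt0 dy; have u1 := cat_u_le1 dy.
have u2 : u (vpart y) ^+ 2 <= 1 by rewrite expr_le1// ltW.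
rewrite sqr_enorm dotpE.
under eq_bigr do rewrite -expr2.
rewrite (sum_tgrad_comb_sqr hn h0_gt0 fE Uy).
have E : ((u (vpart y) / h (vpart y)) ^+ 2 * (\sum_k c k ^+ 2 - cdir c y ^+ 2) +
    (m%:R * u (vpart y) / h (vpart y)) ^+ 2 * (1 - u (vpart y) ^+ 2) * cdir c y ^+ 2)
    * rho (vpart y) =
  (n%:R * h0 ^+ m / h (vpart y) ^+ 2) * ((\sum_k c k ^+ 2 - cdir c y ^+ 2) +
    m%:R ^+ 2 * (1 - u (vpart y) ^+ 2) * cdir c y ^+ 2).
  by rewrite -(density_u hn h0_gt0 dy); field.
rewrite E.
have q2 := cdir2_bound Uy.
(* Cauchy-Schwarz for the unit vector [w], from the nonnegativity of [|c - <c,w> w|^2]. *)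
have cs : cdir c y ^+ 2 <= \sum_k c k ^+ 2.
  have : 0 <= \sum_k (c k - cdir c y * wdir k y) ^+ 2 by apply: sumr_ge0 => k _; exact: sqr_ge0.
  have -> : \sum_k (c k - cdir c y * wdir k y) ^+ 2 = \sum_k c k ^+ 2 -
      2 * cdir c y * (\sum_k c k * wdir k y) + cdir c y ^+ 2 * (\sum_k wdir k y * wdir k y).
    rewrite (eq_bigr (fun k => c k ^+ 2 + - (2 * cdir c y) * (c k * wdir k y) +
        cdir c y ^+ 2 * (wdir k y * wdir k y))).
      by rewrite !big_split/= -!mulr_sumr mulNr.
    by move=> k _; move: (c k) (wdir k y) (cdir c y) => a b d; ring.
  rewrite (sum_wdir2 Uy) -/(cdir c y).
  by move: (\sum_k c k ^+ 2) (cdir c y) => S q H; nra.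
have nh : 0 <= n%:R * h0 ^+ m by rewrite mulr_ge0// exprn_ge0// ltW.
have t1 : 0 <= 1 - u (vpart y) ^+ 2 <= 1 by rewrite subr_ge0 u2 gerBl sqr_ge0.
have in0 : 0 <= (\sum_k c k ^+ 2 - cdir c y ^+ 2) +
    m%:R ^+ 2 * (1 - u (vpart y) ^+ 2) * cdir c y ^+ 2.
  apply: addr_ge0; first by rewrite subr_ge0.
  apply: mulr_ge0; last exact: sqr_ge0.
  by apply: mulr_ge0; [exact: sqr_ge0|case/andP: t1].
rewrite ger0_norm; last by rewrite mulr_ge0// divr_ge0// sqr_ge0.
rewrite /B; apply: ler_pM => //; first by rewrite divr_ge0// sqr_ge0.
  apply: ler_wpM2l => //; rewrite lef_pV2 ?posrE ?exprn_gt0//.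
  by rewrite lerXn2r ?nnegrE ?(ltW h0_gt0) ?(ltW hy)//; exact: cat_h_ge dy.
apply: lerD; first by rewrite gerBl sqr_ge0.
rewrite -mulrA ler_wpM2l ?sqr_ge0//; apply: le_trans q2.
by rewrite ler_piMl ?sqr_ge0//; case/andP: t1.
Qed.

Lemma W12_comb : W12 n h0 (fun=> 1) f.
Proof.
split.
- by apply: (L1loc_continuous hn h0_gt0); exact: lift_continuous_diff dfr.
- exists (tgrad h0 f); last exact: integrable_C_tgrad2.
  apply: weak_grad_tgrad; last exact: dG.
  exact: smooth_comb fE.
- rewrite (_ : (fun y => _) = fun y => f y ^+ 2); first exact: integrable_C_comb2.
  by apply/funext => y; rewrite mulr1.
Qed.

End Combination.

Variable Rad : R.
Hypothesis Rad_gt0 : 0 < Rad.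

(** The form with a maximum shows that the weight is continuous across [|y| = Rad]. *)
Lemma weightE y : weight n Rad y = (Num.max Rad (enorm y)) ^- 2.
Proof.
by rewrite /weight maxC maxEge; case: ltP => // H.
Qed.

Lemma weight_bounds y : 0 <= weight n Rad y <= Rad ^- 2.
Proof.
rewrite weightE; have M0 : 0 < Num.max Rad (enorm y) by rewrite lt_max Rad_gt0.
rewrite invr_ge0 exprn_ge0 ?(ltW M0)//= lef_pV2 ?posrE ?exprn_gt0//.
by rewrite lerXn2r ?nnegrE ?(ltW M0) ?(ltW Rad_gt0)// le_max lexx.
Qed.

Lemma enorm_continuous k : continuous (@enorm R k).
Proof.
move=> y; apply: (@continuous_comp _ _ _ (fun z : 'rV[R]_k => dotp z z) Num.sqrt).
  apply: (@differentiable_continuous _ _ R^o).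
  by have [] := has_grad_sum (fun i => has_gradM (has_grad_coord i y) (has_grad_coord i y)).
exact: sqrt_continuous.
Qed.

Lemma lift_continuous_weight : lift_continuous h0 (weight n Rad).
Proof.
move=> y Uy.
have c1 : {for y, continuous (fun z => enorm (ret z))}.
  by apply: (@continuous_comp _ _ _ ret (@enorm R N)); [exact: continuous_ret|exact: enorm_continuous].
have M0 z : 0 < Num.max Rad (enorm z) by rewrite lt_max Rad_gt0.
apply: (eq_continuous_for (g := fun z => (((Num.max Rad (enorm (ret z))) ^+ 2)^-1 : R))).
  by move=> z; rewrite /= weightE.
have c2 : {for y, continuous (fun z => Num.max Rad (enorm (ret z)))}.
  have -> : (fun z => Num.max Rad (enorm (ret z))) =
      (fun z => (Rad + enorm (ret z) + `|Rad - enorm (ret z)|) / 2).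
    by apply/funext => z; rewrite maxr_absE.
  have c0 : {for y, continuous (fun=> Rad)} by exact: cst_continuous.
    have c3 : {for y, continuous (fun z => Rad - enorm (ret z))} by exact: (cvgB c0 c1).
    have c4 : {for y, continuous (fun z => `|Rad - enorm (ret z)|)} by exact: (cvg_norm c3).
    have c5 : {for y, continuous (fun z => Rad + enorm (ret z))} by exact: (cvgD c0 c1).
    apply: (@continuousM R _ (fun z => Rad + enorm (ret z) + `|Rad - enorm (ret z)|) (fun=> 2^-1)).
      exact: (cvgD c5 c4).
    exact: cst_continuous.
have c3 : {for y, continuous (fun z => Num.max Rad (enorm (ret z)) ^+ 2)} by exact: (cvgM c2 c2).
by apply: (cvgV _ c3); rewrite expf_neq0// gt_eqF.
Qed.

(** The weight is at most [Rad^-2], and the conditions on [f] and its weak gradient are shared by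
    the two spaces. *)
Lemma W12_weight (f : 'rV[R]_N -> R^o) : W12 n h0 (fun=> 1) f -> W12 n h0 (weight n Rad) f.
Proof.
move=> [Lf Gf f2]; split=> //.
have mf := measurable_int _ f2.
apply: le_integrable (integrableZl _ (Rad ^- 2) f2) => //.
- exact: measurable_par_dom.
- apply/measurable_EFinP.
  rewrite (_ : par_pull h0 _ = fun p => par_pull h0 (fun y => f y ^+ 2 * 1) p * weight n Rad (ret (prow p))); last first.
    by apply/funext => p; rewrite !par_pullE/= mulr1 mulrAC.
  apply: measurable_funM; first exact/measurable_EFinP.
  rewrite par_domE; apply: (@measurable_fun_row _ _ R N prow (@measurable_par_row R n) _ (weight n Rad \o ret)).
    exact: cat_ball_open.
  by move=> y [Uy _]; exact: lift_continuous_weight.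
- move=> p /par_domP Up; rewrite [leLHS]/= -EFinM [leRHS]/= lee_fin !par_pullE/= mulr1.
  have /andP[w0 w1] := weight_bounds (ret (prow p)).
  have r0 := density_gt0 hn h0_gt0 (nbhd_dom Up).
  rewrite !normrM mulrAC mulrC -mulrA [X in _ <= X * _]ger0_norm ?invr_ge0 ?sqr_ge0//.
  rewrite [X in X * _]ger0_norm//.
  by rewrite ler_wpM2r// ?mulr_ge0.
- exact: measurable_par_dom.
Qed.

End SobolevMembership.

(** * Non-integrability at the ends *)

Section CatenoidEnds.
Context {R : realType}.
Variables (n : nat) (h0 : R).
Hypotheses (hn : (3 <= n)%N) (h0_gt0 : 0 < h0).
Local Notation leb1 := (@lebesgue_measure R).
Local Notation m := n.-1.
Local Notation dom := (@cat_dom R n h0).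
Local Notation s := (@cat_s R n h0).
Local Notation h := (@cat_h R n h0).
Local Notation h1 := (cat_h1 n h0).
Implicit Types al vv la be t a b c d e delta : R.

(** The bound [h0 * pi] on heights makes the extended real [s_infty] a positive real number. *)
Lemma cat_length : exists2 L : R, 0 < L & forall t, dom t <-> `|t| < L.
Proof.
have s0 : (0%:E < @s_infty R n h0)%E by have := cat_dom0 hn h0_gt0; rewrite /cat_dom/= normr0.
have sf : (@s_infty R n h0 <= (h0 * pi)%:E)%E.
  apply: ge_ereal_sup => _ [u hu <-]; rewrite lee_fin.
  by have /andP[] := cat_s_bounds hn h0_gt0 hu.
have fs : @s_infty R n h0 \is a fin_num.
  by rewrite fin_numElt (lt_trans (ltNyr 0) s0) (le_lt_trans sf (ltry _)).
exists (fine (@s_infty R n h0)); first by rewrite -lte_fin fineK.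
by move=> t; rewrite /cat_dom/= -[in X in _ <-> X]lte_fin fineK.
Qed.

(** With [q = h / h0 >= 2] and [n >= 3], [h'^2 >= q^4 - 1 >= q^4 / 4], so [h' >= q^2 / 2]. *)
Lemma cat_h1_lower t : dom t -> 0 <= t -> 2 * h0 <= h t ->
  h t ^+ 2 <= 2 * h0 ^+ 2 * h1 t.
Proof.
move=> dt t0 ht; have H := cat_h1_sqr hn h0_gt0 dt; have p0 := cat_h1_ge0 n h0 t0.
have h00 : h0 != 0 by rewrite gt_eqF.
pose q := h t / h0.
have hq : h t = q * h0 by rewrite /q divfK.
have q2 : 2 <= q by rewrite /q ler_pdivlMr.
have q1 : 1 <= q by lra.
have m2 : (4 <= 2 * m)%N by rewrite -[4%N]/(2 * 2)%N leq_mul2l; case: n hn => [|[|[|]]].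
have q4 : q ^+ 4 <= q ^+ (2 * m) by exact: ler_weXn2l.
have qq : 4 <= q ^+ 2 by rewrite expr2; nra.
have q44 : q ^+ 4 = q ^+ 2 * q ^+ 2 by rewrite -exprD.
suff: q ^+ 2 / 2 <= h1 t.
  move=> G; have -> : 2 * h0 ^+ 2 * h1 t = (2 * h1 t) * h0 ^+ 2 by ring.
  by rewrite hq exprMn ler_wpM2r ?sqr_ge0//; lra.
rewrite -(@ler_pXn2r _ 2) ?nnegrE//; last by rewrite divr_ge0// sqr_ge0.
rewrite H -/q; apply: (@le_trans _ _ (q ^+ 4 - 1)); last by rewrite lerD2r.
rewrite q44 expr2; move: (q ^+ 2) qq => z z4; nra.
Qed.

Lemma integral_slope (e a b : R) : a < b -> (forall t, a <= t <= b -> dom t) ->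
  (\int[leb1]_(t in `[a, b]) (e * h1 t)%:E = (e * (h b - h a))%:E)%E.
Proof.
move=> ab dm.
have dh t : a <= t <= b -> has_der (fun x => e * h x) t (e * h1 t).
  by move=> /dm dt; apply: has_derZ; exact: has_der_cat_h.
have ch t : a <= t <= b -> {for t, continuous (fun x => e * h x)}.
  by move=> /dh; exact: has_der_continuous.
have ch1 t : a <= t <= b -> {for t, continuous (fun x => e * h1 x)}.
  move=> /dm dt; apply: has_der_continuous; apply: has_derZ; exact: has_der_cat_h1.
rewrite (@continuous_FTC2 _ _ (fun x => e * h x))//.
- by rewrite -EFinB mulrBr.
- by apply/continuous_in_subspaceT => t /set_mem/=; rewrite in_itv/=; exact: ch1.
- split.
  + by move=> t /subset_itv_oo_cc; rewrite in_itv/= => /dh[].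
  + by apply: cvg_at_right_filter; apply: ch; rewrite lexx ltW.
  + by apply: cvg_at_left_filter; apply: ch; rewrite lexx ltW.
- move=> t /subset_itv_oo_cc; rewrite in_itv/= => /dh; exact: has_der_derive1.
Qed.

(** The factor [e] may be negative: this covers the lower end, where [h'] is negative and [h]
    decreases. *)
Lemma slope_integral_le (g : R -> R) (e a b : R) :
  leb1.-integrable setT (EFin \o g) -> a < b ->
  (forall t, a <= t <= b -> [/\ dom t, 0 <= e * h1 t & e * h1 t <= g t]) ->
  e * (h b - h a) <= fine (\int[leb1]_t `|(g t)%:E|)%E.
Proof.
move=> ig ab H; have /integrableP[mg gy] := ig.
have mI : measurable `[a, b] by exact: measurable_itv.
have mag : measurable_fun setT (fun t => `|(g t)%:E|%E) by exact: measurableT_comp.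
rewrite -lee_fin fineK; last first.
  by rewrite ge0_fin_numE//; apply: integral_ge0.
rewrite -integral_slope//; last by move=> t /H[].
apply: (@le_trans _ _ (\int[leb1]_(t in `[a, b]) `|(g t)%:E|)%E); last first.
  by apply: ge0_subset_integral.
apply: ge0_le_integral => //.
- by move=> t /=; rewrite in_itv/= => /H[_ ? _]; rewrite lee_fin.
- apply/measurable_EFinP; apply: subspace_continuous_measurable_fun => //.
  apply/continuous_in_subspaceT => t /set_mem/=; rewrite in_itv/= => /H[dt _ _].
  by apply: has_der_continuous; apply: has_derZ; exact: has_der_cat_h1.
- exact: measurable_funS mag.
- move=> t /=; rewrite in_itv/= => /H[_ _ ?]; rewrite lee_fin.
  by apply: le_trans (ler_norm _).
Qed.

(* A rigid-motion field divided by its factor (h0/h)^(n-1), along a meridian. *)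
Definition meridian_profile (al vv la be t : R) : R :=
  al - vv * h1 t + la * (h t - t * h1 t) + (t + h t * h1 t) * be.

Variable L : R.
Hypotheses (L_gt0 : 0 < L) (LP : forall t, dom t <-> `|t| < L).

(** The terms without [h'] are at most [K h], where [K] is the sum in the hypothesis, because
    [h >= h0] and [t <= L]. The quadratic bound [h^2 <= 2 h0^2 h'] then trades [K h] for
    [(2 h0^2 K / h) h']. *)
Lemma meridian_tail al la be delta t : 0 <= t -> dom t -> 2 * h0 <= h t ->
  2 * h0 ^+ 2 * (`|al| / h0 + `|la| + `|be| * L / h0) <= delta * h t ->
  `|al + la * h t + be * t| <= delta * h1 t.
Proof.
move=> t0 dt ht Kd; set K := (X in _ * X <= _) in Kd.
have h1l := cat_h1_lower dt t0 ht.
have hg := cat_h_ge hn h0_gt0 dt; have hp := cat_h_gt0 hn h0_gt0 dt.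
have tL : t <= L by move/LP: dt; rewrite ger0_norm// => /ltW.
have p0 := cat_h1_ge0 n h0 t0.
have hr : 1 <= h t / h0 by rewrite ler_pdivlMr// mul1r.
have QK : `|al + la * h t + be * t| <= K * h t.
  apply: le_trans (ler_normD _ _) _.
  rewrite /K mulrDl; apply: lerD.
    apply: le_trans (ler_normD _ _) _; rewrite mulrDl; apply: lerD.
      by rewrite mulrAC -mulrA ler_peMr.
    by rewrite normrM (gtr0_norm hp).
  have tLh : t <= L * (h t / h0) by apply: le_trans tL _; rewrite ler_peMr// ltW.
  have -> : `|be| * L / h0 * h t = `|be| * (L * (h t / h0)) by ring.
  by rewrite normrM (ger0_norm t0) ler_wpM2l.
have K0 : 0 <= K by rewrite !addr_ge0// ?divr_ge0 ?mulr_ge0// ltW.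
rewrite -(ler_pM2r hp); apply: (@le_trans _ _ (K * h t ^+ 2)).
  by rewrite expr2 mulrA ler_wpM2r// ltW.
apply: (@le_trans _ _ (K * (2 * h0 ^+ 2 * h1 t))); first by rewrite ler_wpM2l.
have -> : K * (2 * h0 ^+ 2 * h1 t) = (2 * h0 ^+ 2 * K) * h1 t by ring.
by rewrite [X in _ <= X]mulrAC ler_wpM2r.
Qed.

Lemma meridian_profileE al vv la be t : meridian_profile al vv la be t =
  (be * h t - (vv + la * t)) * h1 t + (al + la * h t + be * t).
Proof. by rewrite /meridian_profile; ring. Qed.

(** The coefficient of [h'] is at least [d + delta] and the tail costs [delta], so the profile is at
    least [d h'] in absolute value. Dividing its square by [h^2 <= 2 h0^2 h'] leaves one power of
    [h']. Beyond the height [s A] the radius exceeds [A]. *)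
Lemma meridian_lower al vv la be A T d delta : 2 * h0 <= A -> T < L -> 0 < d ->
  (forall t, 0 <= t -> T < t < L -> A < h t ->
    2 * h0 ^+ 2 * (`|al| / h0 + `|la| + `|be| * L / h0) <= delta * h t /\
    d + delta <= `|be * h t - (vv + la * t)|) ->
  exists2 S, 0 <= S < L & exists2 c, 0 < c & forall t, S < t < L ->
    c * h1 t <= (meridian_profile al vv la be t / h t) ^+ 2.
Proof.
move=> A2 TL d0 H.
have hA : h0 <= A by have := h0_gt0; lra.
have /andP[sA0 _] := cat_s_bounds hn h0_gt0 hA.
have sAL : s A < L by rewrite -(ger0_norm sA0); apply/LP; exact: cat_dom_s.
exists (Num.max T (s A)); first by rewrite le_max sA0 orbT gt_max TL sAL.
have h2 : 0 < 2 * h0 ^+ 2 by rewrite mulr_gt0// exprn_gt0.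
exists (d ^+ 2 / (2 * h0 ^+ 2)); first by rewrite divr_gt0// exprn_gt0.
move=> t /andP[]; rewrite gt_max => /andP[Tt st] tL.
have t0 : 0 <= t by rewrite ltW// (le_lt_trans sA0).
have dt : dom t by apply/LP; rewrite ger0_norm.
have hAt : A < h t by apply: cat_h_gt => //; rewrite ger0_norm.
have [|Kd dP] := H t t0 _ hAt; first by rewrite Tt.
have ht2 : 2 * h0 <= h t by exact: ltW (le_lt_trans A2 hAt).
have Q := meridian_tail t0 dt ht2 Kd.
have hl := cat_h1_lower dt t0 ht2.
have hp := cat_h_gt0 hn h0_gt0 dt; have p0 := cat_h1_ge0 n h0 t0.
have E : d * h1 t <= `|meridian_profile al vv la be t|.
  rewrite meridian_profileE.
  set P := be * h t - _ in dP *; set q := al + _ + _ in Q *.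
  have := ler_normD (P * h1 t + q) (- q); rewrite addrK normrN normrM (ger0_norm p0).
  have : (d + delta) * h1 t <= `|P| * h1 t by rewrite ler_wpM2r.
  by rewrite mulrDl; lra.
rewrite expr_div_n ler_pdivlMr ?exprn_gt0//.
apply: (@le_trans _ _ ((d * h1 t) ^+ 2)); last first.
  rewrite -[X in _ <= X]real_normK ?num_real// lerXn2r ?nnegrE//.
  by rewrite mulr_ge0// ltW.
apply: (@le_trans _ _ (d ^+ 2 / (2 * h0 ^+ 2) * h1 t * (2 * h0 ^+ 2 * h1 t))).
  by rewrite ler_wpM2l// mulr_ge0// divr_ge0// ?sqr_ge0// ltW.
rewrite le_eqVlt; apply/orP; left; apply/eqP.
by rewrite mulrACA divfK ?gt_eqF// exprMn -expr2.
Qed.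

Lemma meridian_lower_nz al vv la be : be != 0 ->
  exists2 S, 0 <= S < L & exists2 c, 0 < c & forall t, S < t < L ->
    c * h1 t <= (meridian_profile al vv la be t / h t) ^+ 2.
Proof.
move=> b0; pose K := `|al| / h0 + `|la| + `|be| * L / h0.
have K0 : 0 <= K by rewrite !addr_ge0// ?divr_ge0 ?mulr_ge0// ltW.
have nb : 0 < `|be| by rewrite normr_gt0.
(* Past [h = B / |be|] the term [be * h] outweighs [vv + la * t] by [d + delta], with [d = 1] and
   [delta = 2 * h0 * K]. *)
pose B := 1 + 2 * h0 * K + `|vv| + `|la| * L.
have B0 : 0 <= B by rewrite !addr_ge0// ?mulr_ge0// ltW.
apply: (@meridian_lower al vv la be (2 * h0 + B / `|be|) 0 1 (2 * h0 * K)) => //.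
  by rewrite lerDl divr_ge0.
move=> t t0 /andP[_ tL] Ah.
have Bb : 0 <= B / `|be| by rewrite divr_ge0// ltW.
split.
  rewrite -/K expr2 mulrA -[X in X <= _]mulrA -[X in _ <= X]mulrA ler_wpM2l ?mulr_ge0//.
    exact: ltW.
  by rewrite mulrC ler_wpM2l//; have := h0_gt0; lra.
have bh : B <= `|be| * h t.
  by rewrite mulrC -ler_pdivrMr//; have := h0_gt0; lra.
have hp : 0 < h t by have := h0_gt0; lra.
have := ler_normD (be * h t - (vv + la * t)) (vv + la * t); rewrite subrK normrM (gtr0_norm hp).
have := ler_normD vv (la * t); rewrite normrM (ger0_norm t0).
have : `|la| * t <= `|la| * L by rewrite ler_wpM2l// ltW.
by rewrite /B in bh; lra.
Qed.

Lemma meridian_lower_z al vv la : vv + la * L != 0 ->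
  exists2 S, 0 <= S < L & exists2 c, 0 < c & forall t, S < t < L ->
    c * h1 t <= (meridian_profile al vv la 0 t / h t) ^+ 2.
Proof.
move=> vL; pose K := `|al| / h0 + `|la| + `|0 : R| * L / h0.
have K0 : 0 <= K by rewrite !addr_ge0// ?divr_ge0 ?mulr_ge0// ltW.
pose D := `|vv + la * L|; have D0 : 0 < D by rewrite normr_gt0.
have l1 : 0 < `|la| + 1 by rewrite ltr_wpDl.
(* Within [w] of the end, [vv + la * t] differs from its limit by at most [D / 4]; the remaining
   [3 D / 4] is split into [d = D / 2] and [delta = D / 4]. Adding 1 to [|la|] avoids a division by
   zero. *)
pose w := D / 4 / (`|la| + 1); have w0 : 0 < w by rewrite !divr_gt0.
have wE : w * (`|la| + 1) = D / 4 by rewrite /w divfK// gt_eqF.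
have h2 : 0 <= 8 * h0 ^+ 2 * K by rewrite mulr_ge0// mulr_ge0// sqr_ge0.
apply: (@meridian_lower al vv la 0 (2 * h0 + 8 * h0 ^+ 2 * K / D) (L - w) (D / 2) (D / 4)).
- by rewrite lerDl divr_ge0// ltW.
- by rewrite gtrBl.
- by rewrite divr_gt0.
move=> t t0 /andP[Tt tL] Ah; rewrite -/K; split.
  have : 8 * h0 ^+ 2 * K / D <= h t by have := h0_gt0; lra.
  by rewrite ler_pdivrMr//; lra.
rewrite mul0r sub0r normrN.
have := ler_normD (vv + la * t) (la * (L - t)).
have -> : vv + la * t + la * (L - t) = vv + la * L by ring.
rewrite -/D normrM [`|L - t|]gtr0_norm ?subr_gt0//.
have : `|la| * (L - t) <= `|la| * w by rewrite ler_wpM2l//; lra.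
by move: wE; rewrite mulrDr mulr1 (mulrC w); lra.
Qed.

(** Otherwise the integral of [|g|] would bound a fixed multiple of every increment of [h] near the
    end, while [h] is unbounded. The sign [e] selects the end, with [t] measured towards it. *)
Lemma end_vanish g c e al vv la be : leb1.-integrable setT (EFin \o g) -> 0 < c ->
  e = 1 \/ e = -1 ->
  (forall t, 0 <= t < L -> c * (meridian_profile al vv la be t / h t) ^+ 2 <= g (e * t)) ->
  be = 0 /\ vv + la * L = 0.
Proof.
move=> ig c0 e1 cg; apply: contrapT => nz.
have [S /andP[S0 SL] [c1 c10 low]] : exists2 S, 0 <= S < L & exists2 c, 0 < c & forall t,
    S < t < L -> c * h1 t <= (meridian_profile al vv la be t / h t) ^+ 2.
  have [b0|] := eqVneq be 0; last exact: meridian_lower_nz.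
  by rewrite b0; apply: meridian_lower_z; apply/eqP => vL; exact: nz.
pose k := c * c1; have k0 : 0 < k by rewrite mulr_gt0.
pose M := fine (\int[leb1]_t `|(g t)%:E|)%E.
have M0 : 0 <= M by apply: fine_ge0; apply: integral_ge0.
have dg t : S < t < L -> [/\ dom t, 0 <= k * h1 t & k * h1 t <= g (e * t)].
  move=> StL; have /andP[St tL] := StL.
  have t0 : 0 <= t by rewrite ltW// (le_lt_trans S0).
  split.
  - by apply/LP; rewrite ger0_norm.
  - by rewrite mulr_ge0 ?(ltW k0)// cat_h1_ge0.
  - apply: le_trans (cg t _); last by rewrite t0.
    by rewrite /k -mulrA ler_wpM2l ?(ltW c0)// low.
have key a b : S < a -> a < b -> b < L -> k * (h b - h a) <= M.
  move=> Sa ab bL; case: e1 => e1; rewrite e1 in dg.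
    apply: slope_integral_le => // t /andP[at_ tb].
    by have := dg t; rewrite mul1r; apply; rewrite (lt_le_trans Sa)// (le_lt_trans tb).
  have -> : k * (h b - h a) = (- k) * (h (- a) - h (- b)) by rewrite !cat_hN; ring.
  apply: slope_integral_le => //; first by rewrite ltrN2.
  move=> t /andP[bt ta].
  have StL : S < - t < L by apply/andP; split; lra.
  have [dt k1 kg] := dg _ StL.
  rewrite cat_h1N mulrN mulN1r opprK in k1 kg; rewrite mulNr; split => //.
  by apply: cat_dom_sub dt; rewrite normrN.
pose a := (S + L) / 2; have Sa : S < a by rewrite /a; lra.
have aL : a < L by rewrite /a; lra.
(* A radius that an increment of at most [M / k] from [h a] cannot reach. *)
pose B := h a + M / k + 1.
have da : dom a by apply/LP; rewrite ger0_norm// ltW// (le_lt_trans S0).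
have Mk : 0 <= M / k by rewrite divr_ge0// ltW.
have hB : h0 <= B by have := cat_h_ge hn h0_gt0 da; rewrite /B; lra.
have /andP[sB0 _] := cat_s_bounds hn h0_gt0 hB.
have sBL : s B < L by rewrite -(ger0_norm sB0); apply/LP; exact: cat_dom_s.
pose b := (Num.max a (s B) + L) / 2.
have mL : Num.max a (s B) < L by rewrite gt_max aL.
have bL : b < L by rewrite /b; lra.
have mb : Num.max a (s B) < b by rewrite /b; lra.
have ab : a < b by apply: le_lt_trans mb; rewrite le_max lexx.
have b0 : 0 <= b by lra.
have Bh : B < h b.
  apply: cat_h_gt => //; first by apply/LP; rewrite ger0_norm.
  by rewrite ger0_norm//; apply: le_lt_trans mb; rewrite le_max lexx orbT.
have := key a b Sa ab bL; rewrite -ler_pdivlMl// mulrC.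
by rewrite /B in Bh; lra.
Qed.

(** The reflection [t -> - t] maps the lower end to the upper one and changes the signs of [vv] and
    [be] only. The two ends give [vv + la * L = 0] and [- vv + la * L = 0]. *)
Lemma section_vanish g c al vv la be : leb1.-integrable setT (EFin \o g) -> 0 < c ->
  (forall t, dom t -> c * (meridian_profile al vv la be t / h t) ^+ 2 <= g t) ->
  [/\ be = 0, vv = 0 & la = 0].
Proof.
move=> ig c0 cg.
have dL t : 0 <= t < L -> dom t by move=> /andP[t0 tL]; apply/LP; rewrite ger0_norm.
have [b0 p] : be = 0 /\ vv + la * L = 0.
  apply: (@end_vanish g c 1 al) => //; first by left.
  by move=> t /dL dt; rewrite mul1r; exact: cg.
have [_ q] : - be = 0 /\ - vv + la * L = 0.
  apply: (@end_vanish g c (-1) al) => //; first by right.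
  move=> t /dL dt; rewrite mulN1r.
  have <- : meridian_profile al vv la be (- t) = meridian_profile al (- vv) la (- be) t.
    by rewrite /meridian_profile cat_hN cat_h1N; ring.
  have <- : h (- t) = h t by exact: cat_hN.
  by apply: cg; apply: cat_dom_sub dt; rewrite normrN.
have lL : la * L = 0 by lra.
split=> //; first by lra.
by move/eqP: lL; rewrite mulf_eq0 (gt_eqF L_gt0) orbF => /eqP.
Qed.

End CatenoidEnds.

(** A nonempty open set contains a cube, whose measure is positive, so it cannot lie in a null
    set. *)
Lemma ae_open_exists (R : realType) n (O : set 'rV[R]_n) (P : ms_type (leb R n) -> Prop) :
  open O -> O !=set0 -> {ae ms_meas (leb R n), forall x, P x} ->
  exists x, O (leb_row x) /\ P x.
Proof.
move=> oO [c Oc] aeP; apply: contrapT => /forallNP H.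
have [e /= e0 eO] : exists2 e : R, 0 < e & ball c e `<=` O.
  by have /nbhs_ballP[e e0 eO] := open_nbhs_nbhs (conj oO Oc); exists e.
(* The value 0 at indices from [n] on is a filler: the cube constrains only the first [n]
   coordinates. *)
pose c' i := if insub i is Some k then c 0 k else 0.
have [mB BE] := @leb_box R n c' e (ltW e0).
set B := [set x | _] in mB BE.
have [A [mA A0 PA]] := aeP.
have BA : B `<=` A.
  move=> x Bx; apply: PA => Px; apply: (H x); split=> //; apply: eO.
  split=> // i j; rewrite ord1 /ball/= mxE distrC.
  have := Bx j (ltn_ord j); rewrite /c'; case: insubP => [k _ kj|]; last by rewrite ltn_ord.
  by rewrite (val_inj kj).
have : (ms_meas (leb R n) B <= ms_meas (leb R n) A)%E by apply: le_measure; rewrite ?inE.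
rewrite A0 BE lee_fin leNgt exprn_gt0//; last by rewrite mulr_gt0.
Qed.

(** * Fields generated by rigid motions, restricted to meridians *)

Section RigidMotionFields.
Context {R : realType}.
Variables (n : nat) (h0 : R).
Hypotheses (hn : (3 <= n)%N) (h0_gt0 : 0 < h0).
Local Notation N := (n + 1)%N.
Local Notation m := n.-1.
Local Notation hi k := (lshift 1 k : 'I_N).
Local Notation vi := (rshift n (@ord0 0) : 'I_N).
Local Notation leb1 := (@lebesgue_measure R).
Local Notation dom := (@cat_dom R n h0).
Local Notation h := (@cat_h R n h0).
Local Notation u := (cat_u n h0).
Local Notation C := (@catenoid R n h0).
Local Notation U := (@cat_nbhd R n h0).
Local Notation ret := (@cat_retr R n h0).
Local Notation rho := (par_density n h0).
Local Notation pdom := (@par_dom R n h0).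
Local Notation prow := (@par_row R n).
Implicit Types (y z : 'rV[R]_N) (f g : 'rV[R]_N -> R^o) (v b : 'I_n -> R).

(** The data record horizontal translation [v], rotation of the axis [b], vertical translation [vv]
    and scaling [la]. The expression is linear in them, so the form is stable under linear
    combinations. *)
Definition rigid_form f v b (vv la : R) :=
  (forall y, C y -> f y =
    u (vpart y) * meridian_profile n h0 (cdir v y) vv la (cdir b y) (vpart y)) /\
  forall y, ~ C y -> f y = 0.

Lemma cdirD v b y : cdir (fun k => v k + b k) y = cdir v y + cdir b y.
Proof. by rewrite /cdir -big_split/=; apply: eq_bigr => k _; rewrite mulrDl. Qed.

Lemma cdirZ c v y : cdir (fun k => c * v k) y = c * cdir v y.
Proof. by rewrite /cdir mulr_sumr; apply: eq_bigr => k _; rewrite mulrA. Qed.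

Lemma cdir_0 y : cdir (fun=> 0) y = 0 :> R.
Proof. by rewrite /cdir big1// => k _; rewrite mul0r. Qed.

Lemma rigid_form0 : rigid_form 0 (fun=> 0) (fun=> 0) 0 0.
Proof. by split=> // y _; rewrite /meridian_profile !cdir_0 !(mul0r, mulr0) subr0 !addr0 mulr0. Qed.

Lemma rigid_formD f g v b vv la v' b' vv' la' :
  rigid_form f v b vv la -> rigid_form g v' b' vv' la' ->
  rigid_form (f + g) (fun k => v k + v' k) (fun k => b k + b' k) (vv + vv') (la + la').
Proof.
move=> [fE f0] [gE g0]; split=> y Cy.
  have -> : (f + g) y = f y + g y by [].
  by rewrite fE// gE// !cdirD /meridian_profile; ring.
have -> : (f + g) y = f y + g y by [].
by rewrite f0// g0// addr0.
Qed.

Lemma rigid_formZ (c : R) f v b vv la : rigid_form f v b vv la ->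
  rigid_form (c *: f) (fun k => c * v k) (fun k => c * b k) (c * vv) (c * la).
Proof.
move=> [fE f0]; split=> y Cy.
  have -> : (c *: f) y = c * f y by [].
  by rewrite fE// !cdirZ /meridian_profile; ring.
have -> : (c *: f) y = c * f y by [].
by rewrite f0// mulr0.
Qed.

(** The normal is [u (w, - h')], so only the component of [V] along [w] and its vertical component
    matter. *)
Lemma rigid_form_normal (V : 'rV[R]_N -> 'rV[R]_N) v b vv la :
  (forall y, C y -> \sum_k wdir k y * V y 0 (hi k) =
     cdir v y + la * h (vpart y) + vpart y * cdir b y) ->
  (forall y, C y -> V y 0 vi = vv + la * vpart y - h (vpart y) * cdir b y) ->
  rigid_form (normal_field h0 V) v b vv la.
Proof.
move=> Vh Vv; split=> y Cy; last by rewrite /normal_field memNset.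
have Uy := catenoid_nbhd hn h0_gt0 Cy.
rewrite /normal_field mem_set// dotpE sum_split cat_nu_v// Vv//.
have -> : \sum_k cat_nu h0 y 0 (hi k) * V y 0 (hi k) =
    u (vpart y) * (cdir v y + la * h (vpart y) + vpart y * cdir b y).
  by rewrite -Vh// mulr_sumr; apply: eq_bigr => k _; rewrite cat_nu_h// -mulrA.
by rewrite /meridian_profile; ring.
Qed.

Lemma catenoid_hcoord y k : C y -> y 0 (hi k) = h (vpart y) * wdir k y.
Proof. by move=> /(catenoidP hn h0_gt0)[Uy ry]; rewrite -[in LHS]ry ret_coord. Qed.

Lemma rigid_form_transl i : exists v b vv la, rigid_form (transl_field n h0 i) v b vv la.
Proof.
rewrite /transl_field; move: i; apply: split_ind => [k|].
  exists (fun j => (j == k)%:R), (fun=> 0), 0, 0.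
  apply: rigid_form_normal => y Cy; rewrite cdir_0 !(mul0r, mulr0, addr0, subr0).
    by apply: eq_bigr => j _; rewrite /evec mxE/= (inj_eq (@lshift_inj _ _)) mulrC.
  by rewrite /evec mxE/= eq_rlshift.
exists (fun=> 0), (fun=> 0), 1, 0.
apply: rigid_form_normal => y Cy; rewrite !cdir_0 !(mul0r, mulr0, addr0, subr0).
  by apply: big1 => j _; rewrite /evec mxE/= eq_lrshift mulr0.
by rewrite /evec mxE !eqxx.
Qed.

Lemma rigid_form_scaling : rigid_form (@scaling_field R n h0) (fun=> 0) (fun=> 0) 0 1.
Proof.
apply: rigid_form_normal => y Cy; rewrite !cdir_0 !(mul0r, mulr0, mul1r, add0r, addr0, subr0).
  have Uy := catenoid_nbhd hn h0_gt0 Cy.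
  rewrite -[RHS]mulr1 -(sum_wdir2 Uy) mulr_sumr; apply: eq_bigr => k _.
  by rewrite catenoid_hcoord// mulrCA.
by rewrite vpartE.
Qed.

(** Rotations about the axis preserve the catenoid: the horizontal block of [Q] enters through the
    quadratic form of a skew matrix, which is zero. The last column of [Q] remains, and skewness
    links it to the last row. *)
Lemma rigid_form_rot (Q : 'M[R]_N) : Q^T = - Q ->
  rigid_form (@rot_field R n h0 Q) (fun=> 0) (fun k => Q (hi k) vi) 0 0.
Proof.
move=> QT; have QE i j : Q i j = - Q j i.
  by have := congr1 (fun B : 'M[R]_N => B j i) QT; rewrite !mxE.
have VE y i : C y -> (Q *m y^T)^T 0 i =
    h (vpart y) * (\sum_j Q i (hi j) * wdir j y) + vpart y * Q i vi.
  move=> Cy; have -> : (Q *m y^T)^T 0 i = \sum_j Q i j * y 0 j.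
    by rewrite mxE mxE; apply: eq_bigr => j _; rewrite mxE.
  rewrite sum_split -vpartE mulr_sumr [vpart y * _]mulrC; congr (_ + _).
  by apply: eq_bigr => j _; rewrite catenoid_hcoord// mulrCA.
apply: rigid_form_normal => y Cy; rewrite ?cdir_0 !(mul0r, add0r).
  under eq_bigr do rewrite VE// mulrDr.
  rewrite big_split/=.
  have -> : \sum_k wdir k y * (vpart y * Q (hi k) vi) =
      vpart y * cdir (fun k => Q (hi k) vi) y.
    by rewrite /cdir mulr_sumr; apply: eq_bigr => k _; rewrite mulrCA (mulrC (wdir k y)).
  suff -> : \sum_k wdir k y * (h (vpart y) * \sum_j Q (hi k) (hi j) * wdir j y) = 0.
    by rewrite add0r.
  pose S := \sum_k \sum_j wdir k y * (Q (hi k) (hi j) * wdir j y).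
  have S0 : S = - S.
    rewrite {1}/S exchange_big/= /S -sumrN; apply: eq_bigr => j _.
    rewrite -sumrN; apply: eq_bigr => k _; rewrite QE.
    by move: (wdir j y) (wdir k y) (Q _ _) => a b c; ring.
  have -> : \sum_k wdir k y * (h (vpart y) * \sum_j Q (hi k) (hi j) * wdir j y) =
      h (vpart y) * S.
    by rewrite /S mulr_sumr; apply: eq_bigr => k _; rewrite -mulr_sumr mulrCA.
  by rewrite (_ : S = 0) ?mulr0//; lra.
rewrite VE//.
have -> : Q vi vi = 0 by have := QE vi vi; lra.
rewrite mulr0 addr0 -mulrN; congr (_ * _); rewrite /cdir -sumrN.
by apply: eq_bigr => j _; rewrite QE mulNr.
Qed.

Lemma rigid_form_RMJF f : RMJF n h0 f -> exists v b vv la, rigid_form f v b vv la.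
Proof.
move=> [k [c [g [gS ->]]]].
apply: (big_ind (fun f => exists v b vv la, rigid_form f v b vv la)).
- by exists (fun=> 0), (fun=> 0), 0, 0; exact: rigid_form0.
- move=> f1 f2 [v [b [vv [la F1]]]] [v' [b' [vv' [la' F2]]]].
  by exists (fun k => v k + v' k), (fun k => b k + b' k), (vv + vv'), (la + la');
    exact: rigid_formD.
move=> i _; have [v [b [vv [la F]]]] : exists v b vv la, rigid_form (g i) v b vv la.
  have [[[j _ <-]|->]|[Q QT <-]] := gS i.
  - exact: rigid_form_transl.
  - by exists (fun=> 0), (fun=> 0), 0, 1; exact: rigid_form_scaling.
  - by exists (fun=> 0), (fun k => Q (hi k) vi), 0, 0; exact: rigid_form_rot.
by exists (fun k => c i * v k), (fun k => c i * b k), (c i * vv), (c i * la);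
  exact: rigid_formZ.
Qed.

Variable Rad : R.
Hypothesis Rad_gt0 : 0 < Rad.

(** The inverse weight is the larger of [Rad^2] and [|y|^2 = h^2 + t^2]. Here
    [Rad^2 <= (Rad^2 / h0^2) h^2] and [t^2 <= pi^2 h^2], whence the three summands of the
    constant. *)
Lemma weight_lower y : U y ->
  (Rad ^+ 2 / h0 ^+ 2 + 1 + pi ^+ 2)^-1 / h (vpart y) ^+ 2 <= weight n Rad (ret y).
Proof.
move=> Uy; have dy := nbhd_dom Uy; have hp := nbhd_h hn h0_gt0 Uy.
have hg := cat_h_ge hn h0_gt0 dy.
have M0 : 0 < Num.max Rad (enorm (ret y)) by rewrite lt_max Rad_gt0.
have W0 : 0 < Rad ^+ 2 / h0 ^+ 2 + 1 + pi ^+ 2.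
  by rewrite ltr_wpDr ?sqr_ge0// ltr_wpDl// divr_ge0// sqr_ge0.
rewrite weightE -invfM lef_pV2 ?posrE ?exprn_gt0//; last by rewrite mulr_gt0// exprn_gt0.
have eE : enorm (ret y) ^+ 2 = h (vpart y) ^+ 2 + vpart y ^+ 2.
  by rewrite sqr_enorm dotp_split -sqr_enorm rad_ret// vpart_ret -expr2.
have t2 : vpart y ^+ 2 <= pi ^+ 2 * h (vpart y) ^+ 2.
  rewrite -exprMn -real_normK ?num_real// lerXn2r ?nnegrE ?mulr_ge0 ?pi_ge0 ?(ltW hp)//.
  apply: le_trans (ltW (cat_dom_lt hn h0_gt0 dy)) _.
  by rewrite mulrC ler_wpM2l// pi_ge0.
have R2 : Rad ^+ 2 <= Rad ^+ 2 / h0 ^+ 2 * h (vpart y) ^+ 2.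
  rewrite -mulrA ler_peMr ?sqr_ge0// mulrC ler_pdivlMr ?exprn_gt0// mul1r.
  by rewrite lerXn2r ?nnegrE ?(ltW h0_gt0) ?(ltW hp).
have h2 : 0 <= h (vpart y) ^+ 2 by exact: sqr_ge0.
have v2 : 0 <= vpart y ^+ 2 by exact: sqr_ge0.
have R0 : 0 <= Rad ^+ 2 by exact: sqr_ge0.
have key (A P H T Q E M : R) : E = H + T -> T <= P * H -> Q <= A * H -> 0 <= H -> 0 <= T ->
    0 <= Q -> M = Q \/ M = E -> M <= (A + 1 + P) * H.
  by rewrite !mulrDl mul1r => ? ? ? ? ? ? [] ->; lra.
by apply: key eE t2 R2 h2 v2 R0 _; case: leP => _; [right|left].
Qed.

Lemma dotp_continuous (a : 'rV[R]_n) : continuous (fun x => dotp a x).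
Proof.
move=> x; apply: (@differentiable_continuous _ _ R^o).
by have [] := has_grad_sum (fun i => has_gradM (has_grad_cst (a 0 i) x) (has_grad_coord i x)).
Qed.

(* By Fubini almost every meridian carries an integrable trace of f^2 weight;
   b' selects a meridian in an open set of directions. *)
Lemma rigid_weight_section f v b vv la (b' : 'I_n -> R) k0 : b' k0 != 0 ->
  rigid_form f v b vv la -> W12 n h0 (weight n Rad) f ->
  exists y, [/\ U y, cdir b' y != 0, cdir b y = 0, vv = 0 & la = 0].
Proof.
move=> bk [fE _] [_ _ fw].
pose F y : R := f y ^+ 2 * weight n Rad y.
pose r := par_pull h0 F \_ pdom.
have ir : (prod_meas leb1 (ms_meas (leb R n))).-integrable setT (EFin \o r).
  have := (integrable_mkcond _ (@measurable_par_dom R n h0)).1 fw.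
  by apply: eq_integrable => // p _; rewrite -restrict_EFin.
have ae := @ae_integrable2 _ _ _ _ _ leb1 (ms_meas (leb R n)) _ ir.
pose a := \row_k b' k : 'rV[R]_n.
pose O := [set x : 'rV[R]_n | enorm x < 1 /\ dotp a x != 0].
have oO : open O.
  have o1 : open ((@enorm R n) @^-1` [set z : R | z < 1]).
    by apply: open_comp => [x _|]; [exact: enorm_continuous|exact: open_lt].
  have o2 : open (dotp a @^-1` [set z : R | z != 0]).
    by apply: open_comp => [x _|]; [exact: dotp_continuous|exact: open_neq].
  exact: openI o1 o2.
have eE : dotp (evec k0) (evec k0 : 'rV[R]_n) = 1.
  rewrite dotpE (bigD1 k0)//= /evec !mxE !eqxx mulr1 big1 ?addr0// => j jk.
  by rewrite !mxE (negbTE jk) mulr0.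
have O0 : O !=set0.
  exists (2^-1 *: evec k0); split.
    rewrite enormZ ger0_norm// /enorm eE// sqrtr1 mulr1; lra.
  rewrite dotpC dotpZ mulf_neq0// ?invr_eq0// dotpE (bigD1 k0)//= /evec !mxE !eqxx mul1r.
  by rewrite big1 ?addr0// => j jk; rewrite !mxE (negbTE jk) mul0r.
have [x [[x1 ax] ix]] := ae_open_exists oO O0 ae.
have x0 : leb_row x != 0.
  by apply: contra ax => /eqP ->; rewrite dotpC -(scale0r 0) dotpZ mul0r.
have ex : 0 < enorm (leb_row x) by rewrite enorm_gt0.
have Ut t : dom t -> U (prow (t, x)) by move=> dt; exact: unit_nbhd.
have d0 := cat_dom0 hn h0_gt0.
have cdE c t : cdir c (prow (t, x)) = cdir c (prow (0, x)).
  by rewrite /cdir; apply: eq_bigr => k _; rewrite /wdir !hpart_row !row_mxEl.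
have vt t : vpart (prow (t, x)) = t by rewrite vpart_row.
pose W := Rad ^+ 2 / h0 ^+ 2 + 1 + pi ^+ 2.
have W0 : 0 < W.
  by rewrite ltr_wpDr ?sqr_ge0// ltr_wpDl// divr_ge0// sqr_ge0.
have c0 : 0 < n%:R * h0 ^+ m / W.
  by rewrite divr_gt0// mulr_gt0 ?exprn_gt0// ltr0n; case: n hn.
have [L L0 LP] := cat_length hn h0_gt0.
have lower t : dom t -> n%:R * h0 ^+ m / W *
    (meridian_profile n h0 (cdir v (prow (0, x))) vv la (cdir b (prow (0, x))) t / h t) ^+ 2
    <= r (t, x).
  move=> dt; have Uy := Ut t dt.
  have -> : r (t, x) = par_pull h0 F (t, x).
    by rewrite /r patchT// inE; split=> //=; rewrite ex.
  rewrite par_pullE/= /F fE; last exact: ret_catenoid.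
  rewrite vpart_ret !cdir_ret// !cdE vt.
  set P := meridian_profile _ _ _ _ _ _ _.
  have wl := weight_lower Uy; rewrite vt -/W in wl.
  have -> : (u t * P) ^+ 2 * weight n Rad (ret (prow (t, x))) * rho t =
      n%:R * h0 ^+ m * P ^+ 2 * weight n Rad (ret (prow (t, x))).
    by rewrite -(density_u hn h0_gt0 dt); ring.
  have -> : n%:R * h0 ^+ m / W * (P / h t) ^+ 2 =
      n%:R * h0 ^+ m * P ^+ 2 * (W^-1 / h t ^+ 2).
    by rewrite expr_div_n; ring.
  apply: ler_wpM2l => //; apply: mulr_ge0; last exact: sqr_ge0.
  by rewrite mulr_ge0// exprn_ge0// ltW.
have [b0 vv0 la0] := section_vanish hn h0_gt0 L0 LP ix c0 lower.
exists (prow (0, x)); split=> //; first exact: Ut.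
have -> : cdir b' (prow (0, x)) = dotp a (leb_row x) / enorm (leb_row x).
  rewrite /cdir dotpE mulr_suml; apply: eq_bigr => k _.
  by rewrite /wdir hpart_row row_mxEl [a _ _]mxE mulrA.
by rewrite mulf_neq0// invr_eq0 gt_eqF.
Qed.

Lemma rigid_weight_transl f : RMJF n h0 f -> W12 n h0 (weight n Rad) f ->
  exists v, f = \sum_k v k *: transl_field n h0 (hi k).
Proof.
move=> /rigid_form_RMJF[v [b [vv [la F]]]] fW.
(* Selecting the meridian by [b] itself makes [cdir b y] both nonzero and zero. *)
have b0 k : b k = 0.
  apply/eqP/negP => /negP bk.
  by have [y [_ /eqP]] := rigid_weight_section bk F fW.
have n0 : (0 < n)%N by exact: leq_trans hn.
(* With [b] gone any meridian will do; the constant vector 1 merely selects one. *)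
have [|y [_ _ _ vv0 la0]] := @rigid_weight_section f v b vv la (fun=> 1) (Ordinal n0) _ F fW.
  exact: oner_neq0.
have [fE f0] := F.
exists v; apply/funext => y'; have [Cy|nCy] := pselect (C y').
  rewrite (sum_transl_field_in hn h0_gt0)// fE// vv0 la0 /meridian_profile.
  have -> : cdir b y' = 0 by rewrite /cdir big1// => k _; rewrite b0 mul0r.
  by rewrite !(mul0r, mulr0) subr0 !addr0.
rewrite f0// sum_transl_fieldE big1// => k _.
by rewrite transl_field_out// mulr0.
Qed.

End RigidMotionFields.

(** The three spaces form a cycle of inclusions: combinations of horizontal translation fields lie
    in [W12] with weight 1, this space lies in the weighted one, and a rigid-motion field in the
    weighted one is such a combination. The independence of the [n] fields gives the lower bound on
    the nullity, and the same inclusion of spaces compares the two nullities. *)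
Theorem mainTheorem5 (R : realType) (n : nat) (h0 Rad : R)
    (hn : (3 <= n)%N) (hh0 : 0 < h0) (hRad : h0 < Rad) :
  [/\ RMJF n h0 `&` W12 n h0 (fun=> 1) = RMJF n h0 `&` W12 n h0 (weight n Rad),
      RMJF n h0 `&` W12 n h0 (weight n Rad) =
        lspan (range (fun i : 'I_n => transl_field n h0 (lshift 1 i))),
      (n%:R%:E <= nul n h0 (fun=> 1%R))%E
    & (nul n h0 (fun=> 1%R) <= nul n h0 (weight n Rad))%E].
Proof.
have Rad0 : 0 < Rad by exact: lt_trans hRad.
have sub f : W12 n h0 (fun=> 1) f -> W12 n h0 (weight n Rad) f.
  exact: W12_weight.
have comb (v : 'I_n -> R) :
    (RMJF n h0 `&` W12 n h0 (fun=> 1)) (\sum_k v k *: transl_field n h0 (lshift 1 k)).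
  split.
    exists n, v, (fun k => transl_field n h0 (lshift 1 k)); split=> // k.
    by left; left; exists (lshift 1 k).
  by apply: (W12_comb hn hh0) => y Cy; exact: sum_transl_field_in.
have span f : (RMJF n h0 `&` W12 n h0 (weight n Rad)) f ->
    exists v : 'I_n -> R, f = \sum_k v k *: transl_field n h0 (lshift 1 k).
  by move=> [fR fW]; exact: rigid_weight_transl fR fW.
split.
- apply/seteqP; split=> f [fR fW]; first by split=> //; exact: sub.
  by have [|v ->] := span f; first by [].
- apply/seteqP; split=> f.
    by move=> /span[v ->]; apply/lspan_range; exists v.
  by move=> /lspan_range[v ->]; have [? ?] := comb v; split=> //; exact: sub.
- apply: le_dimension_independent (independent_transl hn hh0) => k; split.
    exact: jacobi_transl.
  by apply: (W12_comb hn hh0) => y Cy; exact: transl_field_cdir.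
- by apply: dimension_le => f [fJ fW]; split=> //; exact: sub.
Qed.
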